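(* Let $0<\alpha\le1$, let $\{\mathcal{S}^\alpha(t)\}_{t\ge0}$ be the generalized fractional Skellam process with rates $\lambda_j,\mu_j>0$, $j=1,\dots,k$, let $\{D_f(t)\}_{t\ge0}$ be an independent Lévy subordinator with $\mathbb{E}(D_f^r(t))<\infty$ for all $r>0$, and let $\mathcal{Z}_f^\alpha(t)=\mathcal{S}^\alpha(D_f(t))$. Put $m_1=\sum_{j=1}^kj(\lambda_j-\mu_j)$, $m_2=\sum_{j=1}^kj^2(\lambda_j+\mu_j)$, $l_1=m_1/\Gamma(1+\alpha)$, $l_2=m_2/\Gamma(1+\alpha)$, $d=\alpha l_1^2B(\alpha,1+\alpha)$. Then for $0<s\le t<\infty$, $$\mathbb{E}(\mathcal{Z}_f^\alpha(t))=l_1\mathbb{E}(D_f^\alpha(t)),$$ $$\operatorname{Var}(\mathcal{Z}_f^\alpha(t))=\mathbb{E}(D_f^\alpha(t))\big(l_2-l_1^2\mathbb{E}(D_f^\alpha(t))\big)+2d\,\mathbb{E}(D_f^{2\alpha}(t)),$$ $$\operatorname{Cov}(\mathcal{Z}_f^\alpha(s),\mathcal{Z}_f^\alpha(t))=l_2\mathbb{E}(D_f^\alpha(s))+d\,\mathbb{E}(D_f^{2\alpha}(s))-l_1^2\mathbb{E}(D_f^\alpha(s))\mathbb{E}(D_f^\alpha(t))+l_1^2\alpha\,\mathbb{E}\big(D_f^{2\alpha}(t)B(\alpha,\alpha+1;D_f(s)/D_f(t))\big).$$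
   Context: Fix an integer $k\ge1$ and positive rates $\lambda_1,\dots,\lambda_k,\mu_1,\dots,\mu_k$. The generalized counting process (GCP) with rates $\lambda_1,\dots,\lambda_k$ is a Lévy process started at $0$ performing jumps of size $j\in\{1,\dots,k\}$ at rate $\lambda_j$. The generalized Skellam process (GSP) is $\mathcal{S}(t)=M_1(t)-M_2(t)$, with $M_1,M_2$ independent GCPs with rates $\lambda_j$ and $\mu_j$, respectively. For $0<\alpha<1$, the inverse stable subordinator is $Y_\alpha(t)=\inf\{x\ge0: D_\alpha(x)>t\}$, where $D_\alpha$ is the stable subordinator, $\mathbb{E}(e^{-sD_\alpha(t)})=e^{-ts^\alpha}$. The generalized fractional Skellam process (GFSP) is $\mathcal{S}^\alpha(t)=\mathcal{S}(Y_\alpha(t))$ for $0<\alpha<1$ with $\mathcal{S}$ and $Y_\alpha$ independent, and $\mathcal{S}^1(t)=\mathcal{S}(t)$. A Lévy subordinator $\{D_f(t)\}_{t\ge0}$ is a one-dimensional Lévy process with non-decreasing sample paths, $D_f(0)=0$ a.s., and $\mathbb{E}(e^{-sD_f(t)})=e^{-tf(s)}$, $s>0$, where $f$ is its Bernštein function. The process $\mathcal{Z}_f^\alpha$ is called the time-changed generalized fractional Skellam process-I (TCGFSP-I). $B(a,b)$ is the beta function and $B(a,b;x)=\int_0^xu^{a-1}(1-u)^{b-1}\mathrm{d}u$ is the incomplete beta function. *)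

(* Defs.v *)
From HB Require Import structures.
From mathcomp Require Import all_boot all_order all_algebra.
From mathcomp Require Import all_classical all_reals all_analysis.
Set Implicit Arguments.
Unset Strict Implicit.
Unset Printing Implicit Defensive.
Import Order.TTheory GRing.Theory Num.Theory.
Import numFieldNormedType.Exports.

Local Open Scope classical_set_scope.
Local Open Scope ring_scope.

Section special_functions.
Context {R : realType}.
Local Notation mu := (@lebesgue_measure R).

Definition Gamma (x : R) : R :=
  \int[mu]_(u in `]0, +oo[) (u `^ (x - 1) * expR (- u)).

(* Only meant for a, b > 0 and 0 <= x <= 1. The library's [beta_fun] has
   natural number parameters only. *)
Definition incomplete_beta (a b x : R) : R :=
  \int[mu]_(u in `[0, x]) (u `^ (a - 1) * (1 - u) `^ (b - 1)).

Definition beta (a b : R) : R := incomplete_beta a b 1.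

End special_functions.

(* A process is a map [X : R -> T -> R], of which only the times [t >= 0] are
   meaningful: its values at negative times are never constrained. *)
Section processes.
Context {d : measure_display} {T : measurableType d} {R : realType}.
Variable P : probability T R.
Implicit Types X Y D : R -> T -> R.

Definition stochastic_process X : Prop :=
  forall t : R, 0 <= t -> measurable_fun setT (X t).

Definition process_sigma_algebra X : set (set T) :=
  <<s [set A | exists t : R, exists2 B : set R,
         0 <= t /\ measurable B & A = X t @^-1` B] >>.

Definition independent_processes X Y : Prop :=
  [/\ stochastic_process X, stochastic_process Y &
      forall A B, process_sigma_algebra X A -> process_sigma_algebra Y B ->
        P (A `&` B) = (P A * P B)%E].

(* Some [B i] may be [setT], hence the product rule for all subfamilies. *)
Definition mutually_independent (n : nat) (V : 'I_n -> T -> R) : Prop :=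
  forall B : 'I_n -> set R, (forall i, measurable (B i)) ->
    P (\bigcap_i (V i @^-1` B i)) = (\prod_(i < n) P (V i @^-1` B i))%E.

(* [t 0 = 0] is allowed, and [X 0 = 0] almost surely for a Levy process, so
   that the initial value need not be listed among the increments. *)
Definition independent_increments X : Prop :=
  forall (n : nat) (t : nat -> R), 0 <= t 0%N -> (forall i, t i < t i.+1) ->
    @mutually_independent n (fun i w => X (t i.+1) w - X (t i) w).

Definition stationary_increments X : Prop :=
  forall s t : R, 0 <= s -> s < t -> forall B : set R, measurable B ->
    P [set w | B (X t w - X s w)] = P [set w | B (X (t - s) w)].

Definition cadlag (x : R -> R) : Prop :=
  (forall t : R, 0 <= t -> x u @[u --> t^'+] --> x t) /\
  (forall t : R, 0 < t -> cvg (x u @[u --> t^'-])).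

Definition levy_process X : Prop :=
  [/\ stochastic_process X,
      {ae P, forall w, X 0 w = 0},
      independent_increments X,
      stationary_increments X &
      {ae P, forall w, cadlag (X ^~ w)}].

Definition levy_subordinator (f : R -> R) D : Prop :=
  [/\ levy_process D,
      {ae P, forall w (s t : R), 0 <= s -> s <= t -> D s w <= D t w} &
      forall s t : R, 0 < s -> 0 <= t ->
        ('E_P[fun w => expR (- s * D t w)%R] = (expR (- t * f s)%R)%:E)%E].

Definition stable_subordinator (alpha : R) D : Prop :=
  levy_subordinator (fun s => s `^ alpha) D.

(* The real-valued [inf] is 0 on the empty set; for a stable subordinator the
   set is almost surely nonempty. *)
Definition inverse_process D : R -> T -> R :=
  fun t w => inf [set x | 0 <= x /\ t < D x w].

(* Jumps of size j happen at rate lambda_j, in the infinitesimal sense: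
   P(M(h) = j) = lambda_j h + o(h) for 1 <= j <= k and P(M(h) > k) = o(h) as
   h decreases to 0. The index [i : 'I_k] stands for the jump size [i.+1]. *)
Definition generalized_counting_process (k : nat) (lambda : 'I_k -> R)
    (M : R -> T -> nat) : Prop :=
  [/\ levy_process (fun t w => (M t w)%:R),
      forall i : 'I_k,
        fine (P [set w | M h w = i.+1]) / h @[h --> 0^'+] --> lambda i &
      fine (P [set w | (k < M h w)%N]) / h @[h --> 0^'+] --> (0 : R)].

Definition generalized_skellam_process (k : nat) (lambda mu : 'I_k -> R)
    (S : R -> T -> R) : Prop :=
  exists M1 M2 : R -> T -> nat,
    [/\ generalized_counting_process lambda M1,
        generalized_counting_process mu M2,
        independent_processes (fun t w => (M1 t w)%:R) (fun t w => (M2 t w)%:R)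
      & forall (t : R) w, 0 <= t -> S t w = (M1 t w)%:R - (M2 t w)%:R].

Definition generalized_fractional_skellam_process (alpha : R) (k : nat)
    (lambda mu : 'I_k -> R) (Sa : R -> T -> R) : Prop :=
  if alpha == 1 then generalized_skellam_process lambda mu Sa
  else exists S D : R -> T -> R,
    [/\ generalized_skellam_process lambda mu S,
        stable_subordinator alpha D,
        independent_processes S (inverse_process D) &
        forall (t : R) w, 0 <= t -> Sa t w = S (inverse_process D t w) w].

Definition time_change X D : R -> T -> R := fun t w => X (D t w) w.

End processes.

(* Main.v *)
Require Import Defs.
From HB Require Import structures.
From mathcomp Require Import all_boot all_order all_algebra.
From mathcomp Require Import all_classical all_reals all_analysis.
From mathcomp Require Import measurable_realfun ring lra.
Set Implicit Arguments.
Unset Strict Implicit.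
Unset Printing Implicit Defensive.
Import Order.TTheory GRing.Theory Num.Theory.
Import numFieldNormedType.Exports.

Local Open Scope classical_set_scope.
Local Open Scope ring_scope.

(** Both S^alpha and Z are time changes X(C) of a process X by an independent
    nondecreasing process C >= 0. If E X(a) = e(a) and E X(a)X(b) = h(a,b) for
    a <= b, then freezing C gives E X(C_t) = E e(C_t) and E X(C_s)X(C_t) =
    E h(C_s,C_t). Since X need not be jointly measurable, X is replaced by a
    jointly measurable version, equal to X almost surely by right continuity.

    For the Skellam process, e(a) = m1 a and h(a,b) = m2 a + m1^2 a b; these
    come from the Laplace transform of a counting process, which stationarity,
    independence and the infinitesimal rates force to be exp (- t psi).

    For the inverse Y of the stable subordinator D, Y_t is the Lebesgue measure
    of the set of x >= 0 with D_x <= t. By uniqueness of Laplace transforms the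
    expected occupation measure of D has density
    rho(u) = alpha u^(alpha - 1) / Gamma(1 + alpha) on u > 0, since both have
    transform s^(- alpha). Hence E Y_t = t^alpha / Gamma(1 + alpha), and writing
    E Y_s Y_t as a double integral of P(D_x <= s, D_y <= t), split along the
    diagonal, independence of increments gives two integrals of
    (r - u)^alpha rho(u) over u <= s, for r = t and r = s, that is incomplete
    beta functions. *)

(** * Integrals and independence *)

(** Two features of the hypotheses shape the proof. Path properties hold only almost surely and [P]
    need not be complete, so a pathwise limit may fail to be a random variable: integrals are
    compared across null sets without measurability, which is carried by versions built from
    countably many times. Independence concerns generated sigma-algebras; such a version of X is
    still measurable for the sigma-algebra of X, which makes freezing legitimate. Integrability of
    the composite is derived: [x] and [x y] are dominated by [1 + x^2 + y^2], so finiteness of E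
    h(C_t, C_t) is the condition to check, and for Z it reduces to the moments of D_f of orders
    alpha and 2 alpha.

    The transform s^(- alpha) of the occupation measure is the integral over x >= 0 of E exp(- s
    D_x) = exp(- x s^alpha). The incomplete beta function of the statement comes from the half x < y
    of E Y_s Y_t. In the other half the later point must already satisfy D_x <= s, which implies the
    condition on the earlier one; that half yields the complete beta value, hence d. *)

Section integral_ae.
Context d (T : measurableType d) (R : realType).
Variable mu : {measure set T -> \bar R}.
Local Open Scope ereal_scope.
Import HBNNSimple.

(* Unlike [ge0_ae_eq_integral], no measurability is required: the integral of
   a nonnegative function is a supremum over simple functions, and these may
   be cut off on the null set. *)
Let ae_le_nnintegral (f g : T -> \bar R) :
  (forall x, 0 <= f x) -> (forall x, 0 <= g x) ->
  {ae mu, forall x, f x = g x} -> \int[mu]_x f x <= \int[mu]_x g x.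
Proof.
move=> f0 g0 [N [mN N0 subN]].
rewrite !ge0_integralTE//; apply: ge_ereal_sup => _ [h /= hf <-].
pose h' := proj_nnsfun h (measurableC mN).
apply: (@le_trans _ _ (sintegral mu h')); last first.
  apply: ereal_sup_ubound; exists h' => //= x.
  rewrite /mindic indicE.
  have [xN|xN] := pselect (N x).
    by rewrite memNset ?mulr0//= => /(_ xN).
  rewrite mem_set//= mulr1.
  have <- // : f x = g x by apply: contrapT => fg; exact/xN/subN.
rewrite -!integralT_nnsfun le_eqVlt; apply/orP; left; apply/eqP.
apply: ge0_ae_eq_integral => //.
- exact/measurable_EFinP.
- exact/measurable_EFinP.
- by move=> x _; rewrite lee_fin.
- by move=> x _; rewrite lee_fin.
- exists N; split => // x /=; apply: contra_notP => xN _ /=.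
  by rewrite /mindic indicE mem_set ?mulr1.
Qed.

Lemma eq_ae_integralT (f g : T -> \bar R) :
  {ae mu, forall x, f x = g x} -> \int[mu]_x f x = \int[mu]_x g x.
Proof.
move=> fg; rewrite integralE [RHS]integralE.
have fgp : {ae mu, forall x, f^\+ x = g^\+ x}.
  by apply: filterS fg => x; rewrite !unlock => ->.
have fgn : {ae mu, forall x, f^\- x = g^\- x}.
  by apply: filterS fg => x; rewrite !unlock => ->.
have sym (u v : T -> \bar R) : {ae mu, forall x, u x = v x} ->
    {ae mu, forall x, v x = u x} by apply: filterS.
by congr (_ - _); apply/eqP; rewrite eq_le !ae_le_nnintegral//; apply: sym.
Qed.

End integral_ae.

Lemma integral_pushforwardT d1 d2 (X : measurableType d1)
    (Y : measurableType d2) (R : realType) (phi : X -> Y)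
    (mu : {measure set X -> \bar R}) (f : Y -> \bar R) :
  measurable_fun setT phi -> measurable_fun setT f ->
  (\int[pushforward mu phi]_y f y = \int[mu]_x f (phi x))%E.
Proof.
move=> mphi mf; rewrite [LHS]integralE [RHS]integralE.
congr (_ - _)%E; rewrite ge0_integral_pushforward //.
- by apply: eq_integral => x _; rewrite /= !unlock.
- exact: measurable_funepos.
- by apply: eq_integral => x _; rewrite /= !unlock.
- exact: measurable_funeneg.
Qed.

(** * Fubini's theorem for two independent random elements *)

Section independent_pair.
Context d (T : measurableType d) (R : realType) (P : probability T R).
Context d1 (T1 : measurableType d1) d2 (T2 : measurableType d2).
Variables (p1 : T -> T1) (p2 : T -> T2).
Hypotheses (mp1 : measurable_fun setT p1) (mp2 : measurable_fun setT p2).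
Local Open Scope ereal_scope.
Hypothesis indep : forall A B, measurable A -> measurable B ->
  P (p1 @^-1` A `&` p2 @^-1` B) = P (p1 @^-1` A) * P (p2 @^-1` B).

Let X1 : {mfun T >-> T1} := mfun_Sub (mem_set mp1).
Let X2 : {mfun T >-> T2} := mfun_Sub (mem_set mp2).
Let p12 w := (p1 w, p2 w).
Let mp12 : measurable_fun setT p12.
Proof. exact/measurable_fun_pair. Qed.

(** Independence says that both measures agree on rectangles, and these determine a product
    measure. *)
Let law_pair A : measurable A ->
  (distribution P X1 \x distribution P X2) A = pushforward P p12 A.
Proof.
move=> mA.
exact: (@product_measure_unique _ _ _ _ _ (distribution P X1)
  (distribution P X2) (pushforward P p12)).
Qed.

Lemma ge0_integral_indep (F : T1 * T2 -> \bar R) : measurable_fun setT F ->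
  (forall x, 0 <= F x) ->
  \int[P]_w F (p1 w, p2 w) = \int[P]_v \int[P]_w F (p1 w, p2 v).
Proof.
move=> mF F0.
transitivity (\int[pushforward P p12]_z F z).
  by rewrite ge0_integral_pushforward.
transitivity (\int[distribution P X1 \x distribution P X2]_z F z).
  by apply: eq_measure_integral => A mA _; exact/esym/law_pair.
rewrite fubini_tonelli2//= ge0_integral_pushforward//=.
- apply: eq_integral => v _; rewrite /fubini_G ge0_integral_pushforward//.
  exact: measurableT_comp mF (measurable_fun_pair _ _).
- exact: (measurable_fun_fubini_tonelli_G F).
- by move=> y _; apply: integral_ge0.
Qed.

(** Integrability is asked of the iterated integral, the one that is computed in applications;
    Tonelli carries it over to the joint integrand, and then Fubini applies. *)
Lemma integral_indep (F : T1 * T2 -> \bar R) : measurable_fun setT F ->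
  \int[P]_v \int[P]_w `|F (p1 w, p2 v)| < +oo ->
  P.-integrable setT (fun w => F (p1 w, p2 w)) /\
  \int[P]_w F (p1 w, p2 w) = \int[P]_v \int[P]_w F (p1 w, p2 v).
Proof.
move=> mF Foo.
have mFw v : measurable_fun setT (fun x => F (x, p2 v)).
  exact: measurableT_comp mF (measurable_fun_pair _ _).
have iF : P.-integrable setT (F \o p12).
  apply/integrableP; split; first exact: measurableT_comp.
  have -> := ge0_integral_indep (F := abse \o F) (measurableT_comp _ mF) _ => //.
  by move=> x /=.
have iF12 : (distribution P X1 \x distribution P X2).-integrable setT F.
  apply/integrableP; split => //.
  rewrite (eq_measure_integral (pushforward P p12)); last first.
    by move=> A mA _; exact: law_pair.
  rewrite ge0_integral_pushforward//; last exact: measurableT_comp.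
  by case/integrableP : iF.
split => //.
transitivity (\int[pushforward P p12]_z F z).
  by rewrite integral_pushforwardT.
transitivity (\int[distribution P X1 \x distribution P X2]_z F z).
  by apply: eq_measure_integral => A mA _; exact/esym/law_pair.
rewrite -integral21_prod_meas1//.
rewrite [LHS]integral_pushforwardT//; last exact: (measurable_fubini_G iF12).
by apply: eq_integral => v _; rewrite /fubini_G; apply: integral_pushforwardT.
Qed.

End independent_pair.

(** Names the canonical measure structure on [pushforward], so that the image can be passed wherever
    a bundled measure is expected. *)
Definition image_measure d d' (T1 : measurableType d) (T2 : measurableType d')
    (R : realFieldType) (m : {measure set T1 -> \bar R}) (f : T1 -> T2)
    (mf : measurable_fun [set: T1] f) : {measure set T2 -> \bar R} :=
  measure_function_pushforward__canonical__measure_function_Measure m mf.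

Lemma integral_image_measure d d' (T1 : measurableType d)
    (T2 : measurableType d') (R : realType) (m : {measure set T1 -> \bar R})
    (f : T1 -> T2) (mf : measurable_fun [set: T1] f) D (g : T2 -> \bar R) :
  measurable D -> measurable_fun D g -> (forall x, D x -> 0 <= g x)%E ->
  (\int[image_measure m mf]_(x in D) g x = \int[m]_(x in f @^-1` D) g (f x))%E.
Proof.
move=> mD mg g0; apply: (ge0_integral_pushforward mf) => //.
by move=> y /set_mem/g0.
Qed.

(** * Affine substitutions, and measures determined by rays *)

Section lebesgue_affine.
Context {R : realType}.
Local Notation mu := (@lebesgue_measure R).

Let affine (c b : R) : measurableTypeR R -> measurableTypeR R :=
  fun x => c * x + b.

Let measurable_affine c b : measurable_fun setT (affine c b).
Proof. exact: measurable_funD (measurable_funM _ _) _. Qed.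

Let affine_measure (c b : R) (c0 : 0 < c) :
    {measure set (measurableTypeR R) -> \bar R} :=
  mscale (NngNum (ltW c0)) (image_measure mu (@measurable_affine c b)).

(** Lebesgue measure is determined by its values on half-open intervals; the preimage of []p, q]]
    has length [(q - p) / c], which the scaling by [c] restores. *)
Let lebesgue_affine_measure (c b : R) (c0 : 0 < c) A :
  measurable A -> mu A = affine_measure b c0 A.
Proof.
move=> mA.
have := @lebesgue_measure_unique R (affine_measure b c0).
move=> /(_ _ A mA) -> // _ [[p q] _ <-] /=.
rewrite /affine_measure /mscale/= /pushforward.
have -> : (fun x : R => c * x + b) @^-1` `]p, q] =
    `](p - b) / c, (q - b) / c]%classic.
  apply/seteqP; split => x /=; rewrite !in_itv/= ltr_pdivrMr// ler_pdivlMr//;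
  by rewrite ltrBlDr lerBrDr (mulrC x).
rewrite !lebesgue_measure_itv/= !lte_fin ltr_pM2r ?invr_gt0// ltrD2r.
case: ifPn => _; last by rewrite mule0.
rewrite -!EFinD -EFinM; congr _%:E; field.
by rewrite gt_eqF.
Qed.

Lemma ge0_integral_affine (c b : R) (f : R -> \bar R) : 0 < c ->
  measurable_fun setT f -> (forall x, 0 <= f x)%E ->
  (\int[mu]_x f x = c%:E * \int[mu]_x f (c * x + b)%R)%E.
Proof.
move=> c0 mf f0.
transitivity (\int[affine_measure b c0]_x f x)%E.
  apply: eq_measure_integral => A mA _.
  exact: lebesgue_affine_measure.
rewrite [LHS]ge0_integral_mscale//=; congr (_ * _)%E.
exact: (integral_image_measure mu (@measurable_affine c b) measurableT).
Qed.

(** As rays have finite mass, the masses of the intervals []a, b]] follow by subtraction; these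
    intervals are stable under intersection, generate the Borel sets and exhaust the line. *)
Lemma measure_eq_rays (m1 m2 : {measure set R -> \bar R}) :
  (forall t : R, m1 `]-oo, t]%classic = m2 `]-oo, t]%classic)%E ->
  (forall t : R, m1 `]-oo, t]%classic < +oo)%E ->
  forall A, measurable A -> m1 A = m2 A.
Proof.
move=> m12 m1oo A mA.
have mD (m : {measure set R -> \bar R}) (a b : R) :
    (m `]-oo, a]%classic < +oo)%E -> a <= b ->
    m `]a, b]%classic = (m `]-oo, b]%classic - m `]-oo, a]%classic)%E.
  move=> moo ab.
  have -> : `]-oo, b]%classic = `]-oo, a] `|` `]a, b] :> set R.
    by rewrite -itv_bndbnd_setU.
  rewrite measureU//.
    by rewrite addeAC subee ?add0e// ge0_fin_numE.
  by apply/seteqP; split => x //= []; rewrite !in_itv/= => ? /andP[]; lra.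
apply: (measure_unique (@ocitv R) (fun n => `]- n%:R, n%:R]%classic)) => //.
- exact: ocitvI.
- by move=> n; exact: is_ocitv.
- apply/seteqP; split => x // _.
  exists (Num.truncn `|x|).+1 => //=; rewrite in_itv/=.
  have := truncnS_gt `|x|; rewrite ltr_norml => /andP[? ?]; lra.
- move=> _ [[a b] _ <-] /=.
  have [ab|ba] := leP a b; last by rewrite !set_itv_ge ?measure0// bnd_simp -leNgt ltW.
  by rewrite (mD m1)// (mD m2)// -!m12.
- move=> k; apply: le_lt_trans (m1oo k%:R).
  by apply: le_measure; rewrite ?inE// => x; rewrite /= !in_itv/= => /andP[].
Qed.

End lebesgue_affine.

(** * Uniqueness of Laplace transforms *)

Section laplace_uniqueness.
Context {R : realType}.
Implicit Types (n : nat) (t x : R).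

(** With q = exp(- n x), the power (1 - q)^N behaves like exp(- N q), where N q is about n exp(n (t
    - x)). This vanishes for x > t and diverges for x <= t; the factor n is what makes it diverge at
    x = t, so that the limit is the closed ray. *)
Let N n t := Num.truncn (n%:R * expR (n%:R * t)).

(* The binomial kernel: a linear combination of [expR (- j * x)], [j > 0],
   which tends to the indicator function of [x <= t]. *)
Let K n t x := 1 - (1 - expR (- (n%:R * x))) ^+ N n t.

Let N_le n t : (N n t)%:R <= n%:R * expR (n%:R * t).
Proof. by rewrite truncn_le// mulr_ge0// expR_ge0. Qed.

Let expRN_le1 n x : 0 <= x -> 0 <= expR (- (n%:R * x)) <= 1.
Proof. by move=> x0; rewrite expR_ge0 -expR0 ler_expR oppr_le0 mulr_ge0. Qed.

Let K_ge0 n t x : 0 <= x -> 0 <= K n t x.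
Proof.
move=> /(expRN_le1 n) /andP[q0 q1]; rewrite subr_ge0 exprn_ile1//; lra.
Qed.

Let K_le1 n t x : 0 <= x -> K n t x <= 1.
Proof.
move=> /(expRN_le1 n) /andP[q0 q1].
by rewrite lerBlDr lerDl exprn_ge0// subr_ge0.
Qed.

Let K_le n t x : 0 <= x -> K n t x <= n%:R * expR (n%:R * (t - x)).
Proof.
move=> x0; have /andP[q0 q1] := expRN_le1 n x0.
rewrite /K; set q := expR _ in q0 q1 *.
have bernoulli m : 1 - m%:R * q <= (1 - q) ^+ m.
  elim: m => [|m ih]; first by rewrite mul0r subr0 expr0.
  rewrite exprS -natr1.
  have : (1 - q) * (1 - m%:R * q) <= (1 - q) * (1 - q) ^+ m.
    by rewrite ler_wpM2l// subr_ge0.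
  apply: le_trans; have : 0 <= m%:R * q * q by rewrite !mulr_ge0.
  lra.
have := bernoulli (N n t); have := ler_wpM2r q0 (N_le n t).
rewrite mulrBr expRD mulrA -/q; lra.
Qed.

(** Supplies one dominating function for all n. Up to x = t + 1 it is at least 1; beyond, [K_le]
    gives n exp(- n (x - t)), and all but one of the n exponential factors absorb the coefficient
    n. *)
Let K_dom n t x : 0 <= x -> (0 < n)%N -> K n t x <= expR (t + 1 - x).
Proof.
move=> x0 n0; have [xt|xt] := leP (x - t) 1.
  rewrite (le_trans (K_le1 _ _ x0))// -[leLHS]expR0 ler_expR; lra.
apply: (le_trans (K_le n t x0)).
case: n n0 => // n _.
have -> : n.+1%:R * (t - x) = (t + 1 - x) + (- (n%:R * (x - t)) - 1).
  by rewrite -natr1; ring.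
rewrite expRD mulrCA ler_piMr ?expR_ge0//.
have : 1 + n%:R <= expR (n%:R * (x - t)).
  apply: le_trans (expR_ge1Dx _); rewrite lerD2l ler_peMr//; lra.
rewrite expRD => h.
have e1 : expR (-1 : R) <= 1 by rewrite -[leRHS]expR0 ler_expR; lra.
rewrite mulrA; apply: (@le_trans _ _ (n.+1%:R * expR (- (n%:R * (x - t))))).
  by rewrite ler_piMr// mulr_ge0// expR_ge0.
by rewrite expRN ler_pdivrMr ?expR_gt0// mul1r -nat1r.
Qed.

Let K_cvg t x : 0 <= x -> K n.+1 t x @[n --> \oo] --> ((x <= t)%R%:R : R).
Proof.
move=> x0.
have [C hC] : exists C, forall n, `|(x <= t)%R%:R - K n.+1 t x| <= C * n.+1%:R^-1.
  have [xt|xt] := leP x t.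
    (* Here (1 - q)^N <= exp(- N q) <= 1 / (1 + N q), and 1 + N q is at least n + 1 up to the
       rounding in [N], which costs at most q <= 1. *)
    exists 1 => n; rewrite mul1r.
    have /andP[q0 q1] := expRN_le1 n.+1 x0.
    rewrite opprB addrC subrK ger0_norm ?exprn_ge0 ?subr_ge0//.
    set q := expR _ in q0 q1 *.
    apply: (@le_trans _ _ (expR (- ((N n.+1 t)%:R * q)))).
      have := expR_ge1Dx (- q); rewrite -mulrN expRM_natl.
      by apply: lerXn2r; rewrite ?nnegrE ?subr_ge0 ?expR_ge0.
    rewrite expRN lef_pV2 ?posrE ?expR_gt0//.
    apply: le_trans (expR_ge1Dx _).
    have h : n.+1%:R * expR (n.+1%:R * t) - 1 <= (N n.+1 t)%:R.
      have := truncnS_gt (n.+1%:R * expR (n.+1%:R * t)).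
      rewrite -/(N _ _) -natr1; lra.
    have := ler_wpM2r q0 h.
    have : n.+1%:R <= n.+1%:R * expR (n.+1%:R * t) * q.
      by rewrite -mulrA ler_peMr// -expRD -expR0 ler_expR -mulrBr mulr_ge0// subr_ge0.
    lra.
  (* The constant comes from exp(y) >= (y / 2)^2 at y = (n + 1) (x - t), applied to the bound
     [K_le]. *)
  exists (4 / (x - t) ^+ 2) => n.
  rewrite sub0r normrN ger0_norm ?K_ge0//; apply: (le_trans (K_le _ _ x0)).
  rewrite -[t - x]opprB mulrN expRN ler_pdivrMr ?expR_gt0//.
  set e := x - t; have e0 : 0 < e by rewrite subr_gt0.
  have h : n.+1%:R * e / 2 <= expR (n.+1%:R * e / 2).
    apply: le_trans (expR_ge1Dx _); lra.
  have -> : n.+1%:R * e = n.+1%:R * e / 2 + n.+1%:R * e / 2 by lra.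
  rewrite expRD.
  have h2 : (n.+1%:R * e / 2) ^+ 2 <= expR (n.+1%:R * e / 2) * expR (n.+1%:R * e / 2).
    rewrite -expr2; apply: lerXn2r; rewrite ?nnegrE ?expR_ge0 //.
    by rewrite !mulr_ge0// ltW.
  have c0 : 0 <= 4 / e ^+ 2 / n.+1%:R by rewrite !mulr_ge0// invr_ge0 ?exprn_ge0// ltW.
  apply: le_trans (ler_wpM2l c0 h2).
  rewrite le_eqVlt; apply/orP; left; apply/eqP; field.
  by rewrite !gt_eqF.
apply/cvgrPdist_le => /= e e0; near=> n.
rewrite (le_trans (hC n))//.
have [C0|C0] := leP C 0.
  by apply: le_trans (ltW e0); rewrite mulr_le0_ge0.
rewrite ler_pdivrMr// mulrC -ler_pdivrMr//; near: n.
exists (Num.truncn (C / e)) => // m /= hm.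
by rewrite ltW// (lt_le_trans (truncnS_gt _))// ler_nat ltnS.
Unshelve. all: by end_near. Qed.

Local Open Scope ereal_scope.
Let D : set R := `[0%R, +oo[%classic.

Let mD : measurable D. Proof. exact: measurable_itv. Qed.

Let D_ge0 x : D x -> (0 <= x)%R.
Proof. by rewrite /D/= in_itv/= andbT. Qed.

Let integrable_expRN (m : {measure set R -> \bar R}) n :
  \int[m]_(x in D) (expR (- x))%:E < +oo ->
  m.-integrable D (fun x => (expR (- x) ^+ n.+1)%:E).
Proof.
move=> moo; apply/integrableP; split.
  by apply/measurable_EFinP/measurable_funX; apply: measurableT_comp.
apply: le_lt_trans moo; apply: ge0_le_integral => //.
- by apply: measurableT_comp => //; apply/measurable_EFinP/measurable_funX; apply: measurableT_comp.
- by apply/measurable_EFinP; apply: measurableT_comp.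
- move=> x /D_ge0 x0; rewrite gee0_abs ?lee_fin ?exprn_ge0 ?expR_ge0//.
  by rewrite exprS ler_piMr ?expR_ge0// exprn_ile1 ?expR_ge0// -[leRHS]expR0 ler_expR oppr_le0.
Qed.

Let integral_expRN_poly (m : {measure set R -> \bar R}) (p : {poly R}) :
  \int[m]_(x in D) (expR (- x))%:E < +oo ->
  \int[m]_(x in D) (expR (- x) * p.[expR (- x)])%:E =
  \sum_(i < size p) (p`_i)%:E * \int[m]_(x in D) (expR (- x) ^+ i.+1)%:E.
Proof.
move=> moo.
transitivity (\int[m]_(x in D)
    \sum_(i < size p) (p`_i)%:E * (expR (- x) ^+ i.+1)%:E).
  apply: eq_integral => x _; rewrite horner_coef mulr_sumr -sumEFin.
  by apply: eq_bigr => i _; rewrite mulrCA -exprS EFinM.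
rewrite integral_sum//; last first.
  by move=> i; apply: integrableZl => //; exact: integrable_expRN.
by apply: eq_bigr => i _; rewrite integralZl//; exact: integrable_expRN.
Qed.

(** A geometric sum with ratio 1 - exp(- (n + 1) x). One factor exp(- x) is kept outside the
    polynomial because the measures may be infinite and only exp(- x) is known to be integrable. *)
Let K_poly n t : exists p : {poly R}, forall x,
  K n.+1 t x = (expR (- x) * p.[expR (- x)])%R.
Proof.
exists ('X^n * \sum_(i < N n.+1 t) (1 - 'X^(n.+1)) ^+ i)%R => x.
rewrite hornerM hornerXn mulrA -exprS horner_sum -expRM_natl mulrN /K.
set q := expR _.
have := subrX1 (1 - q)%R (N n.+1 t).
under [in X in _ -> X]eq_bigr do
  rewrite !hornerE -expRM_natl mulrN -/q.
by move=> /(congr1 -%R); rewrite opprB => ->; ring.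
Qed.

Variables m1 m2 : {measure set R -> \bar R}.
Hypothesis laplace_eq : forall n,
  \int[m1]_(x in D) (expR (- x) ^+ n.+1)%:E =
  \int[m2]_(x in D) (expR (- x) ^+ n.+1)%:E.
Hypothesis laplace_fin : \int[m1]_(x in D) (expR (- x))%:E < +oo.

Let laplace_fin2 : \int[m2]_(x in D) (expR (- x))%:E < +oo.
Proof.
have : \int[m1]_(x in D) (expR (- x) ^+ 1)%:E < +oo by exact: laplace_fin.
by rewrite laplace_eq.
Qed.

Let integral_K n t :
  \int[m1]_(x in D) (K n.+1 t x)%:E = \int[m2]_(x in D) (K n.+1 t x)%:E.
Proof.
have [p hp] := K_poly n t.
under eq_integral do rewrite hp.
under [RHS]eq_integral do rewrite hp.
rewrite !integral_expRN_poly//.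
by apply: eq_bigr => i _; rewrite laplace_eq.
Qed.

Let cvg_integral_K (m : {measure set R -> \bar R}) t :
  \int[m]_(x in D) (expR (- x))%:E < +oo ->
  \int[m]_(x in D) (K n.+1 t x)%:E @[n --> \oo] -->
    m (`]-oo, t]%classic `&` D).
Proof.
move=> moo.
have mK n : measurable_fun D (fun x => (K n t x)%:E).
  apply/measurable_EFinP; apply: measurable_funB => //.
  apply: measurable_funX; apply: measurable_funB => //.
  by do 2 apply: measurableT_comp => //; exact: measurable_funM.
have := @dominated_convergence _ _ _ m D mD (fun n x => (K n.+1 t x)%:E)
  (fun x => ((x <= t)%R%:R)%:E) (fun x => (expR (t + 1 - x))%:E).
case.
- by move=> n; exact: mK.
- apply/measurable_EFinP/measurableT_comp => //.
  exact: measurable_fun_ler.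
- by apply: aeW => x /D_ge0 x0; apply: cvg_EFin; [exact: nearW|exact: K_cvg].
- apply: (eq_integrable _ (fun x => (expR (t + 1))%:E * (expR (- x) ^+ 1)%:E)) => //.
    by move=> x _; rewrite -EFinM -expRD.
  by apply: integrableZl => //; exact: integrable_expRN.
- by apply: aeW => x n /D_ge0 x0; rewrite gee0_abs ?lee_fin ?K_ge0 ?K_dom.
move=> _ _; suff -> : \int[m]_(x in D) ((x <= t)%R%:R)%:E = m (`]-oo, t]%classic `&` D).
  by [].
rewrite -integral_indic//; apply: eq_integral => x _.
by rewrite indicE /= mem_setE in_itv.
Qed.

(** The kernels use the transforms at positive integers only. In the limit both measures give the
    same mass to each ray cut down to [D]; this mass is finite because 1 <= exp(t - x) for x <=
    t. *)
Lemma laplace_unique (f : R -> \bar R) :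
  \int[m1]_(x in D) f x = \int[m2]_(x in D) f x.
Proof.
have E t : m1 (`]-oo, t]%classic `&` D) = m2 (`]-oo, t]%classic `&` D).
  have h1 := cvg_integral_K (t := t) laplace_fin.
  have := cvg_integral_K (t := t) laplace_fin2.
  under eq_fun do rewrite -integral_K.
  by move=> h2; apply: cvg_unique h1 h2 => //; exact: ereal_hausdorff.
have fin t : m1 (`]-oo, t]%classic `&` D) < +oo.
  apply: le_lt_trans (_ : (expR t)%:E * \int[m1]_(x in D) (expR (- x))%:E < +oo); last first.
    by rewrite lte_mul_pinfty ?lee_fin ?expR_ge0.
  rewrite -ge0_integralZl//; last first.
    by apply/measurable_EFinP; apply: measurableT_comp.
  rewrite -integral_indic//; apply: ge0_le_integral => //.
  - by apply/measurable_EFinP.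
  - by apply: emeasurable_funM => //; apply/measurable_EFinP; apply: measurableT_comp.
  - move=> x _; rewrite -EFinM -expRD lee_fin indicE mem_setE in_itv/=.
    case: (leP x t) => [xt|_] /=; last by rewrite expR_ge0.
    by rewrite -[leLHS]expR0 ler_expR subr_ge0.
apply: eq_measure_integral => A mA AD.
have -> : A = A `&` D by apply/esym/setIidPl.
exact: (measure_eq_rays (m1 := mrestr m1 mD) (m2 := mrestr m2 mD)).
Qed.

End laplace_uniqueness.

(** * Independent time changes *)

Section right_regularization.
Context {R : realType} d (T : measurableType d).
Implicit Types (x : R -> T -> R) (u : R).

(** Despite the name, the grid has mesh 1 / (n + 1). The successor puts the point strictly to the
    right of [u] even if [u] lies on the grid, so that right limits apply. *)
Definition dyad n u : R := (Num.truncn (n.+1%:R * u)).+1%:R / n.+1%:R.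

Lemma dyad_gt0 n u : 0 < dyad n u.
Proof. by rewrite divr_gt0. Qed.

Lemma dyad_gt n u : u < dyad n u.
Proof. by rewrite ltr_pdivlMr// mulrC truncnS_gt. Qed.

Lemma dyad_le n u : 0 <= u -> dyad n u <= u + n.+1%:R^-1.
Proof.
move=> u0; rewrite ler_pdivrMr// mulrDl mulVf ?pnatr_eq0// -natr1 lerD2r mulrC.
by rewrite truncn_le mulr_ge0.
Qed.

Lemma dyad_cvg u : 0 <= u -> dyad n u @[n --> \oo] --> u^'+.
Proof.
move=> u0 A /= [e e0 hA].
have [N hN] : exists N, forall n, (N <= n)%N -> n.+1%:R^-1 < e.
  exists (Num.truncn e^-1) => n Nn; rewrite -[ltRHS]invrK ltf_pV2 ?posrE ?invr_gt0//.
  by rewrite (lt_le_trans (truncnS_gt _))// ler_nat ltnS.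
exists N => // n /= /hN ne; apply: hA; last exact: dyad_gt.
rewrite /= ltr0_norm ?subr_lt0 ?dyad_gt// opprB ltrBlDl.
by rewrite (le_lt_trans (dyad_le _ u0))// ltrD2l.
Qed.

(* A jointly measurable version of a process that is only known to be right
   continuous almost surely. *)
Definition right_version x u w : R :=
  fine (limn_esup (fun n => (x (dyad n u) w)%:E)).

Lemma right_versionE x u w (l : R) :
  x (dyad n u) w @[n --> \oo] --> l -> right_version x u w = l.
Proof.
move=> xl; rewrite /right_version is_cvg_limn_esupE.
  by rewrite (cvg_lim _ (cvg_EFin _ xl))//; exact: nearW.
by apply/cvg_ex; exists l%:E; apply: cvg_EFin => //; exact: nearW.
Qed.

Let measurable_fun_nat_index (N : R -> nat) (g : nat -> T -> R) :
  (forall k, measurable (N @^-1` [set k])) ->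
  (forall k, measurable_fun setT (g k)) ->
  measurable_fun setT (fun z : R * T => g (N z.1) z.2).
Proof.
move=> mN mg _ B mB; rewrite setTI.
have -> : (fun z : R * T => g (N z.1) z.2) @^-1` B =
    \bigcup_k (N @^-1` [set k] `*` (g k @^-1` B)).
  apply/seteqP; split => [[u w] /= gB|[u w] [k _ [/= <-]]//].
  by exists (N u).
apply: bigcup_measurable => k _; apply: measurableX; first exact: mN.
by rewrite -[X in measurable X]setTI; exact: mg.
Qed.

(** Each approximation depends on [u] through an integer only, so its preimages are countable unions
    of rectangles. [T] is arbitrary because the lemma is also applied to the sigma-algebra generated
    by the process itself. *)
Lemma measurable_right_version x :
  (forall u, 0 <= u -> measurable_fun setT (x u)) ->
  measurable_fun setT (fun z : R * T => right_version x z.1 z.2).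
Proof.
move=> mx; apply: measurableT_comp => //.
apply: measurable_fun_limn_esup => n; apply/measurable_EFinP.
apply: (measurable_fun_nat_index (N := fun u => Num.truncn (n.+1%:R * u))
  (g := fun k => x (k.+1%:R / n.+1%:R))) => k.
  apply: is_interval_measurable => a b /= <- hb c /andP[ac cb].
  by apply/eqP; rewrite eqn_leq -{1}hb !le_truncn// ler_wpM2l.
by apply: mx; rewrite divr_ge0.
Qed.

End right_regularization.

Section freezing.
Context d (T : measurableType d) (R : realType) (P : probability T R).
Variables X C : R -> T -> R.
Hypothesis XC : independent_processes P X C.

Let gen (Y : R -> T -> R) : set (set T) := [set A | exists t : R,
  exists2 B : set R, 0 <= t /\ measurable B & A = Y t @^-1` B].

(** The sample space with only the events of [X], respectively of [C]. The identity maps into these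
    two spaces are an independent pair, to which the Fubini lemmas apply. *)
Let T1 := g_sigma_algebraType (gen X).
Let T2 := g_sigma_algebraType (gen C).

Let measurable_id_gen Y : stochastic_process Y ->
  measurable_fun setT (id : T -> g_sigma_algebraType (gen Y)).
Proof.
move=> mY _ A mA; rewrite setTI preimage_id.
suff : <<s gen Y >> `<=` d.-measurable by exact.
apply: smallest_sub; first exact: sigma_algebra_measurable.
by move=> _ [t [B [t0 mB] ->]]; rewrite -[X in measurable X]setTI; exact: mY.
Qed.

Let measurable_gen Y t : 0 <= t ->
  measurable_fun setT (Y t : g_sigma_algebraType (gen Y) -> R).
Proof.
move=> t0 _ B mB; rewrite setTI; apply: sub_sigma_algebra.
by exists t, B.
Qed.

Let indep_id (A : set T1) (B : set T2) : measurable A -> measurable B ->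
  P ((id : T -> T1) @^-1` A `&` (id : T -> T2) @^-1` B) =
  (P ((id : T -> T1) @^-1` A) * P ((id : T -> T2) @^-1` B))%E.
Proof. by case: XC => _ _ h mA mB; exact: h. Qed.

Let mX : stochastic_process X. Proof. by case: XC. Qed.
Let mC : stochastic_process C. Proof. by case: XC. Qed.

Variables (s t : R) (Phi : R * R -> R).
Hypotheses (s0 : 0 <= s) (t0 : 0 <= t) (mPhi : measurable_fun setT Phi).

Let F (z : T1 * T2) : \bar R := (Phi
  (right_version (X : R -> T1 -> R) (C s z.2) z.1,
   right_version (X : R -> T1 -> R) (C t z.2) z.1))%:E.

Let measurable_subst r : 0 <= r -> measurable_fun setT
  (fun z : T1 * T2 => right_version (X : R -> T1 -> R) (C r z.2) z.1).
Proof.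
move=> r0.
apply: (measurableT_comp (measurable_right_version
  (fun u (u0 : 0 <= u) => @measurable_gen X u u0))
  (g := fun z : T1 * T2 => (C r z.2, z.1))).
apply/measurable_fun_pair; last exact: measurable_fst.
exact: (measurableT_comp (@measurable_gen C r r0)).
Qed.

Let mF : measurable_fun setT F.
Proof.
apply/measurable_EFinP; apply: measurableT_comp mPhi _.
by apply/measurable_fun_pair; exact: measurable_subst.
Qed.

Local Open Scope ereal_scope.

(** Measurability of the inner integral belongs to the conclusion because the domination argument
    below adds and compares such functions. *)
Lemma ge0_freezing : (forall z, 0 <= Phi z)%R ->
  measurable_fun setT (fun v => \int[P]_w
    (Phi (right_version X (C s v) w, right_version X (C t v) w))%:E) /\
  \int[P]_w (Phi (right_version X (C s w) w, right_version X (C t w) w))%:E =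
  \int[P]_v \int[P]_w
    (Phi (right_version X (C s v) w, right_version X (C t v) w))%:E.
Proof.
move=> Phi0; split; last first.
  exact: (ge0_integral_indep (measurable_id_gen mX) (measurable_id_gen mC)
    indep_id mF (fun z => Phi0 _)).
apply: (measurable_fun_fubini_tonelli_G (m1 := P) (fun z : T * T => (Phi
  (right_version X (C s z.2) z.1, right_version X (C t z.2) z.1))%:E));
  last by move=> z; rewrite lee_fin.
apply: (measurableT_comp mF (g := fun z : T * T => (z.1 : T1, z.2 : T2))).
apply/measurable_fun_pair.
  exact: measurableT_comp (measurable_id_gen mX) measurable_fst.
exact: measurableT_comp (measurable_id_gen mC) measurable_snd.
Qed.

Lemma freezing :
  \int[P]_v \int[P]_w
    `|(Phi (right_version X (C s v) w, right_version X (C t v) w))%:E| < +oo ->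
  P.-integrable setT
    (fun w => (Phi (right_version X (C s w) w, right_version X (C t w) w))%:E)
  /\ \int[P]_w (Phi (right_version X (C s w) w, right_version X (C t w) w))%:E =
  \int[P]_v \int[P]_w
    (Phi (right_version X (C s v) w, right_version X (C t v) w))%:E.
Proof.
exact: (integral_indep (measurable_id_gen mX) (measurable_id_gen mC)
    indep_id mF).
Qed.

End freezing.

Section time_change_moments.
Context d (T : measurableType d) (R : realType) (P : probability T R).
Implicit Types X C : R -> T -> R.

(** The mixed moment is prescribed for ordered times only, so [h] need not be symmetric;
    monotonicity of the time change keeps the substituted times in order. *)
Definition second_order_moments X (e : R -> R) (h : R -> R -> R) : Prop :=
  forall a b : R, 0 <= a -> a <= b ->
    ('E_P[X a] = (e a)%:E /\ 'E_P[X a * X b] = (h a b)%:E)%E.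

Variables X C : R -> T -> R.
Hypothesis XC : independent_processes P X C.
Hypothesis X_right_cont : {ae P, forall w, forall u, 0 <= u ->
  X (dyad n u) w @[n --> \oo] --> X u w}.
Hypothesis C_ge0 : forall t, 0 <= t -> {ae P, forall w, (0 <= C t w)%R}.
Hypothesis C_mono : forall s t, 0 <= s -> s <= t ->
  {ae P, forall w, (C s w <= C t w)%R}.
Variables (e : R -> R) (h : R -> R -> R).
Hypothesis Xeh : second_order_moments X e h.
Local Open Scope ereal_scope.
Hypothesis hC : forall t, (0 <= t)%R -> \int[P]_w (h (C t w) (C t w))%:E < +oo.

Let Z := time_change X C.
Let Z' t w := right_version X (C t w) w.

Let mX t : (0 <= t)%R -> measurable_fun setT (X t).
Proof. by case: XC => + _ _; exact. Qed.

Let right_version_ae u : (0 <= u)%R ->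
  {ae P, forall w, right_version X u w = X u w}.
Proof.
by move=> u0; apply: filterS X_right_cont => w /(_ u u0) /right_versionE.
Qed.

Lemma time_change_version_ae t : (0 <= t)%R -> {ae P, forall w, Z' t w = Z t w}.
Proof.
move=> t0; apply: filterS2 X_right_cont (C_ge0 t0) => w Xw Cw.
by rewrite /Z' /Z /time_change (right_versionE (Xw _ Cw)).
Qed.

Let inner_integral (Phi : R * R -> R) (a b : R) : (0 <= a)%R -> (0 <= b)%R ->
  \int[P]_w (Phi (right_version X a w, right_version X b w))%:E =
  \int[P]_w (Phi (X a w, X b w))%:E.
Proof.
move=> a0 b0; apply: eq_ae_integralT.
by apply: filterS2 (right_version_ae a0) (right_version_ae b0) => w -> ->.
Qed.

Let sqr_moment t : (0 <= t)%R ->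
  \int[P]_v \int[P]_w (right_version X (C t v) w ^+ 2)%:E < +oo.
Proof.
move=> t0; rewrite (eq_ae_integralT
  (g := fun v => (h (C t v) (C t v))%:E)); first exact: hC.
apply: filterS (C_ge0 t0) => v v0.
rewrite (@inner_integral (fun z => z.1 ^+ 2)%R _ (C t v))//.
have [_ <-] := Xeh v0 (lexx _).
by rewrite unlock; apply: eq_integral => w _; rewrite /= expr2.
Qed.

Let integral_1DD (f g : T -> \bar R) : measurable_fun setT f ->
  measurable_fun setT g -> (forall w, 0 <= f w) -> (forall w, 0 <= g w) ->
  \int[P]_w (1 + (f w + g w)) = 1 + (\int[P]_w f w + \int[P]_w g w).
Proof.
move=> mf mg f0 g0.
rewrite ge0_integralD//.
- by rewrite integral_cst//= probability_setT mule1 ge0_integralD.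
- by move=> w _; exact: adde_ge0.
- exact: emeasurable_funD.
Qed.

(** The bound covers both [x] and [x * y], so integrability of means and of mixed moments follows
    from the second moments at the two times, which [hC] makes finite. *)
Let dominated_freezing s t (Phi : R * R -> R) : (0 <= s)%R -> (0 <= t)%R ->
  measurable_fun setT Phi ->
  (forall x y, `|Phi (x, y)| <= 1 + (x ^+ 2 + y ^+ 2))%R ->
  P.-integrable setT (fun w => (Phi (Z' s w, Z' t w))%:E) /\
  \int[P]_w (Phi (Z' s w, Z' t w))%:E =
  \int[P]_v \int[P]_w (Phi (X (C s v) w, X (C t v) w))%:E.
Proof.
move=> s0 t0 mPhi Phi_le.
have m1 : measurable_fun setT (fun z : R * R => z.1 ^+ 2)%R.
  exact: measurable_funX.
have m2 : measurable_fun setT (fun z : R * R => z.2 ^+ 2)%R.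
  exact: measurable_funX.
have mabs : measurable_fun setT (fun z : R * R => `|Phi z|)%R.
  exact: measurableT_comp.
have [mS _] := ge0_freezing XC s0 t0 m1 (fun z => sqr_ge0 _).
have [mT _] := ge0_freezing XC s0 t0 m2 (fun z => sqr_ge0 _).
have [mA _] := ge0_freezing XC s0 t0 mabs (fun z => normr_ge0 _).
have mr u : measurable_fun setT (right_version X u).
  apply: (measurableT_comp (measurable_right_version mX)
    (g := fun w => (u, w))).
  exact: measurable_fun_pair.
have mr2 u : measurable_fun setT (fun w => (right_version X u w ^+ 2)%:E).
  by apply/measurable_EFinP; apply: measurable_funX.
have r0 u w : 0 <= (right_version X u w ^+ 2)%:E by rewrite lee_fin sqr_ge0.
have finS := sqr_moment s0; have finT := sqr_moment t0.
pose a v := \int[P]_w (right_version X (C s v) w ^+ 2)%:E.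
pose b v := \int[P]_w (right_version X (C t v) w ^+ 2)%:E.
have a0 v : 0 <= a v by exact: integral_ge0.
have b0 v : 0 <= b v by exact: integral_ge0.
have ma : measurable_fun setT a by exact: mS.
have mb : measurable_fun setT b by exact: mT.
have mab : measurable_fun setT (fun v => a v + b v) by exact: emeasurable_funD.
have absab v : \int[P]_w `|(Phi (right_version X (C s v) w,
    right_version X (C t v) w))%:E| <= 1 + (a v + b v).
  rewrite -integral_1DD//.
  apply: ge0_le_integral => //.
  - apply: measurableT_comp => //; apply/measurable_EFinP.
    by apply: measurableT_comp mPhi _; exact: measurable_fun_pair.
  - by apply: emeasurable_funD => //; exact: emeasurable_funD.
  - by move=> w _; rewrite -!EFinD lee_fin Phi_le.
have [|iZ eqZ] := freezing XC s0 t0 mPhi.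
  apply: (@le_lt_trans _ _ (\int[P]_v (1 + (a v + b v)))).
    apply: ge0_le_integral => //.
    - by move=> v _; exact: integral_ge0.
    - by apply: emeasurable_funD => //; exact: measurable_cst.
  rewrite (integral_1DD ma mb a0 b0); apply: lte_add_pinfty; first exact: ltry.
  by apply: lte_add_pinfty; [exact: finS|exact: finT].
split=> //; rewrite eqZ; apply: eq_ae_integralT.
apply: filterS2 (C_ge0 s0) (C_ge0 t0) => v vs vt.
exact: inner_integral.
Qed.

Lemma integrable_time_change t : (0 <= t)%R ->
  P.-integrable setT (fun w => (Z' t w)%:E).
Proof.
move=> t0.
have [||//] := @dominated_freezing t t fst t0 t0.
  exact: measurable_fst.
move=> x y /=; rewrite ler_norml; apply/andP; split; nra.
Qed.

Lemma integrable_time_changeM s t : (0 <= s)%R -> (0 <= t)%R ->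
  P.-integrable setT (fun w => (Z' s w * Z' t w)%:E).
Proof.
move=> s0 t0.
have [||//] := @dominated_freezing s t (fun z => z.1 * z.2)%R s0 t0.
  exact: measurable_funM.
move=> x y /=; rewrite ler_norml; apply/andP; split; nra.
Qed.

Lemma expectation_time_change t : (0 <= t)%R ->
  ('E_P[Z t] = \int[P]_w (e (C t w))%:E)%E.
Proof.
move=> t0; rewrite unlock.
transitivity (\int[P]_w (Z' t w)%:E).
  apply: eq_ae_integralT; apply: filterS (time_change_version_ae t0) => w.
  by move=> ->.
have [|| _ ->] := @dominated_freezing t t fst t0 t0.
- exact: measurable_fst.
- move=> x y /=; rewrite ler_norml; apply/andP; split; nra.
apply: eq_ae_integralT; apply: filterS (C_ge0 t0) => v v0 /=.
by have [<- _] := Xeh v0 (lexx _); rewrite unlock.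
Qed.

Lemma expectation_time_changeM s t : (0 <= s)%R -> (s <= t)%R ->
  ('E_P[Z s * Z t] = \int[P]_w (h (C s w) (C t w))%:E)%E.
Proof.
move=> s0 st; have t0 := le_trans s0 st; rewrite unlock.
transitivity (\int[P]_w (Z' s w * Z' t w)%:E).
  apply: eq_ae_integralT.
  by apply: filterS2 (time_change_version_ae s0) (time_change_version_ae t0)
    => w /= -> ->.
have [|| _ ->] := @dominated_freezing s t (fun z => z.1 * z.2)%R s0 t0.
- exact: measurable_funM.
- move=> x y /=; rewrite ler_norml; apply/andP; split; nra.
apply: eq_ae_integralT; apply: filterS2 (C_ge0 s0) (C_mono s0 st) => v v0 vt /=.
by have [_ <-] := Xeh v0 vt; rewrite unlock.
Qed.

(** [Z] itself may fail to be measurable, so the covariance is first moved to the version [Z'],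
    where the product formula for integrable variables is available. *)
Lemma covariance_time_change s t : (0 <= s)%R -> (s <= t)%R ->
  covariance P (Z s) (Z t) = \int[P]_w (h (C s w) (C t w))%:E -
    (\int[P]_w (e (C s w))%:E) * (\int[P]_w (e (C t w))%:E).
Proof.
move=> s0 st; have t0 := le_trans s0 st.
have EZ' r : (0 <= r)%R -> 'E_P[Z' r] = 'E_P[Z r].
  move=> r0; rewrite unlock; apply: eq_ae_integralT.
  by apply: filterS (time_change_version_ae r0) => w /= ->.
transitivity (covariance P (Z' s) (Z' t)).
  rewrite unlock !EZ'// unlock; apply: eq_ae_integralT.
  by apply: filterS2 (time_change_version_ae s0) (time_change_version_ae t0)
    => w Es Et; rewrite !fctE/= Es Et.
rewrite covarianceE; last 3 first.
- exact/Lfun1_integrable/integrable_time_change.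
- exact/Lfun1_integrable/integrable_time_change.
- exact/Lfun1_integrable/integrable_time_changeM.
rewrite !EZ'// !expectation_time_change// -expectation_time_changeM//.
congr (_ - _); rewrite unlock; apply: eq_ae_integralT.
by apply: filterS2 (time_change_version_ae s0) (time_change_version_ae t0)
  => w Es Et; rewrite !fctE/= Es Et.
Qed.

End time_change_moments.

(** * Levy processes and counting processes *)

Section levy_increments.
Context d (T : measurableType d) (R : realType) (P : probability T R).
Implicit Types X : R -> T -> R.

Lemma eq_ae_probability (A B : set T) : measurable A -> measurable B ->
  {ae P, forall w, A w <-> B w} -> P A = P B.
Proof.
move=> mA mB AB.
have E (D : set T) : measurable D -> P D = (\int[P]_w (\1_D w)%:E)%E.
  by move=> mD; rewrite integral_indic// setIT.
rewrite (E A)// (E B)//; apply: eq_ae_integralT.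
apply: filterS AB => w AB; rewrite !indicE.
by have -> : (w \in A) = (w \in B) by apply/idP/idP; rewrite !inE => /AB.
Qed.

Lemma eq_law_integral (X Y : T -> R) (g : R -> \bar R) :
  measurable_fun setT X -> measurable_fun setT Y ->
  (forall B, measurable B -> P (X @^-1` B) = P (Y @^-1` B)) ->
  measurable_fun setT g -> (forall x, 0 <= g x)%E ->
  (\int[P]_w g (X w) = \int[P]_w g (Y w))%E.
Proof.
move=> mX mY XY mg g0.
transitivity (\int[image_measure P mX]_x g x)%E.
  by rewrite integral_image_measure.
transitivity (\int[image_measure P mY]_x g x)%E.
  by apply: eq_measure_integral => A mA _; exact: XY.
by rewrite integral_image_measure.
Qed.

(** The form in which independence and stationarity of increments are used: [X a] and the increment
    are sampled from two copies of the space. The deterministic process used for alpha = 1 satisfies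
    it by direct computation. *)
Definition independent_stationary_pairs X : Prop :=
  forall (a b : R) (F : R * R -> \bar R), 0 <= a -> a < b ->
  measurable_fun setT F -> (forall z, 0 <= F z)%E ->
  (\int[P]_w F (X a w, (X b w - X a w)%R) =
   \int[P]_w \int[P]_v F (X a w, X (b - a)%R v))%E.

Lemma independent_pair_of_levy X : levy_process P X ->
  forall (a b : R), 0 <= a -> a < b -> forall A B : set R,
  measurable A -> measurable B ->
  P (X a @^-1` A `&` (fun w => X b w - X a w) @^-1` B) =
  (P (X a @^-1` A) * P ((fun w => (X b w - X a w)%R) @^-1` B))%E.
Proof.
move=> [mX X0 indX _ _] a b a0 ab A B mA mB.
have mXA u C : 0 <= u -> measurable C -> measurable (X u @^-1` C).
  by move=> u0 mC; rewrite -[X in measurable X]setTI; exact: mX.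
have mXB u v C : 0 <= u -> 0 <= v -> measurable C ->
    measurable ((fun w => X v w - X u w) @^-1` C).
  move=> u0 v0 mC; rewrite -[X in measurable X]setTI.
  by apply: measurable_funB => //; exact: mX.
have b0 : 0 <= b by rewrite ltW// (le_lt_trans a0).
move: a0; rewrite le_eqVlt => /predU1P[a0|a0].
  (* At time 0 the event concerning [X 0] is almost surely everything or almost surely empty, since
     [X 0] is almost surely 0. *)
  rewrite -{}a0 in ab *.
  have [A0|A0] := pselect (A 0).
    rewrite (eq_ae_probability _ (B := (fun w => X b w - X 0 w) @^-1` B)).
    - have -> : P (X 0 @^-1` A) = 1%E.
        rewrite -[RHS](probability_setT P); apply: eq_ae_probability => //.
          exact: mXA.
        by apply: filterS X0 => w /= ->.
      by rewrite mul1e.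
    - by apply: measurableI; [exact: mXA|exact: mXB].
    - exact: mXB.
    - by apply: filterS X0 => w /= ->; split => // -[].
  rewrite (eq_ae_probability _ (B := set0)).
  - have -> : P (X 0 @^-1` A) = 0%E.
      rewrite -[RHS](measure0 P); apply: eq_ae_probability => //.
        exact: mXA.
      by apply: filterS X0 => w /= ->.
    by rewrite mul0e measure0.
  - by apply: measurableI; [exact: mXA|exact: mXB].
  - by [].
  - by apply: filterS X0 => w /= ->; split => // -[].
(* [X a] is treated as the increment from time 0. Only the times 0, a, b matter; the later ones
   merely complete the strictly increasing sequence that the definition requires. *)
pose t i := match i with O => 0 | 1%N => a | i.+2 => b + i%:R end : R.
have ti i : t i < t i.+1.
  by case: i => [|[|i]] //=; rewrite ?addr0// ltrD2l ltr_nat.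
have := indX 2%N t (lexx _) ti
  (fun i : 'I_2 => if i == ord0 then A else B).
rewrite 2!big_ord_recr/= big_ord0 mul1e.
have mAB (i : 'I_2) : measurable (if i == ord0 then A else B) by case: ifP.
move=> /(_ mAB).
have -> : \bigcap_(i in [set: 'I_2]) ((fun w => X (t i.+1) w - X (t i) w) @^-1`
    (if i == ord0 then A else B)) =
    ((fun w => X a w - X 0 w) @^-1` A) `&` ((fun w => X b w - X a w) @^-1` B).
  apply/seteqP; split => w /=.
    move=> h; split; first exact: (h ord0 I).
    by have := h ord_max I; rewrite /= addr0.
  move=> [hA hB] [[|[|//]] i2] _ /=; first exact: hA.
  by rewrite addr0.
rewrite /= addr0 => E.
have XaE : P ((fun w => X a w - X 0 w) @^-1` A) = P (X a @^-1` A).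
  apply: eq_ae_probability; [exact: mXB (lexx _) (ltW a0) mA|exact: mXA (ltW a0) mA|].
  by apply: filterS X0 => w /= ->; rewrite subr0.
rewrite -XaE -{}E; apply: eq_ae_probability.
- by apply: measurableI; [exact: mXA (ltW a0) mA|exact: mXB (ltW a0) b0 mB].
- by apply: measurableI; [exact: mXB (lexx _) (ltW a0) mA|exact: mXB (ltW a0) b0 mB].
- by apply: filterS X0 => w /= ->; rewrite subr0.
Qed.

Lemma levy_independent_stationary_pairs X :
  levy_process P X -> independent_stationary_pairs X.
Proof.
move=> LX a b F a0 ab mF F0; have [mX _ _ sX _] := LX.
have ba0 : 0 <= b - a by rewrite subr_ge0 ltW.
have mXa := mX _ a0; have mXba := mX _ ba0.
have mXb : measurable_fun setT (X b) by apply: mX; rewrite (le_trans a0)// ltW.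
have mXD : measurable_fun setT (fun w => X b w - X a w).
  exact: measurable_funB.
rewrite (ge0_integral_indep mXa mXD (independent_pair_of_levy LX a0 ab) mF F0).
pose g y := (\int[P]_w F (X a w, y))%E.
have mFG (f : T -> R) : measurable_fun setT f ->
    measurable_fun setT (fun z : T * T => F (X a z.1, f z.2)).
  move=> mf; apply: measurableT_comp mF _; apply/measurable_fun_pair.
    exact: measurableT_comp mXa measurable_fst.
  exact: measurableT_comp mf measurable_snd.
have mg : measurable_fun setT g.
  pose G (z : T * R) := F (X a z.1, z.2).
  apply: (measurable_fun_fubini_tonelli_G (m1 := P) G) => [|z]; last exact: F0.
  apply: measurableT_comp mF _; apply/measurable_fun_pair.
    exact: measurableT_comp mXa measurable_fst.
  exact: measurable_snd.
rewrite (eq_law_integral (g := g) mXD mXba)//.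
- by rewrite -(fubini_tonelli (fun z : T * T => F (X a z.1, X (b - a) z.2)))//;
    exact: mFG.
- by move=> B mB; exact: sX.
- by move=> x; exact: integral_ge0.
Qed.

Lemma cvg_dyad_of_cadlag (x : R -> R) : cadlag x ->
  forall u, 0 <= u -> x (dyad n u) @[n --> \oo] --> x u.
Proof. by move=> [rx _] u u0; exact: cvg_comp (dyad_cvg u0) (rx u u0). Qed.

End levy_increments.

Section exponential_limits.
Context {R : realType}.
Implicit Types (y r : R^nat) (c : R).

(** Squeezed by y / (1 + y) <= 1 - exp(- y) <= y. *)
Lemma cvg_1BexpRN_div y r c : (forall n, 0 <= y n) -> (forall n, 0 < r n) ->
  y @ \oo --> 0 -> y n / r n @[n --> \oo] --> c ->
  (1 - expR (- y n)) / r n @[n --> \oo] --> c.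
Proof.
move=> y0 r0 ycvg yr.
have le1 n : (y n / r n) / (1 + y n) <= (1 - expR (- y n)) / r n.
  rewrite mulrAC ler_pM2r ?invr_gt0// ler_pdivrMr ?ltr_pwDl//.
  have := expR_ge1Dx (y n); have := expR_gt0 (- y n).
  have : expR (- y n) * expR (y n) = 1 by rewrite -expRD addNr expR0.
  nra.
have le2 n : (1 - expR (- y n)) / r n <= y n / r n.
  by rewrite ler_pM2r ?invr_gt0//; have := expR_ge1Dx (- y n); lra.
apply: (@squeeze_cvgr _ _ _ _ (fun n => (y n / r n) / (1 + y n)) (fun n => y n / r n)) => //.
  by apply: nearW => n; rewrite le1 le2.
rewrite -[X in _ --> X]divr1 -[X in _ / X]addr0.
apply: cvgM => //; apply: cvgV; first by rewrite addr0 oner_neq0.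
by apply: cvgD => //; exact: cvg_cst.
Qed.

Lemma cvg_expRB1_div y r c : (forall n, 0 <= y n) -> (forall n, 0 < r n) ->
  y @ \oo --> 0 -> y n / r n @[n --> \oo] --> c ->
  (expR (y n) - 1) / r n @[n --> \oo] --> c.
Proof.
move=> y0 r0 ycvg yr.
have -> : (fun n => (expR (y n) - 1) / r n) =
    (fun n => expR (y n) * ((1 - expR (- y n)) / r n)).
  by apply/funext => n; rewrite mulrA mulrBr mulr1 -expRD subrr expR0.
rewrite -[c]mul1r -[X in X * c]expR0; apply: cvgM.
  by apply: continuous_cvg ycvg; exact: continuous_expR.
exact: cvg_1BexpRN_div.
Qed.

Lemma cvg_halfX : (2 ^- n : R) @[n --> \oo] --> (0 : R).
Proof.
under eq_fun do rewrite -exprVn.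
by apply: cvg_expr; rewrite ger0_norm ?invr_ge0// invf_lt1// ltr1n.
Qed.

End exponential_limits.

Section moments_from_laplace.
Context d (T : measurableType d) (R : realType) (P : probability T R).
Variable X : T -> R.
Hypothesis mX : measurable_fun setT X.
Hypothesis X0 : forall w, 0 <= X w.
Local Open Scope ereal_scope.

Let s n : R := (2 ^- n)%R.
Let s_gt0 n : (0 < s n)%R. Proof. by rewrite invr_gt0 exprn_gt0. Qed.

(* Increases to [x] with [n], so that monotone convergence turns the behaviour
   of the Laplace transform at 0 into moments, finite or not. *)
Let D n (x : R) : R := ((1 - expR (- (s n * x))) / s n)%R.

Let D_ge0 n x : (0 <= x)%R -> (0 <= D n x)%R.
Proof.
move=> x0; rewrite divr_ge0 ?(ltW (s_gt0 n))// subr_ge0 -[leRHS]expR0 ler_expR.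
by rewrite oppr_le0 mulr_ge0// ltW.
Qed.

Let D_nd x : (0 <= x)%R -> {homo D^~ x : m n / (m <= n)%N >-> (m <= n)%R}.
Proof.
move=> x0; apply/nondecreasing_seqP => n; rewrite /D.
have -> : s n = (2 * s n.+1)%R.
  by rewrite /s exprS invfM mulrA divff ?mul1r// pnatr_eq0.
(* Halving the step: with e = exp(- q x), the quotient for 2 q is (1 - e) / q times (1 + e) / 2, and
   e <= 1. *)
set q := s n.+1; have q0 : (0 < q)%R := s_gt0 _.
have -> : (- (2 * q * x) = - (q * x) + - (q * x))%R by ring.
rewrite expRD; set e := expR _.
have e1 : (e <= 1)%R by rewrite -[leRHS]expR0 ler_expR oppr_le0 mulr_ge0// ltW.
have e0 : (0 < e)%R := expR_gt0 _.
rewrite invfM mulrA ler_pM2r ?invr_gt0//; nra.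
Qed.

Let D_cvg x : (0 <= x)%R -> (D n x @[n --> \oo] --> x)%R.
Proof.
move=> x0; apply: cvg_1BexpRN_div => //.
- by move=> n; rewrite mulr_ge0// ltW.
- by rewrite -(mul0r x); apply: cvgM; [exact: cvg_halfX|exact: cvg_cst].
- under eq_fun do rewrite mulrAC divff ?gt_eqF// mul1r.
  exact: cvg_cst.
Qed.

Let mD n : measurable_fun setT (fun w => D n (X w)).
Proof.
apply: measurable_funM => //; apply: measurable_funB => //.
by do 2 apply: measurableT_comp => //; exact: measurable_funM.
Qed.

Let cvg_power k : \int[P]_w (D n (X w) ^+ k)%:E @[n --> \oo] -->
  \int[P]_w (X w ^+ k)%:E.
Proof.
have E w : limn (fun n => (D n (X w) ^+ k)%:E) = (X w ^+ k)%:E.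
  apply/cvg_lim => //; apply: cvg_EFin; first exact: nearW.
  exact: (cvg_comp _ _ (D_cvg (X0 w)) (@exprn_continuous R k (X w))).
under eq_integral do rewrite -E.
apply: cvg_monotone_convergence => //.
- by move=> n; apply/measurable_EFinP/measurable_funX.
- by move=> n w _; rewrite lee_fin exprn_ge0// D_ge0.
- move=> w _ m n mn; rewrite lee_fin lerXn2r ?nnegrE ?D_ge0//.
  exact: D_nd.
Qed.

Variable L : R -> R.
Hypothesis LE : forall s, (0 < s)%R ->
  \int[P]_w (expR (- (s * X w)))%:E = (L s)%:E.

Let iexp u : (0 < u)%R -> P.-integrable setT (fun w => (expR (- (u * X w)))%:E).
Proof.
move=> u0; apply/integrableP; split.
  by apply/measurable_EFinP; do 2 apply: measurableT_comp => //; exact: measurable_funM.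
by under eq_integral do rewrite gee0_abs ?lee_fin ?expR_ge0//; rewrite LE// ltry.
Qed.

(** The mean of [D n (X w)] is a difference quotient of [L] at 0, with [L 0] replaced by 1.
    Finiteness of the moment is part of the conclusion. *)
Lemma first_moment_laplace (m : R) :
  ((1 - L (2 ^- n)) / 2 ^- n @[n --> \oo] --> m)%R ->
  \int[P]_w (X w)%:E = m%:E.
Proof.
move=> Lm; have := @cvg_power 1%N.
have -> : (fun n => \int[P]_w (D n (X w) ^+ 1)%:E) =
    (fun n => ((1 - L (s n)) / s n)%R%:E).
  apply/funext => n.
  transitivity (\int[P]_w ((s n)^-1%:E * (1 - (expR (- (s n * X w)))%:E))).
    by apply: eq_integral => w _; rewrite -EFinB -EFinM expr1 mulrC.
  rewrite integralZl//; last by apply: integrableB => //;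
    [exact: finite_measure_integrable_cst|exact: iexp].
  rewrite integralB//; [|exact: finite_measure_integrable_cst|exact: iexp].
  rewrite [X in _ * (X - _)]integral_cst//= probability_setT mul1e LE//.
  by rewrite -EFinB -EFinM mulrC.
move=> h; apply: (cvg_unique (@ereal_hausdorff R) h).
by apply: cvg_EFin; [exact: nearW|exact: Lm].
Qed.

(** Expanding the square of [D n] gives a second difference quotient of [L] at 0. *)
Lemma second_moment_laplace (m : R) :
  ((1 - 2 * L (2 ^- n) + L (2 * 2 ^- n)) / (2 ^- n) ^+ 2 @[n --> \oo] --> m)%R ->
  \int[P]_w (X w ^+ 2)%:E = m%:E.
Proof.
move=> Lm; have := @cvg_power 2%N.
have -> : (fun n => \int[P]_w (D n (X w) ^+ 2)%:E) =
    (fun n => ((1 - 2 * L (s n) + L (2 * s n)) / s n ^+ 2)%R%:E).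
  apply/funext => n.
  have s2 : (0 < 2 * s n)%R by rewrite mulr_gt0.
  have i1 := finite_measure_integrable_cst P (1 : R) measurableT.
  have i2 : P.-integrable setT (fun w => 2%:E * (expR (- (s n * X w)))%:E).
    exact: integrableZl (iexp (s_gt0 n)).
  have i12 : P.-integrable setT (fun w => 1 - 2%:E * (expR (- (s n * X w)))%:E).
    exact: integrableB i1 i2.
  have i3 := iexp s2.
  transitivity (\int[P]_w ((s n ^+ 2)^-1%:E * (1 - 2%:E * (expR (- (s n * X w)))%:E
      + (expR (- (2 * s n * X w)))%:E))).
    apply: eq_integral => w _; rewrite -!EFinM.
    congr _%:E; rewrite /D expr_div_n mulrC; congr (_ * _)%R.
    have -> : (- (2 * s n * X w) = - (s n * X w) + - (s n * X w))%R by ring.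
    rewrite expRD; ring.
  rewrite integralZl//; last exact: integrableD i12 i3.
  rewrite integralD// integralB// integralZl//; last exact: iexp.
  rewrite [X in _ * (X - _ + _)]integral_cst//= probability_setT mul1e !LE//.
  by rewrite -!EFinM mulrC.
move=> h; apply: (cvg_unique (@ereal_hausdorff R) h).
by apply: cvg_EFin; [exact: nearW|exact: Lm].
Qed.

End moments_from_laplace.

Lemma cvg_sumr {R : realType} (J I : Type) (F : set_system J) (s : seq I)
    (f : I -> J -> R) (l : I -> R) : Filter F ->
  (forall i, f i x @[x --> F] --> l i) ->
  \sum_(i <- s) f i x @[x --> F] --> \sum_(i <- s) l i.
Proof.
move=> FF fl; elim: s => [|i s ih].
  by under eq_fun do rewrite big_nil; rewrite big_nil; exact: cvg_cst.
by under eq_fun do rewrite big_cons; rewrite big_cons; apply: cvgD.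
Qed.

(** * Laplace exponent and moments of a counting process *)

Section gcp_laplace.
Context d (T : measurableType d) (R : realType) (P : probability T R).
Variables (k : nat) (lambda : 'I_k -> R) (M : R -> T -> nat).
Hypothesis lambda_ge0 : forall j, 0 <= lambda j.
Hypothesis gcpM : generalized_counting_process P lambda M.

Let X t w : R := (M t w)%:R.

Let levyX : levy_process P X. Proof. by case: gcpM. Qed.

Let mX t : 0 <= t -> measurable_fun setT (X t).
Proof. by case: levyX => + _ _ _ _; exact. Qed.

(** The Laplace exponent of a compound Poisson process with jumps of size j + 1 at rate
    [lambda j]. *)
Let psi (s : R) : R := \sum_(j < k) lambda j * (1 - expR (- (s * j.+1%:R))).

Let L s t : R := fine (\int[P]_w (expR (- (s * X t w)))%:E)%E.

Let expX s t w : 0 <= s -> 0 < expR (- (s * X t w)) <= 1.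
Proof.
by move=> s0; rewrite expR_gt0 -[leRHS]expR0 ler_expR oppr_le0 mulr_ge0.
Qed.

Let mexpX s t : 0 <= t -> measurable_fun setT (fun w => expR (- (s * X t w))).
Proof.
by move=> t0; do 2 apply: measurableT_comp => //; apply: measurable_funM => //; exact: mX.
Qed.

Let iexpX s t : 0 <= s -> 0 <= t ->
  P.-integrable setT (fun w => (expR (- (s * X t w)))%:E).
Proof.
move=> s0 t0; apply: (le_integrable _ _ _
  (finite_measure_integrable_cst P (1 : R) measurableT)) => //.
  exact/measurable_EFinP/mexpX.
move=> w _ /=; have /andP[e0 e1] := expX t w s0.
by rewrite lee_fin !ger0_norm// ltW.
Qed.

Let LE s t : 0 <= s -> 0 <= t ->
  (\int[P]_w (expR (- (s * X t w)))%:E = (L s t)%:E)%E.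
Proof. by move=> s0 t0; rewrite fineK// integrable_fin_num//; exact: iexpX. Qed.

Let L_ge0 s t : 0 <= L s t.
Proof. by apply/fine_ge0/integral_ge0 => w _; rewrite lee_fin expR_ge0. Qed.

Let L0 s : 0 <= s -> L s 0 = 1.
Proof.
move=> s0; apply: EFin_inj; rewrite -LE//.
transitivity (\int[P]_w (1%:E : \bar R))%E; last first.
  by rewrite [LHS]integral_cst//= probability_setT mule1.
apply: eq_ae_integralT; case: levyX => _ + _ _ _; apply: filterS => w ->.
by rewrite mulr0 oppr0 expR0.
Qed.

Let LD s a b : 0 <= s -> 0 <= a -> 0 < b -> L s (a + b) = L s a * L s b.
Proof.
move=> s0 a0 b0; have ab0 : 0 <= a + b by rewrite addr_ge0// ltW.
have ab : a < a + b by rewrite ltrDl.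
apply: EFin_inj; rewrite -LE//.
pose F (z : R * R) := (expR (- (s * z.1)) * expR (- (s * z.2)))%:E.
have mF : measurable_fun setT F.
  apply/measurable_EFinP; apply: measurable_funM;
  do 2 apply: measurableT_comp => //; exact: measurable_funM.
have F0 z : (0 <= F z)%E by rewrite lee_fin mulr_ge0 ?expR_ge0.
transitivity (\int[P]_w F (X a w, X (a + b) w - X a w)%R)%E.
  apply: eq_integral => w _; rewrite /F/= -expRD; congr (expR _)%:E; ring.
rewrite (levy_independent_stationary_pairs levyX a0 ab mF F0).
rewrite (addrC a) addrK EFinM -(LE s0 a0).
rewrite -ge0_integralZr//; last 2 first.
- exact/measurable_EFinP/mexpX.
- by rewrite lee_fin.
apply: eq_integral => w _; rewrite -LE ?(ltW b0)// -ge0_integralZl//.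
exact/measurable_EFinP/mexpX/ltW.
Qed.

Let LX s h n : 0 <= s -> 0 < h -> L s (n%:R * h) = L s h ^+ n.
Proof.
move=> s0 h0; elim: n => [|n ih]; first by rewrite mul0r L0// expr0.
by rewrite -natr1 mulrDl mul1r LD// ?ih ?exprSr// mulr_ge0// ltW.
Qed.

Let p j t : R := fine (P [set w | M t w = j.+1]).
Let r t : R := fine (P [set w | (k < M t w)%N]).

Let measurable_level t (A : set nat) : 0 <= t -> measurable [set w | A (M t w)].
Proof.
move=> t0.
have -> : [set w | A (M t w)] = X t @^-1` ((fun n => n%:R) @` A).
  apply/seteqP; split => w /=; first by move=> Aw; exists (M t w).
  by move=> [n An /eqP]; rewrite /X eqr_nat => /eqP <-.
rewrite -[X in measurable X]setTI; apply: mX => //.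
apply: countable_measurable; first by move=> x; exact: measurable_set1.
exact: sub_countable (card_image_le _ A) _.
Qed.

(** Split 1 - exp(- s M) by the value of M: the value 0 contributes nothing, the values 1 to k
    contribute exactly the sum, and larger ones between 0 and their probability. *)
Let one_minus_L s t : 0 <= s -> 0 <= t ->
  \sum_(j < k) (1 - expR (- (s * j.+1%:R))) * p j t <= 1 - L s t <=
  \sum_(j < k) (1 - expR (- (s * j.+1%:R))) * p j t + r t.
Proof.
move=> s0 t0.
pose c (j : 'I_k) := 1 - expR (- (s * j.+1%:R)).
have c0 j : 0 <= c j <= 1.
  rewrite /c lerBlDr lerDl expR_ge0 andbT subr_ge0 -[leRHS]expR0 ler_expR.
  by rewrite oppr_le0 mulr_ge0.
pose A (j : nat) := [set w | M t w = j.+1].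
have mA j : measurable (A j) by exact: (measurable_level [set j.+1]).
pose B := [set w | (k < M t w)%N].
have mB : measurable B by exact: (measurable_level [set n | (k < n)%N]).
pose G w := \sum_(j < k) c j * \1_(A j) w.
have iA (j : 'I_k) : P.-integrable setT (fun w => (c j * \1_(A j) w)%:E).
  apply: (eq_integrable _ (fun w => (c j)%:E * (\1_(A j) w)%:E)%E) => //.
    by apply: integrableZl => //; exact: integrable_indic.
have iG : P.-integrable setT (fun w => (G w)%:E).
  apply: (eq_integrable _ (fun w => \sum_(j < k) (c j * \1_(A j) w)%:E)%E) => //.
    by move=> w _; rewrite sumEFin.
  by apply: integrable_sum => //.
have GE : (\int[P]_w (G w)%:E = (\sum_(j < k) c j * p j t)%:E)%E.
  under eq_integral do rewrite -sumEFin.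
  rewrite integral_sum// -sumEFin; apply: eq_bigr => j _.
  under eq_integral do rewrite EFinM.
  rewrite integralZl//; last exact: integrable_indic.
  by rewrite integral_indic// setIT EFinM /p fineK//; exact: (fin_num_measure P _ (mA j)).
have iB : P.-integrable setT (fun w => (\1_B w)%:E) by exact: integrable_indic.
have i1 := finite_measure_integrable_cst P (1 : R) measurableT.
have LE1 : (\int[P]_w (1 - expR (- (s * X t w)))%:E = (1 - L s t)%:E)%E.
  under eq_integral do rewrite EFinB.
  rewrite integralB//; last exact: iexpX.
  by rewrite [X in (X - _)%E]integral_cst//= probability_setT mule1 LE.
have i1e : P.-integrable setT (fun w => (1 - expR (- (s * X t w)))%:E).
  apply: (eq_integrable _ (fun w => 1%:E - (expR (- (s * X t w)))%:E)%E) => //.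
  by apply: integrableB => //; exact: iexpX.
have G_E w : G w = if (0 < M t w <= k)%N then 1 - expR (- (s * X t w)) else 0.
  case: ifPn => [/andP[M0 Mk]|Mk].
    have Mk' : ((M t w).-1 < k)%N by rewrite prednK.
    rewrite /G (bigD1 (Ordinal Mk'))//= big1 ?addr0.
      by rewrite indicE mem_set ?mulr1 /A/= ?prednK// /c/= prednK.
    move=> i iM; rewrite indicE memNset ?mulr0// /A/= => Mi.
    by move/eqP: iM; apply; apply: val_inj; rewrite /= Mi.
  rewrite /G big1// => i _; rewrite indicE memNset ?mulr0// /A/= => Mi.
  by move: Mk; rewrite Mi ltn0Sn ltn_ord.
have e01 w := expX t w s0.
apply/andP; split.
  rewrite -lee_fin -GE -LE1; apply: le_integral => // w _.
  rewrite lee_fin G_E; case: ifP => // _.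
  by rewrite subr_ge0; case/andP: (e01 w).
rewrite -lee_fin.
have -> : (\sum_(j < k) (1 - expR (- (s * j.+1%:R))) * p j t + r t)%:E =
    (\int[P]_w (G w + \1_B w)%:E)%E.
  under eq_integral do rewrite EFinD.
  rewrite integralD// GE integral_indic// setIT EFinD; congr (_ + _)%E.
  by rewrite /r fineK//; exact: (fin_num_measure P _ mB).
rewrite -LE1; apply: le_integral => //.
  apply: (eq_integrable _ (fun w => (G w)%:E + (\1_B w)%:E)%E) => //.
  exact: integrableD.
move=> w _; rewrite lee_fin G_E indicE.
have [M0|M0] := posnP (M t w).
  by rewrite /X M0/= mulr0 oppr0 expR0 subrr add0r.
have [Mk|Mk] := leqP (M t w) k; first by rewrite lerDl.
by rewrite mem_set//= add0r lerBlDr lerDl expR_ge0.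
Qed.

Let one_minus_L_div s : 0 <= s -> (1 - L s h) / h @[h --> 0^'+] --> psi s.
Proof.
move=> s0; case: gcpM => _ hp hr.
apply: (@squeeze_cvgr _ _ _ _
  (fun h => \sum_(j < k) (1 - expR (- (s * j.+1%:R))) * (p j h / h))
  (fun h => \sum_(j < k) (1 - expR (- (s * j.+1%:R))) * (p j h / h) + r h / h)).
- near=> h; have h0 : 0 < h by [].
  have /andP[l u] := one_minus_L s0 (ltW h0).
  under eq_bigr do rewrite mulrA; rewrite -mulr_suml -mulrDl.
  by rewrite !ler_pM2r ?invr_gt0// l u.
- apply: cvg_sumr => j; rewrite [X in _ --> X]mulrC; apply: cvgM (hp j); exact: cvg_cst.
- rewrite -[psi s]addr0; apply: cvgD => //.
  by apply: cvg_sumr => j; rewrite [X in _ --> X]mulrC; apply: cvgM (hp j); exact: cvg_cst.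
Unshelve. all: by end_near. Qed.

(** Multiplicativity gives L(t) = (1 - x)^n with x = 1 - L(t / n), and n x tends to t psi by the
    rates. The bounds exp(- x / (1 - x)) <= 1 - x <= exp(- x) then squeeze L(t). *)
Let L_expR s t : 0 <= s -> 0 <= t -> L s t = expR (- (t * psi s)).
Proof.
move=> s0; rewrite le_eqVlt => /predU1P[<-|t0].
  by rewrite mul0r oppr0 expR0 L0.
pose h n := t / n.+1%:R; have h0 n : 0 < h n by rewrite divr_gt0.
have ht n : n.+1%:R * h n = t by rewrite /h mulrC divfK// pnatr_eq0.
pose x n := 1 - L s (h n).
have Lx n : L s t = (1 - x n) ^+ n.+1.
  by rewrite /x subKr -(LX n.+1 s0 (h0 n)) ht.
have x1 n : 0 <= 1 - x n by rewrite /x subKr.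
have hcvg : h @ \oo --> (0 : R).
  rewrite -(mulr0 t); apply: cvgM; [exact: cvg_cst|exact: cvg_harmonic].
have xh : x n / h n @[n --> \oo] --> psi s.
  by have /cvg_at_rightP := one_minus_L_div s0; apply; split.
have nx : n.+1%:R * x n @[n --> \oo] --> t * psi s.
  under eq_fun => n.
    have -> : n.+1%:R * x n = t * (x n / h n).
      by rewrite /h; field; rewrite !gt_eqF.
    over.
  by apply: cvgM => //; exact: cvg_cst.
have xcvg : x @ \oo --> (0 : R).
  have -> : x = (fun n => x n / h n * h n).
    by apply/funext => n; rewrite divfK// gt_eqF.
  by rewrite -(mulr0 (psi s)); apply: cvgM.
apply/eqP; rewrite eq_le; apply/andP; split.
  have lim : expR (- (n.+1%:R * x n)) @[n --> \oo] --> expR (- (t * psi s)).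
    by apply: (cvg_comp _ _ (cvgN nx)); exact: continuous_expR.
  rewrite -(cvg_lim _ lim)//; apply: limr_ge; first by apply/cvg_ex; eexists; exact: lim.
  apply: nearW => n; rewrite (Lx n) -mulrN expRM_natl.
  by apply: lerXn2r; rewrite ?nnegrE ?expR_ge0//; exact: expR_ge1Dx.
have lim : expR (- ((n.+1%:R * x n) / (1 - x n))) @[n --> \oo] --> expR (- (t * psi s)).
  suff : n.+1%:R * x n / (1 - x n) @[n --> \oo] --> t * psi s.
    move=> /cvgN lim0; exact: (cvg_comp _ _ lim0 (@continuous_expR R _)).
  rewrite -[X in _ --> X]divr1 -[X in _ / X]subr0.
  apply: cvgM => //; apply: cvgV; first by rewrite subr0 oner_neq0.
  by apply: cvgB => //; exact: cvg_cst.
rewrite -(cvg_lim _ lim)//; apply: limr_le; first by apply/cvg_ex; eexists; exact: lim.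
near=> n; have x_lt1 : 0 < 1 - x n.
  by rewrite subr_gt0; near: n; apply: (cvgr_lt 0); rewrite ?ltr01.
rewrite (Lx n) -mulrA -mulrN expRM_natl; apply: lerXn2r; rewrite ?nnegrE ?expR_ge0 ?x1//.
rewrite expRN -[leRHS]invrK lef_pV2 ?posrE ?invr_gt0 ?expR_gt0//.
apply: le_trans (expR_ge1Dx _); rewrite le_eqVlt; apply/orP; left; apply/eqP.
field; rewrite gt_eqF//.
Unshelve. all: by end_near. Qed.

Lemma gcp_laplace s t : 0 <= s -> 0 <= t ->
  (\int[P]_w (expR (- (s * (M t w)%:R)))%:E = (expR (- (t * psi s)))%:E)%E.
Proof. by move=> s0 t0; rewrite -L_expR// LE. Qed.

Let m1 : R := \sum_(j < k) j.+1%:R * lambda j.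
Let m2 : R := \sum_(j < k) j.+1%:R ^+ 2 * lambda j.

Let s_ n : R := 2 ^- n.
Let s_gt0 n : 0 < s_ n. Proof. by rewrite invr_gt0 exprn_gt0. Qed.

Let psi_ge0 s : 0 <= s -> 0 <= psi s.
Proof.
move=> s0; apply: sumr_ge0 => j _; rewrite mulr_ge0// subr_ge0.
by rewrite -[leRHS]expR0 ler_expR oppr_le0 mulr_ge0.
Qed.

Let cvg_jump (j : 'I_k) :
  (1 - expR (- (s_ n * j.+1%:R))) / s_ n @[n --> \oo] --> (j.+1%:R : R).
Proof.
apply: cvg_1BexpRN_div => //.
- by move=> n; rewrite mulr_ge0// ltW.
- by rewrite -(mul0r j.+1%:R); apply: cvgM; [exact: cvg_halfX|exact: cvg_cst].
- under eq_fun do rewrite mulrAC divff ?gt_eqF// mul1r.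
  exact: cvg_cst.
Qed.

Let cvg_psi : psi (s_ n) / s_ n @[n --> \oo] --> m1.
Proof.
under eq_fun do rewrite mulr_suml.
apply: cvg_sumr => j; rewrite [X in _ --> X]mulrC.
under eq_fun do rewrite -mulrA.
by apply: cvgM; [exact: cvg_cst|exact: cvg_jump].
Qed.

(** Minus the second difference of [psi] at 0. Its summands are perfect squares, so it is
    nonnegative and of order s^2. *)
Let psi2 s := 2 * psi s - psi (2 * s).

Let psi2E s : psi2 s = \sum_(j < k) lambda j * (1 - expR (- (s * j.+1%:R))) ^+ 2.
Proof.
rewrite /psi2 /psi mulr_sumr -sumrB; apply: eq_bigr => j _.
have -> : - (2 * s * j.+1%:R) = - (s * j.+1%:R) + - (s * j.+1%:R) by ring.
rewrite expRD; ring.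
Qed.

Let cvg_psi2 : psi2 (s_ n) / s_ n ^+ 2 @[n --> \oo] --> m2.
Proof.
under eq_fun do rewrite psi2E mulr_suml.
apply: cvg_sumr => j; rewrite [X in _ --> X]mulrC.
under eq_fun do rewrite -mulrA -expr_div_n.
apply: cvgM; first exact: cvg_cst.
exact: (cvg_comp _ _ (@cvg_jump j) (@exprn_continuous R 2 j.+1%:R)).
Qed.

Let cvg_scale (g : R^nat) (y : R^nat) (t c : R) : (forall n, y n != 0) ->
  y @ \oo --> (0 : R) -> g n / y n @[n --> \oo] --> c ->
  t * g n @[n --> \oo] --> (0 : R) /\ t * g n / y n @[n --> \oo] --> t * c.
Proof.
move=> y0 ycvg gr; split.
  under eq_fun => n.
    have -> : t * g n = t * (g n / y n) * y n by rewrite -mulrA divfK.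
    over.
  by rewrite -(mulr0 (t * c)); apply: cvgM => //; apply: cvgM => //; exact: cvg_cst.
by under eq_fun do rewrite -mulrA; apply: cvgM => //; exact: cvg_cst.
Qed.

Let cvg_laplace1 t : 0 <= t ->
  (1 - expR (- (t * psi (s_ n)))) / s_ n @[n --> \oo] --> t * m1.
Proof.
move=> t0.
have [h1 h2] := @cvg_scale (fun n => psi (s_ n)) s_ t m1
  (fun n => lt0r_neq0 (s_gt0 n)) (@cvg_halfX R) cvg_psi.
apply: cvg_1BexpRN_div => // n.
by rewrite mulr_ge0// psi_ge0// ltW.
Qed.

Lemma gcp_first_moment t : 0 <= t ->
  (\int[P]_w ((M t w)%:R)%:E = (t * m1)%:E :> \bar R)%E.
Proof.
move=> t0; apply: (first_moment_laplace (mX t0) _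
  (L := fun s => expR (- (t * psi s)))) => //.
  by move=> s s0; rewrite -gcp_laplace// ltW.
exact: cvg_laplace1.
Qed.

Lemma gcp_second_moment t : 0 <= t ->
  (\int[P]_w ((M t w)%:R ^+ 2)%:E = (t * m2 + (t * m1) ^+ 2)%:E :> \bar R)%E.
Proof.
move=> t0; apply: (second_moment_laplace (mX t0) _
  (L := fun s => expR (- (t * psi s)))) => //.
  by move=> s s0; rewrite -gcp_laplace// ltW.
(* The transform at 2 s equals a^2 b, and 1 - 2 a + a^2 b = a^2 (b - 1) + (1 - a)^2: the first term
   yields the variance, the second the squared mean. *)
pose a n := expR (- (t * psi (s_ n))).
pose b n := expR (t * psi2 (s_ n)).
have -> : (fun n => (1 - 2 * expR (- (t * psi (2 ^- n))) +
    expR (- (t * psi (2 * 2 ^- n)))) / (2 ^- n) ^+ 2) =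
  (fun n => a n ^+ 2 * ((b n - 1) / s_ n ^+ 2) + ((1 - a n) / s_ n) ^+ 2).
  apply/funext => n; rewrite -/(s_ n).
  have -> : - (t * psi (2 * s_ n)) =
      - (t * psi (s_ n)) + - (t * psi (s_ n)) + t * psi2 (s_ n).
    by rewrite /psi2; ring.
  rewrite 2!expRD -/(a n) -/(b n); field; exact: lt0r_neq0.
have s2 n : 0 < s_ n ^+ 2 by rewrite exprn_gt0.
have s2cvg : s_ n ^+ 2 @[n --> \oo] --> (0 : R).
  rewrite -[X in _ --> X](expr0n R 2) .
  exact: (cvg_comp _ _ (@cvg_halfX R) (@exprn_continuous R 2 _)).
have [h1 h2] := @cvg_scale (fun n => psi2 (s_ n)) (fun n => s_ n ^+ 2) t m2
  (fun n => lt0r_neq0 (s2 n)) s2cvg cvg_psi2.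
have [h3 h4] := @cvg_scale (fun n => psi (s_ n)) s_ t m1
  (fun n => lt0r_neq0 (s_gt0 n)) (@cvg_halfX R) cvg_psi.
apply: cvgD; last exact: (cvg_comp _ _ (cvg_laplace1 t0) (@exprn_continuous R 2 _)).
rewrite -[t * m2]mul1r; apply: cvgM; last first.
  apply: cvg_expRB1_div => // n; rewrite psi2E mulr_ge0// sumr_ge0// => j _.
  by rewrite mulr_ge0// sqr_ge0.
have -> : (1 : R) = (expR (- 0)) ^+ 2 by rewrite oppr0 expR0 expr1n.
have h5 : a @ \oo --> expR (- 0).
  exact: (cvg_comp _ _ (cvgN h3) (@continuous_expR R _)).
exact: (cvg_comp _ _ h5 (@exprn_continuous R 2 (expR (- 0)))).
Qed.

Lemma gcp_second_order_moments : second_order_moments P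
  (fun t w => (M t w)%:R) (fun a => a * m1) (fun a b => a * m2 + m1 ^+ 2 * a * b).
Proof.
move=> a b a0 ab; rewrite unlock gcp_first_moment//; split => //.
move: ab; rewrite le_eqVlt => /predU1P[<-|ab].
  transitivity (\int[P]_w ((M a w)%:R ^+ 2)%:E : \bar R)%E.
    by apply: eq_integral => w _; rewrite /= expr2.
  by rewrite gcp_second_moment//; congr _%:E; ring.
have ba0 : 0 <= b - a by rewrite subr_ge0 ltW.
have XE0 t w : (0 <= (X t w)%:E)%E by rewrite lee_fin.
have XX0 t w : (0 <= (X t w ^+ 2)%:E)%E by rewrite lee_fin sqr_ge0.
(* The absolute value makes F nonnegative on the whole plane; it changes nothing at counts. *)
pose F (z : R * R) := `|z.1 * (z.1 + z.2)|%:E.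
have mF : measurable_fun setT F.
  apply/measurable_EFinP; apply: measurableT_comp => //.
  by apply: measurable_funM => //; exact: measurable_funD.
transitivity (\int[P]_w F (X a w, X b w - X a w)%R)%E.
  apply: eq_integral => w _; rewrite /F/= /X.
  by rewrite addrC subrK ger0_norm// mulr_ge0.
rewrite (levy_independent_stationary_pairs levyX a0 ab mF)//.
transitivity (\int[P]_w ((X a w ^+ 2)%:E + ((b - a) * m1)%:E * (X a w)%:E))%E.
  apply: eq_integral => w _.
  transitivity (\int[P]_v ((X a w ^+ 2)%:E + (X a w)%:E * (X (b - a) v)%:E))%E.
    apply: eq_integral => v _; rewrite /F/= ger0_norm ?mulr_ge0 ?addr_ge0//.
    by rewrite -EFinM -EFinD mulrDr expr2.
  rewrite ge0_integralD//.
  - rewrite [X in (X + _)%E]integral_cst//= probability_setT mule1.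
    rewrite ge0_integralZl//.
    + by rewrite gcp_first_moment// muleC.
    + exact/measurable_EFinP/mX.
  - by move=> v _; exact: mule_ge0.
  - apply: emeasurable_funM => //; exact/measurable_EFinP/mX.
have m1_ge0 : 0 <= m1 by apply: sumr_ge0 => j _; rewrite mulr_ge0.
have c0 : (0 <= ((b - a) * m1)%:E)%E by rewrite lee_fin mulr_ge0.
have mXE : measurable_fun setT (fun w => (X a w)%:E) by exact/measurable_EFinP/mX.
rewrite ge0_integralD//.
- rewrite gcp_second_moment// ge0_integralZl//.
  by rewrite gcp_first_moment// -EFinM -EFinD; congr _%:E; ring.
- by apply/measurable_EFinP/measurable_funX/mX.
- by move=> w _; exact: mule_ge0.
- exact: emeasurable_funM.
- by move=> z; rewrite lee_fin.
Qed.

End gcp_laplace.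

Lemma integrable_ge0_fin d (T : measurableType d) (R : realType)
    (m : {measure set T -> \bar R}) (f : T -> R) (c : R) :
  measurable_fun setT f -> (forall w, 0 <= f w) ->
  (\int[m]_w (f w)%:E = c%:E)%E -> m.-integrable setT (fun w => (f w)%:E).
Proof.
move=> mf f0 fc; apply/integrableP; split; first exact/measurable_EFinP.
under eq_integral do rewrite gee0_abs ?lee_fin//.
by rewrite fc ltry.
Qed.

Section skellam_moments.
Context d (T : measurableType d) (R : realType) (P : probability T R).
Variables (k : nat) (lambda mu : 'I_k -> R) (S : R -> T -> R).
Hypothesis lambda_ge0 : forall j, 0 <= lambda j.
Hypothesis mu_ge0 : forall j, 0 <= mu j.
Hypothesis gspS : generalized_skellam_process P lambda mu S.

Let m1 : R := \sum_(j < k) j.+1%:R * (lambda j - mu j).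
Let m2 : R := \sum_(j < k) j.+1%:R ^+ 2 * (lambda j + mu j).

Lemma skellam_cvg_dyad : {ae P, forall w, forall u, 0 <= u ->
  S (dyad n u) w @[n --> \oo] --> S u w}.
Proof.
have [M1 [M2 [[[_ _ _ _ c1] _ _] [[_ _ _ _ c2] _ _] _ SE]]] := gspS.
apply: filterS2 c1 c2 => w c1 c2 u u0.
under eq_fun do rewrite SE ?(ltW (dyad_gt0 _ _))//.
rewrite SE//; apply: cvgB; [exact: (cvg_dyad_of_cadlag c1)|exact: (cvg_dyad_of_cadlag c2)].
Qed.

(** Convergence along the grid does not suffice for the fractional process, where [S] is evaluated
    at the values of an inverse subordinator. *)
Lemma skellam_right_cvg : {ae P, forall w, forall u, 0 <= u ->
  S v w @[v --> u^'+] --> S u w}.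
Proof.
have [M1 [M2 [[[_ _ _ _ c1] _ _] [[_ _ _ _ c2] _ _] _ SE]]] := gspS.
apply: filterS2 c1 c2 => w [c1 _] [c2 _] u u0; rewrite SE//.
have : ((M1 v w)%:R - (M2 v w)%:R : R) @[v --> u^'+] --> ((M1 u w)%:R - (M2 u w)%:R : R).
  by apply: cvgB; [exact: c1|exact: c2].
apply: cvg_trans; apply: near_eq_cvg; near=> v.
by rewrite SE// (le_trans u0)// ltW.
Unshelve. all: by end_near. Qed.

(** Independence factorizes the cross terms, so the products of means combine to the square of a
    difference of rates, while the terms linear in [a] add up. *)
Lemma skellam_second_order_moments : second_order_moments P S
  (fun a => a * m1) (fun a b => a * m2 + m1 ^+ 2 * a * b).
Proof.
have [M1 [M2 [G1 G2 [mX mY indep] SE]]] := gspS.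
have H1 := gcp_second_order_moments lambda_ge0 G1.
have H2 := gcp_second_order_moments mu_ge0 G2.
pose X t w : R := (M1 t w)%:R; pose Y t w : R := (M2 t w)%:R.
pose l1 := \sum_(j < k) j.+1%:R * lambda j; pose l2 := \sum_(j < k) j.+1%:R ^+ 2 * lambda j.
pose u1 := \sum_(j < k) j.+1%:R * mu j; pose u2 := \sum_(j < k) j.+1%:R ^+ 2 * mu j.
have m1E : m1 = l1 - u1.
  by rewrite /m1 /l1 /u1 -sumrB; apply: eq_bigr => j _; rewrite mulrBr.
have m2E : m2 = l2 + u2.
  by rewrite /m2 /l2 /u2 -big_split; apply: eq_bigr => j _; rewrite mulrDr.
have EX a : 0 <= a -> (\int[P]_w (X a w)%:E = (a * l1)%:E)%E.
  by move=> a0; have [<- _] := H1 a a a0 (lexx a); rewrite unlock.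
have EY a : 0 <= a -> (\int[P]_w (Y a w)%:E = (a * u1)%:E)%E.
  by move=> a0; have [<- _] := H2 a a a0 (lexx a); rewrite unlock.
have iX a : 0 <= a -> P.-integrable setT (fun w => (X a w)%:E).
  move=> a0; apply: integrable_ge0_fin (EX a a0) => //; exact: mX.
have iY a : 0 <= a -> P.-integrable setT (fun w => (Y a w)%:E).
  move=> a0; apply: integrable_ge0_fin (EY a a0) => //; exact: mY.
have EXX a b : 0 <= a -> a <= b ->
    (\int[P]_w (X a w * X b w)%:E = (a * l2 + l1 ^+ 2 * a * b)%:E)%E.
  by move=> a0 ab; have [_ <-] := H1 a b a0 ab; rewrite unlock.
have EYY a b : 0 <= a -> a <= b ->
    (\int[P]_w (Y a w * Y b w)%:E = (a * u2 + u1 ^+ 2 * a * b)%:E)%E.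
  by move=> a0 ab; have [_ <-] := H2 a b a0 ab; rewrite unlock.
have EXY a b : 0 <= a -> 0 <= b ->
    (\int[P]_w (X a w * Y b w)%:E = (a * l1 * (b * u1))%:E)%E.
  move=> a0 b0; pose F (z : R * R) := `|z.1 * z.2|%:E.
  have mF : measurable_fun setT F.
    by apply/measurable_EFinP; apply: measurableT_comp => //; exact: measurable_funM.
  have F0 z : (0 <= F z)%E by rewrite lee_fin.
  transitivity (\int[P]_w F (X a w, Y b w))%E.
    by apply: eq_integral => w _; rewrite /F/= ger0_norm// mulr_ge0.
  have iab (A B : set R) : measurable A -> measurable B ->
      P (X a @^-1` A `&` Y b @^-1` B) = (P (X a @^-1` A) * P (Y b @^-1` B))%E.
    by move=> mA mB; apply: indep; apply: sub_sigma_algebra; [exists a, A|exists b, B].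
  rewrite (ge0_integral_indep (mX _ a0) (mY _ b0) iab mF F0).
  transitivity (\int[P]_v ((a * l1)%:E * (Y b v)%:E))%E.
    apply: eq_integral => v _; rewrite -EX// -ge0_integralZr//.
    - by apply: eq_integral => w _; rewrite /F/= ger0_norm ?mulr_ge0// EFinM.
    - exact/measurable_EFinP/mX.
    - by move=> w _; rewrite lee_fin.
    - by rewrite lee_fin.
  by rewrite integralZl//; [rewrite EY// -EFinM|exact: iY].
have iXX a b : 0 <= a -> a <= b -> P.-integrable setT (fun w => (X a w * X b w)%:E).
  move=> a0 ab; apply: integrable_ge0_fin (EXX a b a0 ab).
    by apply: measurable_funM; apply: mX; rewrite // (le_trans a0).
  by move=> w; rewrite mulr_ge0.
have iYY a b : 0 <= a -> a <= b -> P.-integrable setT (fun w => (Y a w * Y b w)%:E).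
  move=> a0 ab; apply: integrable_ge0_fin (EYY a b a0 ab).
    by apply: measurable_funM; apply: mY; rewrite // (le_trans a0).
  by move=> w; rewrite mulr_ge0.
have iXY a b : 0 <= a -> 0 <= b -> P.-integrable setT (fun w => (X a w * Y b w)%:E).
  move=> a0 b0; apply: integrable_ge0_fin (EXY a b a0 b0).
    by apply: measurable_funM; [exact: mX|exact: mY].
  by move=> w; rewrite mulr_ge0.
move=> a b a0 ab; have b0 := le_trans a0 ab; rewrite !unlock; split.
  transitivity (\int[P]_w ((X a w)%:E - (Y a w)%:E))%E.
    by apply: eq_integral => w _; rewrite SE// EFinB.
  rewrite integralB//; [|exact: iX|exact: iY].
  by rewrite EX// EY// -EFinB m1E; congr _%:E; ring.
transitivity (\int[P]_w (((X a w * X b w)%:E + (Y a w * Y b w)%:E) -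
    ((X a w * Y b w)%:E + (X b w * Y a w)%:E)))%E.
  apply: eq_integral => w _; transitivity ((S a w * S b w)%:E) => //.
  rewrite !SE// -!EFinD; congr _%:E.
  rewrite /X /Y; ring.
rewrite integralB//; last 2 first.
- by apply: integrableD => //; [exact: iXX|exact: iYY].
- by apply: integrableD => //; exact: iXY.
have -> : (\int[P]_w ((X a w * X b w)%:E + (Y a w * Y b w)%:E) =
    \int[P]_w (X a w * X b w)%:E + \int[P]_w (Y a w * Y b w)%:E)%E.
  by rewrite integralD//; [exact: iXX|exact: iYY].
have -> : (\int[P]_w ((X a w * Y b w)%:E + (X b w * Y a w)%:E) =
    \int[P]_w (X a w * Y b w)%:E + \int[P]_w (X b w * Y a w)%:E)%E.
  by rewrite integralD//; exact: iXY.
rewrite EXX// EYY// !EXY// -!EFinD m1E m2E; congr _%:E; ring.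
Qed.

End skellam_moments.

(** * The inverse stable subordinator *)

Section gamma_integrals.
Context {R : realType}.
Local Notation mu := (@lebesgue_measure R).

Lemma ge0_integral_affine_in (D : set R) (c b : R) (f : R -> \bar R) : 0 < c ->
  measurable D -> measurable_fun setT f -> (forall x, 0 <= f x)%E ->
  (\int[mu]_(x in D) f x =
   c%:E * \int[mu]_(x in (fun x => (c * x + b)%R) @^-1` D) f (c * x + b)%R)%E.
Proof.
move=> c0 mD mf f0; rewrite integral_mkcond [in RHS]integral_mkcond.
rewrite (@ge0_integral_affine _ c b)//.
- by apply/(measurable_restrictT f) => //; exact: measurable_funTS.
- by move=> x; exact: erestrict_ge0.
Qed.

(** The integrand is singular at 0 for a < 1, so the fundamental theorem is applied on
    [v / (n + 2), v], followed by monotone convergence; n + 2 keeps the left end strictly below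
    v. *)
Lemma integral_powR0 (a v : R) : 0 < a -> 0 < v ->
  (\int[mu]_(u in `]0%R, v]) (a * u `^ (a - 1))%:E = (v `^ a)%:E)%E.
Proof.
move=> a0 v0.
pose e n : R := v / n.+2%:R.
have e0 n : 0 < e n by rewrite divr_gt0.
have ev n : e n < v by rewrite ltr_pdivrMr// ltr_pMr// ltr1n.
have mf : measurable_fun setT (fun u => (a * u `^ (a - 1))%:E).
  apply/measurable_EFinP; apply: measurable_funM => //.
have -> : `]0, v]%classic = \bigcup_n `[e n, v]%classic.
  apply/seteqP; split => x /=; rewrite in_itv/=.
    move=> /andP[x0 xv].
    exists (Num.truncn (v / x)) => //=; rewrite in_itv/= xv andbT.
    rewrite ler_pdivrMr// mulrC -ler_pdivrMr// ltW//.
    by rewrite (lt_le_trans (truncnS_gt _))// ler_nat.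
  move=> [n _]; rewrite /= in_itv/= => /andP[ex ->].
  by rewrite (lt_le_trans (e0 n)).
have h : (\int[mu]_(u in `[e n, v]) (a * u `^ (a - 1))%:E)%E @[n --> \oo] -->
    (\int[mu]_(u in \bigcup_n `[e n, v]%classic) (a * u `^ (a - 1))%:E)%E.
  apply: ge0_nondecreasing_set_cvg_integral => //.
  - apply/nondecreasing_seqP => n; rewrite subsetEset => x /=.
    rewrite !in_itv/= => /andP[ex ->]; rewrite andbT (le_trans _ ex)//.
    by rewrite ler_pM2l// lef_pV2 ?posrE// ler_nat.
  - by move=> i; exact: measurable_funTS.
  - by move=> i x _; rewrite lee_fin mulr_ge0 ?powR_ge0// ltW.
have E n : (\int[mu]_(u in `[e n, v]) (a * u `^ (a - 1))%:E =
    (v `^ a - e n `^ a)%:E)%E.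
  rewrite EFinB; apply: (@continuous_FTC2 _ _ (fun u => u `^ a)) => //.
  - apply: derivable_within_continuous => x; rewrite in_itv/= => /andP[ex _].
    apply: derivableM => //; apply: derivable_powR.
    by rewrite in_itv/= andbT (lt_le_trans (e0 n)).
  - have cont x : 0 < x -> {for x, continuous (fun u => u `^ a)}.
      move=> x0; apply: differentiable_continuous; apply/derivable1_diffP.
      by apply: derivable_powR; rewrite in_itv/= andbT.
    split.
    + move=> x; rewrite in_itv/= => /andP[ex _]; apply: derivable_powR.
      by rewrite in_itv/= andbT (lt_trans (e0 n)).
    + by apply/cvg_at_right_filter; exact: cont.
    + by apply/cvg_at_left_filter; exact: cont.
  - move=> x; rewrite in_itv/= => /andP[ex _]; rewrite powR_derive1//.
    by rewrite in_itv/= andbT (lt_trans (e0 n)).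
rewrite (_ : (fun n => _) = (fun n => (v `^ a - e n `^ a)%:E)) in h; last first.
  exact/funext.
apply: (cvg_unique (@ereal_hausdorff R) h).
apply: cvg_EFin; first exact: nearW.
rewrite -[X in _ --> X]subr0; apply: cvgB; first exact: cvg_cst.
have /cvg_at_rightP := powR_cvg0 a0; apply; split => //.
rewrite -[X in _ --> X](mulr0 v); apply: cvgM; first exact: cvg_cst.
by have := @cvg_harmonic R; rewrite -cvg_shiftS.
Qed.

Lemma integral_expR_tail (s u : R) : 0 < s ->
  (\int[mu]_(v in `[u, +oo[) (s * expR (- (s * v)))%:E =
   (expR (- (s * u)))%:E)%E.
Proof.
move=> s0.
have mf : measurable_fun setT (fun v => (s * expR (- (s * v)))%:E).
  apply/measurable_EFinP; apply: measurable_funM => //.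
  by do 2 apply: measurableT_comp => //; exact: measurable_funM.
have f0 v : (0 <= (s * expR (- (s * v)))%:E)%E.
  by rewrite lee_fin mulr_ge0 ?expR_ge0// ltW.
rewrite (@ge0_integral_affine_in _ 1 u)// mul1e.
have -> : (fun x : R => 1 * x + u) @^-1` `[u, +oo[ = `[0, +oo[%classic.
  by apply/seteqP; split => x /=; rewrite !in_itv/= !andbT mul1r lerDr.
transitivity ((expR (- (s * u)))%:E *
    \int[mu]_(x in `[0%R, +oo[) (s * expR (- (s * x)))%:E)%E.
  rewrite -ge0_integralZl//; last exact: (measurable_funTS mf).
  apply: eq_integral => x _; rewrite -EFinM mul1r; congr _%:E.
  have -> : - (s * (x + u)) = - (s * u) + - (s * x) by ring.
  by rewrite expRD; ring.
rewrite -[RHS]mule1 -(integral_exponential_pdf s0); congr (_ * _)%E.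
rewrite [LHS]integral_mkcond; apply: eq_integral => x _.
rewrite /exponential_pdf !patchE.
by case: ifP => //; rewrite mulNr.
Qed.

Let gamma_integrand_ge0 (a u : R) : (0 <= (u `^ a * expR (- u))%:E)%E.
Proof. by rewrite lee_fin mulr_ge0 ?powR_ge0 ?expR_ge0. Qed.

Let measurable_gamma_integrand (a : R) :
  measurable_fun setT (fun u : R => (u `^ a * expR (- u))%:E).
Proof.
apply/measurable_EFinP; apply: measurable_funM => //.
by do 2 apply: measurableT_comp => //.
Qed.

Let gamma_lty (a : R) : 0 < a -> a <= 1 ->
  (\int[mu]_(u in `]0%R, +oo[) (u `^ a * expR (- u))%:E < +oo)%E.
Proof.
move=> a0 a1.
have h0 : 0 < 2^-1 :> R by rewrite invr_gt0.
(* Uses u^a <= 1 + u <= 2 exp(u / 2); the factor 4 turns the exponential density of rate 1/2 into 2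
   exp(- u / 2). *)
apply: (@le_lt_trans _ _
  (\int[mu]_(u in `[0%R, +oo[) (4%:E * (2^-1 * expR (- (2^-1 * u)))%:E))%E).
  apply: (@le_trans _ _ (\int[mu]_(u in `[0%R, +oo[) (u `^ a * expR (- u))%:E)%E).
    apply: ge0_subset_integral => //; first exact: (measurable_funTS (measurable_gamma_integrand a)).
    by move=> x /=; rewrite !in_itv/= !andbT => /ltW.
  apply: ge0_le_integral => //.
  - exact: (measurable_funTS (measurable_gamma_integrand a)).
  - apply/measurable_funTS/measurable_EFinP/measurable_funM => //.
    apply: measurable_funM => //.
    by do 2 apply: measurableT_comp => //; exact: measurable_funM.
  move=> x; rewrite /= in_itv/= andbT => x0; rewrite -EFinM lee_fin.
  have -> : - x = - (2^-1 * x) + - (2^-1 * x) by lra.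
  rewrite expRD !mulrA ler_pM2r ?expR_gt0//.
  have xa : x `^ a <= 1 + x.
    have [x1|x1] := leP x 1.
      have : x `^ a <= 1 `^ a by rewrite ge0_ler_powR ?nnegrE// ltW.
      by rewrite powR1; lra.
    by have := ler1_powR (ltW x1) a1; lra.
  have := expR_ge1Dx (2^-1 * x).
  have : expR (2^-1 * x) * expR (- (2^-1 * x)) = 1 by rewrite -expRD subrr expR0.
  have := expR_gt0 (- (2^-1 * x)); have := powR_ge0 x a.
  nra.
rewrite ge0_integralZl//; last first.
  apply/measurable_funTS/measurable_EFinP/measurable_funM => //.
  by do 2 apply: measurableT_comp => //; exact: measurable_funM.
by rewrite integral_expR_tail// -EFinM ltry.
Qed.

Lemma integral_GammaE (a : R) : 0 < a -> a <= 1 ->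
  (\int[mu]_(u in `]0%R, +oo[) (u `^ a * expR (- u))%:E = (Gamma (1 + a))%:E)%E.
Proof.
move=> a0 a1; rewrite /Gamma /Rintegral addrAC subrr add0r fineK//.
rewrite ge0_fin_numE; first exact: gamma_lty.
by apply: integral_ge0.
Qed.

(** On ]0, 1] the integrand is at least exp(- 1) u^a. *)
Lemma Gamma_gt0 (a : R) : 0 < a -> a <= 1 -> 0 < Gamma (1 + a).
Proof.
move=> a0 a1; rewrite -lte_fin -integral_GammaE//.
have a10 : 0 < a + 1 by rewrite addr_gt0.
apply: (@lt_le_trans _ _ ((expR (-1) / (a + 1))%:E)).
  by rewrite lte_fin divr_gt0// expR_gt0.
apply: (@le_trans _ _ (\int[mu]_(u in `]0%R, 1%R]) (u `^ a * expR (- u))%:E)%E); last first.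
  apply: ge0_subset_integral => //; first exact: (measurable_funTS (measurable_gamma_integrand a)).
  by move=> x /=; rewrite !in_itv/= andbT => /andP[].
have -> : (expR (-1) / (a + 1))%:E =
    (\int[mu]_(u in `]0%R, 1%R]) ((expR (-1) / (a + 1))%:E * ((a + 1) * u `^ (a + 1 - 1))%:E))%E.
  rewrite ge0_integralZl//.
  - by rewrite integral_powR0// powR1 mule1.
  - apply/measurable_funTS/measurable_EFinP/measurable_funM => //.
  - by move=> x _; rewrite lee_fin mulr_ge0 ?powR_ge0// ltW.
  - by rewrite lee_fin divr_ge0 ?expR_ge0// ltW.
apply: ge0_le_integral => //.
- by move=> x _; rewrite -EFinM lee_fin !mulr_ge0 ?invr_ge0 ?expR_ge0 ?powR_ge0// ltW.
- apply/measurable_funTS/measurable_EFinP/measurable_funM => //.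
  by apply: measurable_funM.
- exact: (measurable_funTS (measurable_gamma_integrand a)).
move=> x /=; rewrite in_itv/= => /andP[x0 x1].
rewrite -EFinM lee_fin addrK mulrA divfK ?gt_eqF// mulrC ler_wpM2l ?powR_ge0//.
by rewrite ler_expR lerN2.
Qed.

(** An integration by parts done by Tonelli: exp(- s u) is the integral of s exp(- s v) over v >= u,
    and integrating a u^(a - 1) over u <= v leaves v^a. Scaling v by 1 / s then gives the Gamma
    integral. *)
Lemma laplace_powR (a s : R) : 0 < a -> a <= 1 -> 0 < s ->
  (\int[mu]_(u in `]0%R, +oo[) (expR (- (s * u)) * (a * u `^ (a - 1)))%:E =
   (Gamma (1 + a) / s `^ a)%:E)%E.
Proof.
move=> a0 a1 s0.
pose w u : \bar R := ((a * u `^ (a - 1))%:E)%E.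
have w0 u : (0 <= w u)%E by rewrite lee_fin mulr_ge0 ?powR_ge0// ltW.
have mw : measurable_fun setT w.
  by apply/measurable_EFinP/measurable_funM.
pose g v : \bar R := (s * expR (- (s * v)))%:E.
have g0 v : (0 <= g v)%E by rewrite lee_fin mulr_ge0 ?expR_ge0// ltW.
have mg : measurable_fun setT g.
  apply/measurable_EFinP; apply: measurable_funM => //.
  by do 2 apply: measurableT_comp => //; exact: measurable_funM.
pose A := [set z : R * R | 0 < z.1 /\ z.1 <= z.2].
have mA : measurable A.
  have -> : A = (fst @^-1` `]0, +oo[%classic) `&` [set z | z.1 <= z.2].
    by apply/seteqP; split => z /=; rewrite /A/= in_itv/= andbT.
  apply: measurableI.
    by rewrite -[X in measurable X]setTI; exact: measurable_fst.
  rewrite -[X in measurable X]setTI.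
  have -> : [set: R * R] `&` [set z | z.1 <= z.2] =
      setT `&` (fun z : R * R => (z.1 <= z.2)%R) @^-1` [set true].
    by apply/seteqP; split => z /=; rewrite ?inE.
  exact: (measurable_fun_ler measurable_fst measurable_snd).
pose F (z : R * R) : \bar R := (w z.1 * g z.2 * (\1_A z)%:E)%E.
have F0 z : (0 <= F z)%E by rewrite !mule_ge0.
have mF : measurable_fun setT F.
  apply: emeasurable_funM; last exact/measurable_EFinP/measurable_indic.
  by apply: emeasurable_funM; apply: measurableT_comp.
transitivity (\int[mu]_u \int[mu]_v F (u, v))%E.
  rewrite integral_mkcond; apply: eq_integral => u _; rewrite patchE.
  rewrite mem_setE in_itv/= andbT; case: ifPn => [u0|/negP u0]; last first.
    rewrite integral0_eq// => v _; rewrite /F indicE memNset ?mule0//.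
    by rewrite /A/= => -[].
  transitivity (w u * \int[mu]_(v in `[u, +oo[) g v)%E.
    by rewrite integral_expR_tail// /w -EFinM mulrC.
  rewrite -ge0_integralZl//; last exact: (measurable_funTS mg).
  rewrite integral_mkcond; apply: eq_integral => v _.
  rewrite patchE /F indicE/=.
  have -> : ((u, v) \in A) = (v \in `[u, +oo[%classic).
    by apply/idP/idP; rewrite !inE /A/= in_itv/= andbT => // -[].
  by case: ifP; rewrite ?mule1 ?mule0.
transitivity (\int[mu]_v \int[mu]_u F (u, v))%E.
  exact: (@fubini_tonelli _ _ _ _ R mu mu F mF F0).
transitivity (\int[mu]_(v in `]0%R, +oo[) (v `^ a * (s * expR (- (s * v))))%:E)%E.
  rewrite [RHS]integral_mkcond; apply: eq_integral => v _; rewrite patchE.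
  rewrite mem_setE in_itv/= andbT; case: ifPn => [v0|/negP v0]; last first.
    rewrite integral0_eq// => u _; rewrite /F indicE memNset ?mule0//.
    by rewrite /A/= => -[u0 uv]; apply: v0; exact: lt_le_trans uv.
  rewrite EFinM -(integral_powR0 a0 v0) -ge0_integralZr//; last 3 first.
  - exact: (measurable_funTS mw).
  - by move=> x _; exact: w0.
  - exact: (g0 v).
  rewrite [RHS]integral_mkcond; apply: eq_integral => u _.
  rewrite patchE /F indicE/=.
  have -> : ((u, v) \in A) = (u \in `]0, v]%classic).
    by apply/idP/idP; rewrite !inE /A/= in_itv/= => /andP.
  by case: ifP; rewrite ?mule1 ?mule0.
have s1 : 0 < s^-1 by rewrite invr_gt0.
have mh : measurable_fun setT (fun v => (v `^ a * (s * expR (- (s * v))))%:E).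
  by apply/measurable_EFinP; apply: measurable_funM => //; exact/measurable_EFinP.
have h0 v : (0 <= (v `^ a * (s * expR (- (s * v))))%:E)%E.
  by rewrite lee_fin !mulr_ge0 ?powR_ge0 ?expR_ge0// ltW.
have maff : measurable_fun setT (fun x : R => s^-1 * x + 0).
  exact: measurable_funD (measurable_funM _ _) _.
rewrite (@ge0_integral_affine_in _ s^-1 0)//.
have -> : (fun x => s^-1 * x + 0) @^-1` `]0, +oo[ = `]0, +oo[%classic.
  by apply/seteqP; split => x /=; rewrite !in_itv/= !andbT addr0 pmulr_rgt0.
rewrite [in RHS]mulrC EFinM -integral_GammaE//.
rewrite -ge0_integralZl//; last 2 first.
- exact: (measurable_funTS (measurableT_comp mh maff)).
- by rewrite lee_fin ltW.
rewrite -ge0_integralZl//; last 2 first.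
- exact: (measurable_funTS (measurable_gamma_integrand a)).
- by rewrite lee_fin invr_ge0 powR_ge0.
apply: eq_integral => x; rewrite inE/= in_itv/= andbT => x0.
rewrite -!EFinM addr0 powRM ?(ltW x0) ?(ltW s1)//.
have -> : s^-1 `^ a = (s `^ a)^-1 by rewrite -powR_inv1 ?ltW// -powRrM mulN1r powRN.
have -> : s * (s^-1 * x) = x by rewrite mulrA divff ?mul1r// gt_eqF.
by congr _%:E; field; rewrite !gt_eqF// powR_gt0.
Qed.

End gamma_integrals.

(** * The right-continuous inverse of a nondecreasing unbounded function *)

Section generalized_inverse.
Context {R : realType}.
Local Notation mu := (@lebesgue_measure R).
Variable f : R -> R.
Hypothesis f_mono : forall a b, 0 <= a -> a <= b -> f a <= f b.
Hypothesis f_unbounded : forall t, exists2 x, 0 <= x & t < f x.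

Let level t := [set x | 0 <= x /\ t < f x].

Let level_neq0 t : level t !=set0.
Proof. by have [x x0 tx] := f_unbounded t; exists x. Qed.

Let level_lb t : lbound (level t) 0. Proof. by move=> x []. Qed.

Let level_has_lb t : has_lbound (level t). Proof. by exists 0; exact: (@level_lb t). Qed.

Let inv t := inf (level t).

Lemma ge0_inverse t : 0 <= inv t.
Proof. exact: lb_le_inf (@level_neq0 t) (@level_lb t). Qed.

Lemma le_inverse s t : s <= t -> inv s <= inv t.
Proof.
move=> st; apply: lb_le_inf => // x [x0 tx].
by apply: ge_inf => //; split => //; exact: le_lt_trans tx.
Qed.

Let lt_inverse t x : 0 <= x -> x < inv t -> f x <= t.
Proof.
move=> x0 xt; rewrite leNgt; apply/negP => tx.
by move: xt; rewrite ltNge => /negP; apply; apply: ge_inf.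
Qed.

Let gt_inverse t x : inv t < x -> t < f x.
Proof.
move=> tx; have [z [z0 tz] zx] := inf_lt (@level_neq0 t) tx.
by apply: lt_le_trans tz _; apply: f_mono => //; exact: ltW.
Qed.

(** For x >= 0 the conditions f x <= t and x <= inv t can differ only at the single point x = inv
    t. *)
Lemma inverse_integral t :
  ((inv t)%:E = \int[mu]_(x in `[0%R, +oo[) ((f x <= t)%R%:R)%:E)%E.
Proof.
transitivity (\int[mu]_x (\1_(`[0%R, inv t]%classic : set R) x)%:E)%E.
  rewrite integral_indic// setIT [RHS]lebesgue_measure_itv/= lte_fin.
  case: ltP => [_|wu]; first by rewrite oppr0 adde0.
  by congr _%:E; apply/eqP; rewrite eq_le wu ge0_inverse.
rewrite [RHS]integral_mkcond; apply: eq_ae_integralT.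
exists [set inv t]; split.
- exact: measurable_set1.
- exact: lebesgue_measure_set1.
move=> x /=; apply: contra_notP => xt.
rewrite patchE indicE !mem_setE !in_itv/= andbT.
have [x0|x0] := leP 0 x => //=.
case: (ltgtP x (inv t)) xt => // [xt _|tx _].
  by rewrite lt_inverse.
by rewrite leNgt gt_inverse.
Qed.

(** At [inv t + e] the value of [f] strictly exceeds [t], hence eventually [u n], so that
    [inv (u n)] is at most [inv t + e]. *)
Lemma cvg_inverse (u : R^nat) t : (forall n, t <= u n) -> u @ \oo --> t ->
  inv (u n) @[n --> \oo] --> inv t.
Proof.
move=> tu ut; apply/cvgrPdist_le => e e0.
have h : t < f (inv t + e) by apply: gt_inverse; rewrite ltrDl.
have : \forall n \near \oo, u n < f (inv t + e) by apply: (cvgr_lt t).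
apply: filterS => n un; rewrite distrC ger0_norm ?subr_ge0 ?le_inverse//.
rewrite lerBlDl; apply: ge_inf => //; split => //.
by rewrite addr_ge0 ?ge0_inverse// ltW.
Qed.

End generalized_inverse.

(** The terms may equal [p], which a right limit ignores; this does happen, since an inverse is
    constant across a jump of the subordinator. *)
Lemma cvg_right_seq {R : realType} (f : R -> R) (u : R^nat) (p : R) :
  f x @[x --> p^'+] --> f p -> (forall n, p <= u n) -> u @ \oo --> p ->
  f (u n) @[n --> \oo] --> f p.
Proof.
move=> /cvgrPdist_le fp pu up; apply/cvgrPdist_le => e e0.
have [d /= d0 hd] := fp e e0.
have : \forall n \near \oo, `|p - u n| < d by move/cvgrPdist_lt : up; exact.
apply: filterS => n un; have := pu n; rewrite le_eqVlt => /predU1P[<-|pun].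
  by rewrite subrr normr0 ltW.
exact: hd.
Qed.

Section density_measure.
Context {R : realType}.
Local Notation mu := (@lebesgue_measure R).
Local Open Scope ereal_scope.

(* The measure is the image under the first projection of the Lebesgue measure
   of the region below the graph; points outside the region are sent to -1. *)
Lemma exists_density_measure (w : R -> R) : measurable_fun setT w ->
  (forall u, 0 <= w u)%R ->
  exists m : {measure set R -> \bar R}, forall g : R -> \bar R,
    measurable_fun setT g -> (forall x, 0 <= g x) ->
    \int[m]_(x in `[0%R, +oo[) g x = \int[mu]_(u in `]0%R, +oo[) (g u * (w u)%:E).
Proof.
move=> mw w0.
pose A := [set z : R * R | [/\ 0 < z.1, 0 <= z.2 & z.2 <= w z.1]%R].
have mA : measurable A.
  have -> : A = (fst @^-1` `]0%R, +oo[%classic `&` snd @^-1` `[0%R, +oo[%classic)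
      `&` (fun z : R * R => (z.2 <= w z.1)%R) @^-1` [set true].
    apply/seteqP; split => z /=; rewrite /A/= !in_itv/= !andbT.
      by move=> [-> -> ->].
    by move=> [[-> ->] ->].
  apply: measurableI.
    apply: measurableI.
      by rewrite -[X in measurable X]setTI; exact: measurable_fst.
    by rewrite -[X in measurable X]setTI; exact: measurable_snd.
  rewrite -[X in measurable X]setTI.
  by apply: (measurable_fun_ler measurable_snd (measurableT_comp mw measurable_fst)).
pose psi (z : R * R) : R := (\1_A z * (z.1 + 1) - 1)%R.
have mpsi : measurable_fun setT psi.
  apply: measurable_funB => //; apply: measurable_funM; first exact: measurable_indic.
  by apply: measurable_funD => //; exact: measurable_fst.
pose psi' : measurableTypeR R * measurableTypeR R -> R := psi.
have mpsi' : measurable_fun setT psi' by exact: mpsi.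
exists (image_measure (mu \x mu) mpsi') => g mg g0.
rewrite integral_image_measure//; last exact: (measurable_funTS mg).
have -> : psi' @^-1` `[0%R, +oo[ = A.
  apply/seteqP; split => z; rewrite /psi' /psi/= in_itv/= andbT indicE.
    have [zA|zA] := pselect (A z); first by [].
    by rewrite memNset// mul0r add0r ler0N1.
  move=> Az; rewrite mem_set// mul1r addrK.
  by case: Az => /ltW.
rewrite integral_mkcond.
pose G (z : R * R) := g z.1 * (\1_A z)%:E.
have G0 z : 0 <= G z by rewrite mule_ge0.
have mG : measurable_fun setT G.
  apply: emeasurable_funM; last exact/measurable_EFinP/measurable_indic.
  exact: measurableT_comp mg measurable_fst.
transitivity (\int[mu \x mu]_z G z).
  apply: eq_integral => z _; rewrite patchE /G indicE; case: ifPn => zA.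
    by rewrite mule1 /psi' /psi indicE zA mul1r addrK.
  by rewrite mule0.
transitivity (\int[mu]_u \int[mu]_v G (u, v)).
  exact: (@fubini_tonelli1 _ _ _ _ R mu mu G mG G0).
rewrite [RHS]integral_mkcond; apply: eq_integral => u _; rewrite patchE mem_setE.
rewrite in_itv/= andbT; case: ifPn => [u0|/negP u0]; last first.
  rewrite integral0_eq// => v _; rewrite /G indicE memNset ?mule0//.
  by rewrite /A/= => -[].
have -> : (w u)%:E = \int[mu]_v (\1_(`[0%R, w u]%classic : set R) v)%:E.
  rewrite integral_indic// setIT [RHS]lebesgue_measure_itv/= lte_fin.
  case: ltP => [_|wu]; first by rewrite oppr0 adde0.
  by congr _%:E; apply/eqP; rewrite eq_le wu w0.
rewrite -ge0_integralZl//.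
- apply: eq_integral => v _; rewrite /G/= !indicE; congr (_ * (_%:R)%:E).
  congr nat_of_bool; apply/idP/idP; rewrite !inE /A/= in_itv/=.
    by move=> [_ -> ->].
  by move=> /andP[].
- exact/measurable_EFinP/measurable_indic.
Qed.

End density_measure.

(** * Occupation density of the subordinator and moments of its inverse *)

Section subordinator_occupation.
Context d (T : measurableType d) (R : realType) (P : probability T R).
Variables (alpha : R) (D : R -> T -> R).
Hypotheses (alpha_gt0 : 0 < alpha) (alpha_le1 : alpha <= 1).
Hypothesis mD : stochastic_process D.
Hypothesis D0 : {ae P, forall w, D 0 w = 0}.
Hypothesis D_mono : {ae P, forall w (s t : R), 0 <= s -> s <= t -> D s w <= D t w}.
Hypothesis D_right_cont : {ae P, forall w, forall u, 0 <= u ->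
  D (dyad n u) w @[n --> \oo] --> D u w}.
Hypothesis D_pairs : independent_stationary_pairs P D.
Local Open Scope ereal_scope.
Hypothesis D_laplace : forall s t : R, (0 < s)%R -> (0 <= t)%R ->
  \int[P]_w (expR (- s * D t w))%:E = (expR (- t * s `^ alpha))%:E.
Local Notation mu := (@lebesgue_measure R).

Let c := Gamma (1 + alpha).
Let c_gt0 : (0 < c)%R. Proof. exact: Gamma_gt0. Qed.

Let D_ge0 : {ae P, forall w, forall t, (0 <= t)%R -> (0 <= D t w)%R}.
Proof. by apply: filterS2 D0 D_mono => w w0 wm t t0; rewrite -w0 wm. Qed.

Let V x w := right_version D x w.

Let VE : {ae P, forall w, forall x, (0 <= x)%R -> V x w = D x w}.
Proof. by apply: filterS D_right_cont => w h x /h /right_versionE. Qed.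

Let mV : measurable_fun setT (fun z : R * T => V z.1 z.2).
Proof. exact: measurable_right_version. Qed.

Let rho (u : R) : R := (alpha * u `^ (alpha - 1) / c)%R.

Let mrho : measurable_fun setT rho.
Proof. by apply: measurable_funM => //; apply: measurable_funM. Qed.

Let rho_ge0 u : (0 <= rho u)%R.
Proof. by rewrite !mulr_ge0 ?powR_ge0 ?invr_ge0// ltW. Qed.

(* Negative times are sent to -1, hence ignored by integrals over [0, +oo[. *)
Let phi (z : R * T) : R :=
  (\1_(`[0%R, +oo[%classic : set R) z.1 * (`|V z.1 z.2| + 1) - 1)%R.

Let mphi : measurable_fun setT (phi : measurableTypeR R * T -> R).
Proof.
apply: measurable_funB => //; apply: measurable_funM.
  apply: measurableT_comp; last exact: measurable_fst.
  exact: measurable_indic.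
apply: measurable_funD => //.
by apply: measurableT_comp => //; exact: mV.
Qed.

Let occ : {measure set R -> \bar R} := image_measure (mu \x P) mphi.

Let integral_occ (g : R -> \bar R) : measurable_fun setT g -> (forall x, 0 <= g x) ->
  \int[occ]_(x in `[0%R, +oo[) g x =
  \int[mu]_(x in `[0%R, +oo[) \int[P]_w g (D x w).
Proof.
move=> mg g0; rewrite integral_image_measure//; last exact: (measurable_funTS mg).
have -> : (phi : measurableTypeR R * T -> R) @^-1` `[0%R, +oo[ =
    [set z | (0 <= z.1)%R].
  apply/seteqP; split => z; rewrite /phi/= in_itv/= andbT indicE mem_setE in_itv/= andbT.
    by case: (leP 0%R z.1) => //= _; rewrite mul0r add0r ler0N1.
  by move=> ->; rewrite mul1r addrK.
rewrite integral_mkcond.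
pose G (z : R * T) := g (`|V z.1 z.2|)%R * (\1_(`[0%R, +oo[%classic : set R) z.1)%:E.
have G0 z : 0 <= G z by rewrite mule_ge0.
have mG : measurable_fun setT G.
  apply: emeasurable_funM.
    apply: measurableT_comp mg _; apply: measurableT_comp => //.
  apply/measurable_EFinP; apply: measurableT_comp; last exact: measurable_fst.
  exact: measurable_indic.
transitivity (\int[mu \x P]_z G z).
  apply: eq_integral => z _; rewrite patchE.
  have -> : (z \in [set z : measurableTypeR R * T | (0 <= z.1)%R]) = (0 <= z.1)%R.
    by apply/idP/idP; rewrite inE.
  rewrite /G /phi !indicE !mem_setE !in_itv/= !andbT.
  by case: (leP 0%R z.1) => _; rewrite ?mule0// mule1 mul1r addrK.
transitivity (\int[mu]_x \int[P]_w G (x, w)).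
  exact: (@fubini_tonelli1 _ _ _ _ R mu P G mG G0).
rewrite [RHS]integral_mkcond; apply: eq_integral => x _; rewrite patchE mem_setE.
rewrite in_itv/= andbT; case: ifPn => x0; last first.
  rewrite integral0_eq// => w _; rewrite /G/= indicE mem_setE in_itv/= andbT.
  by rewrite (negbTE x0) mule0.
apply: eq_ae_integralT; apply: filterS2 VE D_ge0 => w VEw Dw.
by rewrite /G/= indicE mem_setE in_itv/= andbT x0 mule1 VEw// ger0_norm ?Dw.
Qed.

Lemma occupation (g : R -> \bar R) : measurable_fun setT g -> (forall x, 0 <= g x) ->
  \int[mu]_(x in `[0%R, +oo[) \int[P]_w g (D x w) =
  \int[mu]_(u in `]0%R, +oo[) (g u * (rho u)%:E).
Proof.
move=> mg g0; have [m hm] := exists_density_measure mrho rho_ge0.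
rewrite -integral_occ// -hm//.
have mE n : measurable_fun setT (fun x : R => (expR (- x) ^+ n.+1)%:E).
  by apply/measurable_EFinP; apply: measurable_funX; apply: measurableT_comp.
have E0 n (x : R) : 0 <= (expR (- x) ^+ n.+1)%:E.
  by rewrite lee_fin exprn_ge0// expR_ge0.
(* The mean of exp(- (n + 1) D_x) is exp(- x q) with q = (n + 1)^alpha, and its integral over x >= 0
   is 1 / q. *)
have L1 n : \int[occ]_(x in `[0%R, +oo[) (expR (- x) ^+ n.+1)%:E =
    ((n.+1%:R `^ alpha)^-1)%:E.
  rewrite integral_occ//.
  have q0 : (0 < (n.+1%:R : R) `^ alpha)%R by rewrite powR_gt0.
  transitivity (\int[mu]_(x in `[0%R, +oo[)
    (((n.+1%:R `^ alpha)^-1)%:E *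
     (n.+1%:R `^ alpha * expR (- (n.+1%:R `^ alpha * x)))%:E)).
    apply: eq_integral => x; rewrite mem_setE in_itv/= andbT => x0.
    rewrite -EFinM mulrA mulVf ?gt_eqF// mul1r mulrC -mulNr.
    rewrite -D_laplace//; apply: eq_integral => w _.
    by rewrite -expRM_natl mulrN mulNr.
  have mq : measurable_fun setT (fun x : R =>
      (n.+1%:R `^ alpha * expR (- (n.+1%:R `^ alpha * x)))%:E).
    apply/measurable_EFinP; apply: measurable_funM => //.
    by do 2 apply: measurableT_comp => //; exact: measurable_funM.
  rewrite ge0_integralZl//; last exact: (measurable_funTS mq).
  by rewrite integral_expR_tail// mulr0 oppr0 expR0 mule1.
apply: laplace_unique => [n|]; last first.
  by have := L1 0%N; rewrite /= => h; rewrite [ltLHS]h ltry.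
rewrite L1 hm//.
transitivity (\int[mu]_(u in `]0%R, +oo[) ((c^-1)%:E *
    (expR (- (n.+1%:R * u)) * (alpha * u `^ (alpha - 1)))%:E)).
  have mq : measurable_fun setT (fun u : R =>
      (expR (- (n.+1%:R * u)) * (alpha * u `^ (alpha - 1)))%:E).
    apply/measurable_EFinP; apply: measurable_funM; last exact: measurable_funM.
    by do 2 apply: measurableT_comp => //; exact: measurable_funM.
  rewrite ge0_integralZl//.
  - rewrite laplace_powR// -EFinM; congr _%:E.
    by rewrite mulrA mulVf ?mul1r// gt_eqF.
  - exact: (measurable_funTS mq).
  - by move=> x _; rewrite lee_fin !mulr_ge0 ?expR_ge0 ?powR_ge0// ltW.
  - by rewrite lee_fin invr_ge0 ltW.
apply: eq_integral => u _; rewrite -!EFinM; congr _%:E.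
rewrite /rho -expRM_natl mulrN; ring.
Qed.

Let ind (r u : R) : \bar R := ((u <= r)%R%:R)%:E.

Let ind_ge0 r u : 0 <= ind r u. Proof. by rewrite lee_fin. Qed.

Let mind d' (T' : measurableType d') (f g : T' -> R) :
  measurable_fun setT f -> measurable_fun setT g ->
  measurable_fun setT (fun z => ind (f z) (g z)).
Proof.
move=> mf mg; apply/measurable_EFinP/measurableT_comp => //.
exact: measurable_fun_ler.
Qed.

Let mVx x : measurable_fun setT (V x).
Proof.
apply: (measurableT_comp mV (g := fun w => (x, w))).
exact: measurable_fun_pair.
Qed.

Lemma tonelli_in d' (T' : measurableType d')
    (m : {sigma_finite_measure set T' -> \bar R}) (A : set R)
    (F : R * T' -> \bar R) : measurable A ->
  measurable_fun setT F -> (forall z, 0 <= F z) ->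
  \int[mu]_(x in A) \int[m]_y F (x, y) = \int[m]_y \int[mu]_(x in A) F (x, y).
Proof.
move=> mA mF F0.
pose G (z : R * T') := F z * (\1_A z.1)%:E.
have G0 z : 0 <= G z by rewrite mule_ge0.
have mG : measurable_fun setT G.
  apply: emeasurable_funM => //; apply/measurable_EFinP.
  by apply: measurableT_comp; [exact: measurable_indic|exact: measurable_fst].
transitivity (\int[mu]_x \int[m]_y G (x, y)).
  rewrite integral_mkcond; apply: eq_integral => x _; rewrite patchE.
  case: ifPn => xA.
    by apply: eq_integral => y _; rewrite /G/= indicE xA mule1.
  by rewrite integral0_eq// => y _; rewrite /G/= indicE (negbTE xA) mule0.
transitivity (\int[m]_y \int[mu]_x G (x, y)).
  exact: (@fubini_tonelli _ _ _ _ R mu m G mG G0).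
apply: eq_integral => y _; rewrite [RHS]integral_mkcond.
apply: eq_integral => x _; rewrite patchE /G/= indicE.
by case: ifP; rewrite ?mule1 ?mule0.
Qed.

Let integral_V (x : R) (g : R -> \bar R) : (0 <= x)%R ->
  \int[P]_w g (V x w) = \int[P]_w g (D x w).
Proof.
move=> x0; apply: eq_ae_integralT; apply: filterS VE => w VEw.
by rewrite VEw.
Qed.

Let integral_rho (r : R) : (0 <= r)%R ->
  \int[mu]_(u in `]0%R, +oo[) (ind r u * (rho u)%:E) = (r `^ alpha / c)%:E.
Proof.
move=> r0.
have -> : \int[mu]_(u in `]0%R, +oo[) (ind r u * (rho u)%:E) =
    \int[mu]_(u in `]0%R, r]) (rho u)%:E.
  rewrite integral_mkcond [RHS]integral_mkcond; apply: eq_integral => u _.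
  rewrite !patchE !mem_setE !in_itv/= andbT /ind.
  case: (ltP 0%R u) => //= u0.
  by case: (leP u r) => _; rewrite ?mul1e ?mul0e.
move: r0; rewrite le_eqVlt => /predU1P[<-|r0].
  by rewrite set_itvxx integral_set0 powR0 ?mul0r// gt_eqF.
have mq : measurable_fun setT (fun u : R => (alpha * u `^ (alpha - 1))%:E).
  by apply/measurable_EFinP; exact: measurable_funM.
transitivity (\int[mu]_(u in `]0%R, r]) ((c^-1)%:E * (alpha * u `^ (alpha - 1))%:E)).
  by apply: eq_integral => u _; rewrite -EFinM mulrC.
rewrite ge0_integralZl//.
- by rewrite integral_powR0// -EFinM mulrC.
- exact: (measurable_funTS mq).
- by move=> x _; rewrite lee_fin mulr_ge0 ?powR_ge0// ltW.
- by rewrite lee_fin invr_ge0 ltW.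
Qed.

Let occupation_cdf (r : R) : (0 <= r)%R ->
  \int[mu]_(x in `[0%R, +oo[) \int[P]_w ind r (D x w) = (r `^ alpha / c)%:E.
Proof.
move=> r0; rewrite (occupation (g := ind r))//; first exact: integral_rho.
exact: (mind (measurable_cst r) (@measurable_id _ R setT)).
Qed.

(** [kappa (h, r)] is the probability that D_h <= r, written with the version [V] so as to be
    jointly measurable in h and r. *)
Let kappa (z : R * R) : \bar R := \int[P]_v ind z.2 (V z.1 v).

Let mkappa : measurable_fun setT kappa.
Proof.
apply: (measurable_fun_fubini_tonelli_F (m2 := P)
  (fun z : (R * R) * T => ind z.1.2 (V z.1.1 z.2))) => [|z]; last exact: ind_ge0.
apply: mind; first exact: measurableT_comp measurable_snd measurable_fst.
apply: (measurableT_comp mV (g := fun z : (R * R) * T => (z.1.1, z.2))).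
by apply/measurable_fun_pair => //; exact: measurableT_comp measurable_fst measurable_fst.
Qed.

Let mkappa_slice r : measurable_fun setT (fun h : R => kappa (h, r)).
Proof. by apply: (measurableT_comp mkappa); exact: measurable_fun_pair. Qed.

Let kappa_ge0 z : 0 <= kappa z. Proof. exact: integral_ge0. Qed.

Let integral_kappa (r : R) : (0 <= r)%R ->
  \int[mu]_(h in `]0%R, +oo[) kappa (h, r) = (r `^ alpha / c)%:E.
Proof.
move=> r0.
rewrite integral_itv_obnd_cbnd; last exact: (measurable_funTS (mkappa_slice r)).
rewrite -(occupation_cdf r0); apply: eq_integral => h.
rewrite mem_setE in_itv/= andbT => h0.
exact: integral_V.
Qed.

Let p (s t : R) (z : R * R) : \bar R := \int[P]_w (ind s (V z.1 w) * ind t (V z.2 w)).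

Let mp s t : measurable_fun setT (p s t).
Proof.
apply: (measurable_fun_fubini_tonelli_F (m2 := P)
  (fun z : (R * R) * T => ind s (V z.1.1 z.2) * ind t (V z.1.2 z.2))) => [|z];
  last by rewrite mule_ge0.
apply: emeasurable_funM; apply: mind => //.
  apply: (measurableT_comp mV (g := fun z : (R * R) * T => (z.1.1, z.2))).
  by apply/measurable_fun_pair => //; exact: measurableT_comp measurable_fst measurable_fst.
apply: (measurableT_comp mV (g := fun z : (R * R) * T => (z.1.2, z.2))).
by apply/measurable_fun_pair => //; exact: measurableT_comp measurable_snd measurable_fst.
Qed.

Let p_ge0 s t z : 0 <= p s t z.
Proof. by apply: integral_ge0 => w _; rewrite mule_ge0. Qed.

(** For u <= s <= t this is the integral of [kappa (h, t - u)] over h > 0: the expected time that D,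
    restarted at height u, spends up to height t. *)
Let g (s t u : R) : \bar R := ind s u * ((t - u) `^ alpha / c)%:E.

Let g_ge0 s t u : 0 <= g s t u.
Proof. by rewrite mule_ge0// lee_fin divr_ge0 ?powR_ge0// ltW. Qed.

Let mg s t : measurable_fun setT (g s t).
Proof.
apply: emeasurable_funM; first exact: (mind (measurable_cst s) (@measurable_id _ R setT)).
apply/measurable_EFinP; apply: measurable_funM => //.
apply: (measurableT_comp (measurable_powR alpha)).
exact: measurable_funB.
Qed.

(* The increment of D over [x, x + h] is independent of D x and distributed
   as D h. *)
Let p_shift (s t x h : R) : (0 <= x)%R -> (0 < h)%R ->
  p s t (x, x + h)%R = \int[P]_w (ind s (D x w) * kappa (h, t - D x w)%R).
Proof.
move=> x0 h0; have xh : (x < x + h)%R by rewrite ltrDl.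
pose F (z : R * R) := ind s z.1 * ind t (z.1 + z.2)%R.
have mF : measurable_fun setT F.
  by apply: emeasurable_funM; apply: mind => //; exact: measurable_funD.
have F0 z : 0 <= F z by rewrite mule_ge0.
transitivity (\int[P]_w F (D x w, (D (x + h)%R w - D x w)%R)).
  apply: eq_ae_integralT; apply: filterS VE => w VEw.
  rewrite /F/= !VEw ?(ltW (le_lt_trans x0 xh))//.
  by have -> : (D x w + (D (x + h) w - D x w) = D (x + h) w)%R by ring.
rewrite D_pairs// (addrC x) addrK; apply: eq_integral => w _.
rewrite -(ge0_integralZl P measurableT)//; last first.
  exact: mind (measurable_cst _) (mVx h).
apply: eq_ae_integralT; apply: filterS VE => v VEv.
by rewrite /F/= VEv ?(ltW h0)// /ind lerBrDl.
Qed.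

(** With y = x + h and D x frozen, integrating over h gives [g s t (D x w)]; the occupation formula
    then handles the integral over x. The factor D x <= s together with s <= t makes the remaining
    height t - D x nonnegative. *)
Let J_E (s t : R) : (0 <= s)%R -> (s <= t)%R ->
  \int[mu]_(x in `[0%R, +oo[) \int[mu]_(y in `]x, +oo[) p s t (x, y) =
  \int[mu]_(u in `]0%R, +oo[) (g s t u * (rho u)%:E).
Proof.
move=> s0 st; rewrite -(occupation (mg s t) (g_ge0 s t)).
apply: eq_integral => x; rewrite mem_setE in_itv/= andbT => x0.
have mpx : measurable_fun setT (fun y : R => p s t (x, y)).
  by apply: (measurableT_comp (mp s t)); exact: measurable_fun_pair.
rewrite (@ge0_integral_affine_in _ _ 1 x)// mul1e.
have -> : (fun y : R => (1 * y + x)%R) @^-1` `]x, +oo[ = `]0%R, +oo[%classic.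
  by apply/seteqP; split => y /=; rewrite !in_itv/= !andbT mul1r ltrDr.
pose F (z : R * T) := ind s (D x z.2) * kappa (z.1, t - D x z.2)%R.
have F0 z : 0 <= F z by rewrite mule_ge0.
have mF : measurable_fun setT F.
  have mDx := measurableT_comp (mD x0) (@measurable_snd _ _ R T).
  apply: emeasurable_funM; first exact: mind (measurable_cst _) mDx.
  apply: (measurableT_comp mkappa); apply/measurable_fun_pair => /=.
    exact: measurable_fst.
  exact: measurable_funB.
transitivity (\int[mu]_(h in `]0%R, +oo[) \int[P]_w F (h, w)).
  apply: eq_integral => h; rewrite mem_setE in_itv/= andbT => h0.
  by rewrite mul1r addrC p_shift.
rewrite tonelli_in//; apply: eq_integral => w _; rewrite /F/=.
transitivity (ind s (D x w) * \int[mu]_(h in `]0%R, +oo[) kappa (h, t - D x w)%R).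
  exact: (ge0_integralZl mu (measurable_itv _)
    (measurable_funTS (mkappa_slice (t - D x w))) (fun _ _ => kappa_ge0 _) (ind_ge0 _ _)).
rewrite /g; case: (leP (D x w) s) => Ds; last first.
  by rewrite /ind leNgt Ds !mul0e.
by rewrite integral_kappa// subr_ge0 (le_trans Ds).
Qed.

(** If B is the event that all D_n stay at or below N, then exp(- N) P(B) <= E exp(- D_n) = exp(- n)
    for every n, hence P(B) = 0. *)
Lemma subordinator_unbounded :
  {ae P, forall w, forall r, exists2 x, (0 <= x)%R & (r < D x w)%R}.
Proof.
suff : {ae P, forall w, forall N, exists n, (N%:R < D n%:R w)%R}.
  apply: filterS => w h r; have [n hn] := h (Num.truncn r).+1.
  by exists n%:R => //; rewrite (lt_trans _ hn)// truncnS_gt.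
apply/ae_foralln => N.
pose B := \bigcap_n [set w | (D n%:R w <= N%:R)%R].
have mBn n : measurable [set w | (D n%:R w <= N%:R)%R].
  have -> : [set w | (D n%:R w <= N%:R)%R] = D n%:R @^-1` `]-oo, N%:R]%classic.
    by apply/seteqP; split => w /=; rewrite in_itv.
  by rewrite -[X in measurable X]setTI; apply: mD.
have mB : measurable B by exact: bigcapT_measurable.
exists B; split => //; last first.
  by move=> w /= /forallNP h n _ /=; rewrite leNgt; apply/negP; exact: h.
have Pn n : (expR (- N%:R))%:E * P B <= (expR (- n%:R))%:E.
  have -> : P B = \int[P]_w (\1_B w)%:E by rewrite integral_indic// setIT.
  have m1 : measurable_fun setT (fun w => (\1_B w)%:E : \bar R).
    exact/measurable_EFinP/measurable_indic.
  rewrite -(ge0_integralZl P measurableT m1); last 2 first.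
  - by move=> w _; rewrite lee_fin.
  - by rewrite lee_fin expR_ge0.
  have -> : (expR (- n%:R))%:E = \int[P]_w (expR (- 1 * D n%:R w))%:E.
    by rewrite D_laplace// powR1 mulr1.
  apply: ge0_le_integral => //.
  - by apply: emeasurable_funM => //.
  - apply/measurable_EFinP; apply: measurableT_comp => //.
    by apply: measurable_funM => //; exact: mD.
  - move=> w _; rewrite -EFinM lee_fin indicE.
    have [wB|wB] := boolP (w \in B); last by rewrite mulr0 expR_ge0.
    by rewrite mulr1 ler_expR mulN1r lerN2; move/set_mem : wB => /(_ n I).
have PB : P B \is a fin_num by exact: fin_num_measure.
apply: (etrans (esym (fineK PB))); congr _%:E; apply/eqP; rewrite eq_le fine_ge0// andbT leNgt.
apply/negP => b0; set b := fine _ in b0.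
have eb0 : (0 < expR (- N%:R) * b)%R by rewrite mulr_gt0 ?expR_gt0.
have := Pn (Num.truncn (expR (- N%:R) * b)^-1).
rewrite -(fineK PB) -EFinM lee_fin -/b leNgt => /negP; apply.
rewrite expRN -[ltRHS]invrK ltf_pV2 ?posrE ?invr_gt0 ?expR_gt0//.
apply: lt_le_trans (expR_ge1Dx _).
by rewrite (lt_le_trans (truncnS_gt _))// nat1r.
Qed.

Let Y := inverse_process D.

Let nice_paths : {ae P, forall w,
  (forall a b : R, (0 <= a -> a <= b -> D a w <= D b w)%R) /\
  (forall r, exists2 x, (0 <= x)%R & (r < D x w)%R)}.
Proof. by apply: filterS2 D_mono subordinator_unbounded. Qed.

(** Valid for every [w]: where the level set is empty, [inf] takes its default value 0. *)
Lemma inverse_process_ge0 t w : (0 <= Y t w)%R.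
Proof.
rewrite /Y /inverse_process; have [->|/set0P I0] := eqVneq
  [set x | (0 <= x)%R /\ (t < D x w)%R] set0; first by rewrite inf0.
by apply: lb_le_inf => // x [].
Qed.

Lemma inverse_process_mono :
  {ae P, forall w, forall s t, (s <= t)%R -> (Y s w <= Y t w)%R}.
Proof.
apply: filterS nice_paths => w [_ h] s t; exact: (@le_inverse _ (D ^~ w)).
Qed.

Lemma inverse_process_cvg_dyad : {ae P, forall w, forall u, (0 <= u)%R ->
  (Y (dyad n u) w @[n --> \oo] --> Y u w)%R}.
Proof.
apply: filterS nice_paths => w [h1 h2] u u0.
apply: (@cvg_inverse _ (D ^~ w)) => //.
  by move=> n; exact/ltW/dyad_gt.
by apply: cvg_trans (dyad_cvg u0) _; exact: cvg_within.
Qed.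

Let Y_E : {ae P, forall w, forall t,
  (Y t w)%:E = \int[mu]_(x in `[0%R, +oo[) ind t (V x w)}.
Proof.
apply: filterS2 nice_paths VE => w [h1 h2] VEw t.
rewrite [LHS](@inverse_integral _ (D ^~ w) h1 h2).
by apply: eq_integral => x; rewrite mem_setE in_itv/= andbT => x0; rewrite VEw.
Qed.

Let mindV t : measurable_fun setT (fun z : R * T => ind t (V z.1 z.2)).
Proof. exact: mind (measurable_cst t) mV. Qed.

Lemma inverse_process_mean t : (0 <= t)%R ->
  \int[P]_w (Y t w)%:E = (t `^ alpha / c)%:E.
Proof.
move=> t0; transitivity (\int[P]_w \int[mu]_(x in `[0%R, +oo[) ind t (V x w)).
  by apply: eq_ae_integralT; apply: filterS Y_E => w.
rewrite -(@tonelli_in _ _ P _ (fun z => ind t (V z.1 z.2)))//.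
rewrite -(occupation_cdf t0); apply: eq_integral => x.
by rewrite mem_setE in_itv/= andbT => x0; exact: integral_V.
Qed.

(** When y < x, the event D_x <= s forces D_y <= s, so the level t imposed at y may be lowered to
    s. *)
Let p_swap (s t x y : R) : (s <= t)%R -> (0 <= y)%R -> (y < x)%R ->
  p s t (x, y) = p s s (y, x).
Proof.
move=> st y0 yx; have x0 : (0 <= x)%R by rewrite (le_trans y0)// ltW.
apply: eq_ae_integralT; apply: filterS2 VE D_mono => w VEw Dw.
rewrite /= !VEw// /ind; have Dyx := Dw _ _ y0 (ltW yx).
case: (leP (D x w) s) => Dxs; last by rewrite mul0e mule0.
by rewrite (le_trans Dyx Dxs) (le_trans (le_trans Dyx Dxs) st).
Qed.

Let mp_slice s t x : measurable_fun setT (fun y : R => p s t (x, y)).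
Proof. by apply: (measurableT_comp (mp s t)); exact: measurable_fun_pair. Qed.

Let split_p (s t x : R) : (0 <= x)%R ->
  \int[mu]_(y in `[0%R, +oo[) p s t (x, y) =
  \int[mu]_(y in `[0%R, x[) p s t (x, y) + \int[mu]_(y in `]x, +oo[) p s t (x, y).
Proof.
move=> x0; rewrite integral_itv_bndo_bndc; last exact: (measurable_funTS (mp_slice s t x)).
rewrite -ge0_integral_setU.
- congr (integral _ _ _); apply/seteqP; split => y /=; rewrite !in_itv/= !andbT.
    by move=> ->; case: (leP y x) => ?; [left|right].
  by move=> [/andP[]//|/ltW]; exact: le_trans.
- exact: measurable_itv.
- exact: measurable_itv.
- exact: (measurable_funTS (mp_slice s t x)).
- by move=> y _; exact: p_ge0.
- apply/disj_set2P/seteqP; split => y //=; rewrite !in_itv/= andbT => -[/andP[_ yx]].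
  by rewrite ltNge yx.
Qed.

Lemma inverse_process_second_moment (s t : R) : (0 <= s)%R -> (s <= t)%R ->
  \int[P]_w (Y s w * Y t w)%:E =
  \int[mu]_(u in `]0%R, +oo[) (ind s u * ((t - u) `^ alpha / c)%:E * (rho u)%:E) +
  \int[mu]_(u in `]0%R, +oo[) (ind s u * ((s - u) `^ alpha / c)%:E * (rho u)%:E).
Proof.
move=> s0 st.
pose I r w := \int[mu]_(x in `[0%R, +oo[) ind r (V x w).
have I0 r w : 0 <= I r w by exact: integral_ge0.
have mindw r w : measurable_fun setT (fun x : R => ind r (V x w)).
  apply: (measurableT_comp (mindV r) (g := fun x => (x, w))).
  exact: measurable_fun_pair.
have mI r : measurable_fun setT (I r).
  pose G (z : R * T) := ind r (V z.1 z.2) * (\1_(`[0%R, +oo[%classic : set R) z.1)%:E.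
  have mG : measurable_fun setT G.
    apply: emeasurable_funM; first exact: mindV.
    apply/measurable_EFinP; apply: measurableT_comp; last exact: measurable_fst.
    exact: measurable_indic.
  have -> : I r = fun w => \int[mu]_x G (x, w).
    apply/funext => w; rewrite /I integral_mkcond; apply: eq_integral => x _.
    by rewrite patchE /G/= indicE; case: ifP; rewrite ?mule1 ?mule0.
  apply: (@measurable_fun_fubini_tonelli_G _ _ _ _ R mu G mG).
  by move=> z; rewrite mule_ge0.
transitivity (\int[P]_w (I s w * I t w)).
  by apply: eq_ae_integralT; apply: filterS Y_E => w YEw; rewrite EFinM !YEw.
transitivity (\int[P]_w \int[mu]_(x in `[0%R, +oo[) (ind s (V x w) * I t w)).
  apply: eq_integral => w _; symmetry.
  exact: (ge0_integralZr mu (measurable_itv _) (measurable_funTS (mindw s w))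
    (fun _ _ => ind_ge0 _ _) (I0 t w)).
rewrite -(@tonelli_in _ _ P _ (fun z => ind s (V z.1 z.2) * I t z.2)); last 3 first.
- exact: measurable_itv.
- apply: emeasurable_funM; first exact: mindV.
  exact: measurableT_comp (mI t) measurable_snd.
- by move=> z; rewrite mule_ge0.
transitivity (\int[mu]_(x in `[0%R, +oo[) \int[mu]_(y in `[0%R, +oo[) p s t (x, y)).
  apply: eq_integral => x _.
  transitivity (\int[P]_w \int[mu]_(y in `[0%R, +oo[) (ind s (V x w) * ind t (V y w))).
    apply: eq_integral => w _; symmetry.
    exact: (ge0_integralZl mu (measurable_itv _) (measurable_funTS (mindw t w))
      (fun _ _ => ind_ge0 _ _) (ind_ge0 _ _)).
  rewrite -(@tonelli_in _ _ P _ (fun z => ind s (V x z.2) * ind t (V z.1 z.2)))//.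
  + apply: emeasurable_funM; last exact: mindV.
    apply: mind => //; exact: measurableT_comp (mVx x) measurable_snd.
  + by move=> z; rewrite mule_ge0.
(* Indicators of the two sides of the diagonal replace the moving bounds of the inner integrals,
   giving measurability in x and a form to which Tonelli applies. *)
pose A := [set z : R * R | (0 <= z.2)%R && (z.2 < z.1)%R].
have mA : measurable A.
  have -> : A = snd @^-1` `[0%R, +oo[%classic `&`
      (fun z : R * R => (z.2 < z.1)%R) @^-1` [set true].
    apply/seteqP; split => z /=; rewrite /A/= in_itv/= andbT.
      by move=> /andP[].
    by move=> [-> ->].
  apply: measurableI.
    by rewrite -[X in measurable X]setTI; exact: measurable_snd.
  rewrite -[X in measurable X]setTI.
  by apply: (measurable_fun_ltr measurable_snd measurable_fst).
pose F (z : R * R) := p s t z * (\1_A z)%:E.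
have F0 z : 0 <= F z by rewrite mule_ge0// p_ge0.
have mF : measurable_fun setT F.
  by apply: emeasurable_funM; [exact: mp|exact/measurable_EFinP/measurable_indic].
pose B := [set z : R * R | (z.1 < z.2)%R].
have mB : measurable B.
  have -> : B = (fun z : R * R => (z.1 < z.2)%R) @^-1` [set true].
    by apply/seteqP; split.
  rewrite -[X in measurable X]setTI.
  by apply: (measurable_fun_ltr measurable_fst measurable_snd).
pose H (z : R * R) := p s t z * (\1_B z)%:E.
have H0 z : 0 <= H z by rewrite mule_ge0// p_ge0.
have mH : measurable_fun setT H.
  by apply: emeasurable_funM; [exact: mp|exact/measurable_EFinP/measurable_indic].
have FE x : (0 <= x)%R ->
    \int[mu]_(y in `[0%R, x[) p s t (x, y) = \int[mu]_y F (x, y).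
  move=> x0; rewrite integral_mkcond; apply: eq_integral => y _.
  rewrite patchE /F indicE mem_setE in_itv/=.
  have -> : ((x, y) \in A) = (0 <= y < x)%R by apply/idP/idP; rewrite inE.
  by case: ifP; rewrite ?mule1 ?mule0.
have HE x : \int[mu]_(y in `]x, +oo[) p s t (x, y) = \int[mu]_y H (x, y).
  rewrite integral_mkcond; apply: eq_integral => y _.
  rewrite patchE /H indicE mem_setE in_itv/= andbT.
  have -> : ((x, y) \in B) = (x < y)%R by apply/idP/idP; rewrite inE.
  by case: ifP; rewrite ?mule1 ?mule0.
have mF1 : measurable_fun setT (fun x : R => \int[mu]_y F (x, y)).
  exact: (@measurable_fun_fubini_tonelli_F _ _ _ _ R mu F mF F0).
have mH1 : measurable_fun setT (fun x : R => \int[mu]_y H (x, y)).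
  exact: (@measurable_fun_fubini_tonelli_F _ _ _ _ R mu H mH H0).
have F10 (x : R) : 0 <= \int[mu]_y F (x, y) by exact: integral_ge0.
have H10 (x : R) : 0 <= \int[mu]_y H (x, y) by exact: integral_ge0.
transitivity (\int[mu]_(x in `[0%R, +oo[) (\int[mu]_y F (x, y) + \int[mu]_y H (x, y))).
  apply: eq_integral => x; rewrite mem_setE in_itv/= andbT => x0.
  by rewrite split_p// FE// HE.
rewrite (ge0_integralD mu (measurable_itv _) (fun _ _ => F10 _)
  (measurable_funTS mF1) (fun _ _ => H10 _) (measurable_funTS mH1)).
rewrite addeC; congr (_ + _).
  rewrite -(J_E s0 st); apply: eq_integral => x _; exact/esym/HE.
(* Below the diagonal, exchanging the variables and applying [p_swap] leads to the same integral as
   above it, with both levels equal to s. *)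
rewrite -(J_E s0 (lexx s)).
transitivity (\int[mu]_y \int[mu]_(x in `[0%R, +oo[) F (x, y)).
  exact: (@tonelli_in _ _ mu _ F (measurable_itv _) mF F0).
rewrite [RHS]integral_mkcond; apply: eq_integral => y _.
rewrite patchE mem_setE in_itv/= andbT; case: ifPn => y0; last first.
  rewrite integral0_eq// => x _; rewrite /F indicE memNset ?mule0//.
  by rewrite /A/= (negbTE y0).
rewrite integral_mkcond [RHS]integral_mkcond; apply: eq_integral => x _.
rewrite !patchE !mem_setE !in_itv/= !andbT /F indicE.
have -> : ((x, y) \in A) = (y < x)%R.
  by apply/idP/idP; rewrite inE /A/= y0.
case: (ltP y x) => yx.
  by rewrite (le_trans y0 (ltW yx)) mule1 p_swap.
by rewrite mule0; case: ifP.
Qed.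

(** Substitute u = t v: the powers t, t^alpha and t^(alpha - 1) combine to t^(2 alpha), and the
    bound s becomes s / t. *)
Lemma integral_incomplete_beta (s t : R) : (0 <= s)%R -> (s <= t)%R ->
  \int[mu]_(u in `]0%R, +oo[) (ind s u * ((t - u) `^ alpha / c)%:E * (rho u)%:E) =
  (alpha / c ^+ 2 * (t `^ (2 * alpha) * incomplete_beta alpha (alpha + 1) (s / t)))%:E.
Proof.
move=> s0 st.
have -> : \int[mu]_(u in `]0%R, +oo[) (ind s u * ((t - u) `^ alpha / c)%:E * (rho u)%:E) =
    \int[mu]_(u in `]0%R, s]) (((t - u) `^ alpha / c)%:E * (rho u)%:E).
  rewrite integral_mkcond [RHS]integral_mkcond; apply: eq_integral => u _.
  rewrite !patchE !mem_setE !in_itv/= andbT /ind.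
  case: (ltP 0%R u) => //= u0.
  by case: (leP u s) => _; rewrite ?mul1e ?mul0e.
(* Here s = t = 0; the quotient s / t has no meaning, but the power in front of it is 0. *)
have [t0|t0] := leP t 0%R.
  have -> : s = 0%R by apply/eqP; rewrite eq_le s0 (le_trans st).
  have -> : t = 0%R by apply/eqP; rewrite eq_le t0 (le_trans s0).
  rewrite set_itvxx integral_set0 powR0 ?mul0r ?mulr0//.
  by rewrite mulf_neq0// gt_eqF.
pose x := (s / t)%R.
have x01 : (0 <= x <= 1)%R by rewrite divr_ge0 ?(ltW t0)//= ler_pdivrMr// mul1r.
pose b (v : R) : R := (v `^ (alpha - 1) * (1 - v) `^ alpha)%R.
have mb : measurable_fun setT (fun v => (b v)%:E).
  apply/measurable_EFinP; apply: measurable_funM => //.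
  by apply: (measurableT_comp (measurable_powR alpha)); exact: measurable_funB.
have b0 v : 0 <= (b v)%:E by rewrite lee_fin mulr_ge0 ?powR_ge0.
(* [incomplete_beta] is the real part of an extended integral, so finiteness must be shown: on ]0,
   1] the integrand is at most v^(alpha - 1). *)
have bE : \int[mu]_(v in `]0%R, x]) (b v)%:E =
    (incomplete_beta alpha (alpha + 1) x)%:E.
  rewrite integral_itv_obnd_cbnd; last exact: (measurable_funTS mb).
  rewrite /incomplete_beta /Rintegral addrK fineK// ge0_fin_numE; last first.
    by apply: integral_ge0 => v _; exact: b0.
  rewrite -integral_itv_obnd_cbnd; last exact: (measurable_funTS mb).
  have [x0|x0] := leP x 0%R.
    by rewrite set_itv_ge ?integral_set0 ?ltry// bnd_simp -leNgt.
  have mq : measurable_fun setT (fun u : R => (alpha * u `^ (alpha - 1))%:E).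
    by apply/measurable_EFinP; exact: measurable_funM.
  apply: (@le_lt_trans _ _ (\int[mu]_(u in `]0%R, x])
      ((alpha^-1)%:E * (alpha * u `^ (alpha - 1))%:E))); last first.
    rewrite (ge0_integralZl mu (measurable_itv _) (measurable_funTS mq)).
    - by rewrite integral_powR0// -EFinM ltry.
    - by move=> u _; rewrite lee_fin mulr_ge0 ?powR_ge0// ltW.
    - by rewrite lee_fin invr_ge0 ltW.
  have mq' : measurable_fun setT
      (fun u : R => (alpha^-1)%:E * (alpha * u `^ (alpha - 1))%:E).
    exact: emeasurable_funM.
  apply: ge0_le_integral => //.
  - by move=> v _; exact: b0.
  - exact: (measurable_funTS mb).
  - exact: (measurable_funTS mq').
  move=> v; rewrite /= in_itv/= => /andP[v0 vx].
  rewrite -EFinM lee_fin mulrA mulVf ?gt_eqF// mul1r ler_piMr ?powR_ge0//.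
  have v1 : (v <= 1)%R by rewrite (le_trans vx)//; case/andP: x01.
  have : ((1 - v) `^ alpha <= 1 `^ alpha)%R.
    by rewrite ge0_ler_powR ?nnegrE ?subr_ge0 ?(ltW alpha_gt0)// lerBlDr lerDl ltW.
  by rewrite powR1.
pose h (u : R) : \bar R := ((t - u) `^ alpha / c)%:E * (rho u)%:E.
have h0 u : 0 <= h u.
  by rewrite mule_ge0 ?lee_fin ?rho_ge0// divr_ge0 ?powR_ge0// ltW.
have mh : measurable_fun setT h.
  apply: emeasurable_funM; last exact/measurable_EFinP.
  apply/measurable_EFinP; apply: measurable_funM => //.
  by apply: (measurableT_comp (measurable_powR alpha)); exact: measurable_funB.
rewrite (@ge0_integral_affine_in _ _ t 0 h t0 (measurable_itv _) mh h0).
have -> : (fun v : R => (t * v + 0)%R) @^-1` `]0%R, s] = `]0%R, x]%classic.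
  apply/seteqP; split => v /=; rewrite !in_itv/= addr0 pmulr_rgt0// /x ler_pdivlMr//;
  by rewrite mulrC.
transitivity (t%:E * \int[mu]_(v in `]0%R, x])
    ((alpha / c ^+ 2 * (t `^ (2 * alpha) / t))%:E * (b v)%:E)).
  congr (_ * _); apply: eq_integral => v; rewrite mem_setE in_itv/= => /andP[v0 vx].
  have v1 : (v <= 1)%R by rewrite (le_trans vx)//; case/andP: x01.
  rewrite /h /rho /b -!EFinM; congr _%:E; rewrite addr0.
  have -> : (t - t * v = t * (1 - v))%R by ring.
  rewrite !powRM ?subr_ge0 ?(ltW t0) ?(ltW v0)//.
  have -> : (t `^ (2 * alpha) / t = t `^ alpha * t `^ (alpha - 1))%R.
    rewrite -powRD; last by rewrite (gt_eqF t0) implybT.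
    rewrite -[X in (_ / X)%R](powRr1 (ltW t0)) -powRB; last by rewrite (gt_eqF t0) implybT.
    by congr powR; ring.
  by field; rewrite gt_eqF.
rewrite (ge0_integralZl mu (measurable_itv _) (measurable_funTS mb)
  (fun _ _ => b0 _)); last first.
  by rewrite lee_fin !mulr_ge0 ?invr_ge0 ?exprn_ge0 ?powR_ge0// ltW.
rewrite bE -!EFinM; congr _%:E; rewrite -/x; field; rewrite !gt_eqF//.
Qed.

(** Closed form of the integral of (t - u)^alpha / Gamma(1 + alpha) against [rho] over 0 < u <= s.
    For alpha = 1 it is s t - s^2 / 2. *)
Definition fractional_kernel (s t : R) : R :=
  (alpha / Gamma (1 + alpha) ^+ 2 *
   (t `^ (2 * alpha) * incomplete_beta alpha (alpha + 1) (s / t)))%R.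

Lemma inverse_process_second_order_moments : second_order_moments P (inverse_process D)
  (fun t => t `^ alpha / Gamma (1 + alpha))%R
  (fun s t => fractional_kernel s t + fractional_kernel s s)%R.
Proof.
move=> s t s0 st; rewrite unlock; split; first exact: inverse_process_mean.
transitivity (\int[P]_w (Y s w * Y t w)%:E); first by [].
rewrite inverse_process_second_moment// integral_incomplete_beta//.
by rewrite integral_incomplete_beta.
Qed.

End subordinator_occupation.

Lemma stable_subordinator_inverse d (T : measurableType d) (R : realType)
    (P : probability T R) (alpha : R) (D : R -> T -> R) :
  0 < alpha -> alpha <= 1 -> stable_subordinator P alpha D ->
  [/\ second_order_moments P (inverse_process D)
        (fun t => t `^ alpha / Gamma (1 + alpha))
        (fun s t => fractional_kernel alpha s t + fractional_kernel alpha s s),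
      {ae P, forall w s t, s <= t -> inverse_process D s w <= inverse_process D t w} &
      {ae P, forall w u, 0 <= u ->
        inverse_process D (dyad n u) w @[n --> \oo] --> inverse_process D u w}].
Proof.
move=> alpha_gt0 alpha_le1 [levyD D_mono lapD].
have [mD D0 _ _ cD] := levyD.
have lap (s t : R) : 0 < s -> 0 <= t ->
    (\int[P]_w (expR (- s * D t w))%:E)%E = (expR (- t * s `^ alpha))%:E.
  by move=> s0 t0; rewrite -lapD// unlock.
split.
- apply: inverse_process_second_order_moments => //.
    by apply: filterS cD => w; exact: cvg_dyad_of_cadlag.
  exact: levy_independent_stationary_pairs.
- exact: inverse_process_mono mD D_mono lap.
- exact: inverse_process_cvg_dyad mD D_mono lap.
Qed.

(** * Fractional Skellam processes and their time changes *)

Section fractional_skellam_moments.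
Context d (T : measurableType d) (R : realType) (P : probability T R).
Variables (k : nat) (lambda mu : 'I_k -> R).
Hypothesis lambda_ge0 : forall j, 0 <= lambda j.
Hypothesis mu_ge0 : forall j, 0 <= mu j.

Let m1 : R := \sum_(j < k) j.+1%:R * (lambda j - mu j).
Let m2 : R := \sum_(j < k) j.+1%:R ^+ 2 * (lambda j + mu j).

(* The case alpha = 1 of the moment formulas is read off the results on inverse
   subordinators, applied to the deterministic subordinator D x = x. *)
Let identity_inverse (t : R) (w : T) : 0 <= t ->
  inverse_process (fun x _ => x) t w = t.
Proof.
move=> t0; rewrite /inverse_process.
have -> : [set x : R | 0 <= x /\ t < x] = `]t, +oo[%classic.
  apply/seteqP; split => x /=; rewrite in_itv/= andbT; first by case.
  by move=> tx; split => //; rewrite (le_trans t0)// ltW.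
by rewrite inf_itv.
Qed.

Let identity_moments : second_order_moments P (inverse_process (fun x _ => x))
  (fun t => t `^ 1 / Gamma (1 + 1))
  (fun s t => fractional_kernel 1 s t + fractional_kernel 1 s s).
Proof.
apply: inverse_process_second_order_moments => //.
- exact: aeW.
- by apply: aeW => w s t.

- apply: aeW => w u u0 /=.
  exact: (cvg_trans (dyad_cvg u0) (cvg_within _)).
- move=> a b F a0 ab mF F0.
  under [RHS]eq_integral do rewrite integral_cst//= probability_setT mule1.
  by [].
- move=> s t s0 t0; rewrite integral_cst//= probability_setT mule1 powRr1 ?ltW//.
  by congr (expR _)%:E; ring.
Qed.

Let identity_mean (a : R) : 0 <= a -> a = a `^ 1 / Gamma (1 + 1).
Proof.
move=> a0; have [+ _] := identity_moments a0 (lexx a).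
rewrite unlock; under eq_integral do rewrite identity_inverse//.
by rewrite integral_cst//= probability_setT mule1 => -[].
Qed.

Let identity_product (a b : R) : 0 <= a -> a <= b ->
  a * b = fractional_kernel 1 a b + fractional_kernel 1 a a.
Proof.
move=> a0 ab; have b0 := le_trans a0 ab; have [_] := identity_moments a0 ab.
rewrite unlock.
under eq_integral do rewrite /= /GRing.mul/= !identity_inverse//.
by rewrite integral_cst//= probability_setT mule1 => -[].
Qed.

Variables (alpha : R) (Sa : R -> T -> R).
Hypotheses (alpha_gt0 : 0 < alpha) (alpha_le1 : alpha <= 1).
Hypothesis gfspSa : generalized_fractional_skellam_process P alpha lambda mu Sa.

Lemma gfsp_second_order_moments : second_order_moments P Sa
  (fun t => m1 * (t `^ alpha / Gamma (1 + alpha)))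
  (fun s t => m2 * (s `^ alpha / Gamma (1 + alpha)) +
    m1 ^+ 2 * (fractional_kernel alpha s t + fractional_kernel alpha s s)).
Proof.
move: gfspSa; rewrite /generalized_fractional_skellam_process.
case: eqP => [->|_] => [gS a b a0 ab|].
  have [e h] := skellam_second_order_moments lambda_ge0 mu_ge0 gS a0 ab.
  split; first by rewrite e -identity_mean// mulrC.
  rewrite h -identity_mean// -identity_product// mulrA mulrC -mulrA.
  by congr _%:E; rewrite /m2; ring.
move=> [S [D [gS stD indep SaE]]].
have [Ymom Ymono Ydyad] := stable_subordinator_inverse alpha_gt0 alpha_le1 stD.
pose Y := inverse_process D.
have Y0 t w : 0 <= Y t w by exact: inverse_process_ge0.
have [_ mY _] := indep.
have iY t : 0 <= t -> P.-integrable setT (fun w => (Y t w)%:E).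
  move=> t0; have [+ _] := Ymom t t t0 (lexx t); rewrite unlock => E.
  exact: (integrable_ge0_fin (mY _ t0) _ E).
have iYY s t : 0 <= s -> s <= t -> P.-integrable setT (fun w => (Y s w * Y t w)%:E).
  move=> s0 st; have [_] := Ymom s t s0 st; rewrite unlock => E.
  apply: (integrable_ge0_fin _ _ E) => [|w]; last by rewrite mulr_ge0.
  by apply: measurable_funM; apply: mY => //; exact: le_trans st.
have iZ (c : R) (g : T -> R) : P.-integrable setT (fun w => (g w)%:E) ->
    P.-integrable setT (fun w => (c * g w)%:E).
  by move=> ig; under eq_fun do rewrite EFinM; exact: integrableZl.
have hE a b : 0 <= a -> a <= b ->
    P.-integrable setT (fun w => (Y a w * m2 + m1 ^+ 2 * Y a w * Y b w)%:E) /\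
    (\int[P]_w (Y a w * m2 + m1 ^+ 2 * Y a w * Y b w)%:E =
    m2%:E * \int[P]_w (Y a w)%:E + (m1 ^+ 2)%:E * \int[P]_w (Y a w * Y b w)%:E)%E.
  move=> a0 ab.
  under eq_fun do rewrite mulrC -mulrA EFinD.
  have i1 := iZ m2 _ (iY _ a0); have i2 := iZ (m1 ^+ 2) _ (iYY _ _ a0 ab).
  split; first exact: integrableD.
  rewrite integralD//; congr (_ + _)%E.
    by rewrite -integralZl//; exact: iY.
  by rewrite -integralZl//; exact: iYY.
have Smom := skellam_second_order_moments lambda_ge0 mu_ge0 gS.
have hC t : 0 <= t -> (\int[P]_w (Y t w * m2 + m1 ^+ 2 * Y t w * Y t w)%:E < +oo)%E.
  by move=> t0; apply: integrable_lty => //; have [] := hE t t t0 (lexx t).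
have SaY t : 0 <= t -> Sa t = time_change S Y t.
  by move=> t0; apply/funext => w; rewrite SaE.
have Yae t : 0 <= t -> {ae P, forall w, 0 <= Y t w} by move=> _; exact: aeW.
have Ymn s t : 0 <= s -> s <= t -> {ae P, forall w, Y s w <= Y t w}.
  by move=> _ st; apply: filterS Ymono => w; exact.
move=> a b a0 ab; rewrite !SaY//; last exact: le_trans ab.
split.
  rewrite (expectation_time_change indep (skellam_cvg_dyad gS) Yae Smom hC)//.
  under eq_integral do rewrite mulrC EFinM.
  rewrite integralZl//; last exact: iY.
  by have [+ _] := Ymom a b a0 ab; rewrite unlock => ->.
rewrite (expectation_time_changeM indep (skellam_cvg_dyad gS) Yae Ymn Smom hC)//.
have [_ ->] := hE a b a0 ab.
have [] := Ymom a b a0 ab; rewrite unlock => -> E.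
by rewrite E -!EFinM -EFinD.
Qed.

(** The inverse subordinator is nondecreasing and right continuous along the grid, so it approaches
    its limit from the right, where [S] is continuous. *)
Lemma gfsp_cvg_dyad : {ae P, forall w u, 0 <= u ->
  Sa (dyad n u) w @[n --> \oo] --> Sa u w}.
Proof.
move: gfspSa; rewrite /generalized_fractional_skellam_process.
case: eqP => [_ gS|_]; first exact: skellam_cvg_dyad gS.
move=> [S [D [gS stD _ SaE]]].
have [_ Ymono Ydyad] := stable_subordinator_inverse alpha_gt0 alpha_le1 stD.
have Scvg := skellam_right_cvg gS.
apply: filterS3 Ymono Ydyad Scvg => w Ym Yd Sc u u0.
under eq_fun do rewrite SaE ?(ltW (dyad_gt0 _ _))//.
rewrite SaE//; apply: (@cvg_right_seq _ (S ^~ w) (fun n => inverse_process D (dyad n u) w)).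
- by apply: Sc; exact: inverse_process_ge0.
- by move=> n; apply: Ym; exact/ltW/dyad_gt.
- exact: Yd.
Qed.

End fractional_skellam_moments.

(** Inversion is reduced to real powers of the positive and negative parts; at 0 all of these have
    the value 0. *)
Lemma measurable_invr (R : realType) : measurable_fun setT (@GRing.inv R).
Proof.
have -> : @GRing.inv R =
    fun x => Num.max x 0 `^ (- 1) - Num.max (- x) 0 `^ (- 1).
  apply/funext => x; rewrite !powR_inv1 ?le_max ?lexx ?orbT//.
  have [x0|x0] := leP 0 x.
    by rewrite max_r ?oppr_le0// invr0 subr0.
  by rewrite max_l ?oppr_ge0 ?(ltW x0)// invr0 sub0r invrN opprK.
have mpow (g : R -> R) : measurable_fun setT g ->
    measurable_fun setT (fun x => g x `^ (- 1)).
  exact: (measurableT_comp (measurable_powR (- 1))).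
by apply: measurable_funB; apply: mpow; apply: measurable_maxr.
Qed.

Lemma incomplete_beta_ge0 (R : realType) (a b x : R) : 0 <= incomplete_beta a b x.
Proof. by apply: Rintegral_ge0 => u _; rewrite mulr_ge0 ?powR_ge0. Qed.

Lemma measurable_incomplete_beta (R : realType) (a b : R) :
  measurable_fun setT (incomplete_beta a b).
Proof.
pose g (u : R) : R := u `^ (a - 1) * (1 - u) `^ (b - 1).
have mg : measurable_fun setT g.
  apply: measurable_funM => //.
  by apply: (measurableT_comp (measurable_powR (b - 1))); exact: measurable_funB.
pose F (z : R * R) : \bar R :=
  (((0 <= z.2)%R%:R * (z.2 <= z.1)%R%:R) * g z.2)%:E.
have F0 z : (0 <= F z)%E by rewrite lee_fin !mulr_ge0 ?powR_ge0.
have mF : measurable_fun setT F.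
  apply/measurable_EFinP; apply: measurable_funM; last first.
    exact: measurableT_comp mg measurable_snd.
  apply: measurable_funM; apply: measurableT_comp => //;
    by apply: measurable_fun_ler => //; exact: measurable_cst.
have -> : incomplete_beta a b =
    fine \o (fun x => \int[@lebesgue_measure R]_u F (x, u))%E.
  apply/funext => x; rewrite /= /incomplete_beta /Rintegral; congr fine.
  rewrite integral_mkcond; apply: eq_integral => u _.
  rewrite patchE mem_setE in_itv/= /F/=.
  by case: (0 <= u) => /=; case: (u <= x) => /=; rewrite ?(mul0r,mulr0,mul1r).
apply: measurableT_comp => //.
exact: (@measurable_fun_fubini_tonelli_F _ _ _ _ R (@lebesgue_measure R) F mF F0).
Qed.

(** * The final formulas, by a second time change *)

Section time_changed_fractional_skellam.
Context (R : realType) d (T : measurableType d) (P : probability T R).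
Variables (k : nat) (lambda mu : 'I_k -> R).
Hypothesis lambda_ge0 : forall j, 0 <= lambda j.
Hypothesis mu_ge0 : forall j, 0 <= mu j.
Variables (alpha : R) (Sa : R -> T -> R) (f : R -> R) (Df : R -> T -> R).
Hypotheses (alpha_gt0 : 0 < alpha) (alpha_le1 : alpha <= 1).
Hypothesis gfspSa : generalized_fractional_skellam_process P alpha lambda mu Sa.
Hypothesis subDf : levy_subordinator P f Df.
Hypothesis indep : independent_processes P Sa Df.
Hypothesis Df_lty : forall r t : R, 0 < r -> 0 <= t ->
  ('E_P[fun w => (Df t w `^ r)%R] < +oo)%E.

Let m1 : R := \sum_(j < k) j.+1%:R * (lambda j - mu j).
Let m2 : R := \sum_(j < k) j.+1%:R ^+ 2 * (lambda j + mu j).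
Let c := Gamma (1 + alpha).
Let l1 := m1 / c.
Let l2 := m2 / c.
Let dd := alpha * l1 ^+ 2 * beta alpha (1 + alpha).
Let Z := time_change Sa Df.

Let c_gt0 : 0 < c. Proof. exact: Gamma_gt0. Qed.
Let l2_ge0 : 0 <= l2.
Proof.
rewrite divr_ge0 ?(ltW c_gt0)// sumr_ge0// => j _.
by rewrite mulr_ge0 ?sqr_ge0// addr_ge0.
Qed.
Let dd_ge0 : 0 <= dd.
Proof.
apply: mulr_ge0; last exact: incomplete_beta_ge0.
by apply: mulr_ge0; [exact: ltW|exact: sqr_ge0].
Qed.

Let e t := m1 * (t `^ alpha / c).
Let h s t := m2 * (s `^ alpha / c) +
  m1 ^+ 2 * (fractional_kernel alpha s t + fractional_kernel alpha s s).

Let B s t := t `^ (2 * alpha) * incomplete_beta alpha (alpha + 1) (s / t).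

(** The [dd] term is the diagonal kernel, as [B s s] is s^(2 alpha) times a complete beta value. For
    s = 0 the quotient s / s is 0 and not 1, but the power in front vanishes. *)
Let hE s t : 0 <= s ->
  h s t = l2 * s `^ alpha + dd * s `^ (2 * alpha) + l1 ^+ 2 * alpha * B s t.
Proof.
have c0 : c != 0 by rewrite gt_eqF.
move=> s0; have -> : h s t = l2 * s `^ alpha + l1 ^+ 2 * alpha * B s s +
    l1 ^+ 2 * alpha * B s t.
  by rewrite /h /fractional_kernel -/c -/(B s t) -/(B s s) /l1 /l2; field.
congr (_ + _ + _); move: s0; rewrite le_eqVlt => /predU1P[<-|s0].
  by rewrite /B powR0 ?mul0r ?mulr0// mulf_neq0// gt_eqF.
by rewrite /B divff ?gt_eqF// /dd /beta [alpha + 1]addrC; ring.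
Qed.

Let mDf t : 0 <= t -> measurable_fun setT (Df t).
Proof. by case: subDf => -[mD _ _ _ _] _ _; exact: mD. Qed.

Let Df_mono s t : 0 <= s -> s <= t -> {ae P, forall w, Df s w <= Df t w}.
Proof.
by move=> s0 st; case: subDf => _ mono _; apply: filterS mono => w; exact.
Qed.

Let Df_ge0 t : 0 <= t -> {ae P, forall w, 0 <= Df t w}.
Proof.
move=> t0; case: subDf => -[_ D0 _ _ _] mono _.
by apply: filterS2 D0 mono => w D0w mono_w; rewrite -D0w mono_w.
Qed.

Local Open Scope ereal_scope.

Let M r t := \int[P]_w (Df t w `^ r)%:E.

Let mM r t : (0 <= t)%R -> measurable_fun setT (fun w => (Df t w `^ r)%:E).
Proof.
move=> t0; apply/measurable_EFinP.
exact: (measurableT_comp (measurable_powR r) (mDf t0)).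
Qed.

Let M_fin r t : (0 < r)%R -> (0 <= t)%R -> M r t \is a fin_num.
Proof.
move=> r0 t0; rewrite ge0_fin_numE.
  by move: (Df_lty r0 t0); rewrite unlock.
by apply: integral_ge0 => w _; rewrite lee_fin powR_ge0.
Qed.

Let mB s t : (0 <= s)%R -> (0 <= t)%R ->
  measurable_fun setT (fun w => (B (Df s w) (Df t w))%:E).
Proof.
move=> s0 t0; apply/measurable_EFinP; apply: measurable_funM.
  exact: (measurableT_comp (measurable_powR (2 * alpha)) (mDf t0)).
apply: (measurableT_comp (measurable_incomplete_beta alpha (alpha + 1))).
apply: measurable_funM; first exact: mDf.
exact: (measurableT_comp (@measurable_invr R) (mDf t0)).
Qed.

Let B_ge0 s t : (0 <= B s t)%R.
Proof. by rewrite mulr_ge0 ?powR_ge0 ?incomplete_beta_ge0. Qed.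

Let integral_h s t : (0 <= s)%R -> (0 <= t)%R ->
  \int[P]_w (h (Df s w) (Df t w))%:E =
  l2%:E * M alpha s + dd%:E * M (2 * alpha) s +
  (l1 ^+ 2 * alpha)%:E * \int[P]_w (B (Df s w) (Df t w))%:E.
Proof.
move=> s0 t0.
have pw (r x : R) : 0 <= (x `^ r)%:E by rewrite lee_fin powR_ge0.
have Bp w : 0 <= (B (Df s w) (Df t w))%:E by rewrite lee_fin B_ge0.
have l0 : 0 <= l2%:E by rewrite lee_fin.
have d0 : 0 <= dd%:E by rewrite lee_fin.
have q0 : 0 <= (l1 ^+ 2 * alpha)%:E by rewrite lee_fin mulr_ge0 ?sqr_ge0// ltW.
have m1' := measurable_funeM l2%:E (mM alpha s0).
have m2' := measurable_funeM dd%:E (mM (2 * alpha) s0).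
have m3' := measurable_funeM (l1 ^+ 2 * alpha)%:E (mB s0 t0).
transitivity (\int[P]_w (l2%:E * (Df s w `^ alpha)%:E +
    dd%:E * (Df s w `^ (2 * alpha))%:E +
    (l1 ^+ 2 * alpha)%:E * (B (Df s w) (Df t w))%:E)).
  by apply: eq_ae_integralT; apply: filterS (Df_ge0 s0) => w Dw; rewrite hE.
have a1 w : 0 <= l2%:E * (Df s w `^ alpha)%:E := mule_ge0 l0 (pw _ _).
have a2 w : 0 <= dd%:E * (Df s w `^ (2 * alpha))%:E := mule_ge0 d0 (pw _ _).
have a3 w : 0 <= (l1 ^+ 2 * alpha)%:E * (B (Df s w) (Df t w))%:E := mule_ge0 q0 (Bp w).
rewrite (ge0_integralD P measurableT (fun w _ => adde_ge0 (a1 w) (a2 w))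
  (emeasurable_funD m1' m2') (fun w _ => a3 w) m3').
rewrite (ge0_integralD P measurableT (fun w _ => a1 w) m1' (fun w _ => a2 w) m2').
rewrite (ge0_integralZl P measurableT (mM alpha s0) (fun w _ => pw _ _) l0).
rewrite (ge0_integralZl P measurableT (mM (2 * alpha) s0) (fun w _ => pw _ _) d0).
by rewrite (ge0_integralZl P measurableT (mB s0 t0) (fun w _ => Bp w) q0).
Qed.

Let integral_B_diag t : (0 <= t)%R ->
  (l1 ^+ 2 * alpha)%:E * \int[P]_w (B (Df t w) (Df t w))%:E =
  dd%:E * M (2 * alpha) t.
Proof.
move=> t0.
have q0 : (0 <= l1 ^+ 2 * alpha)%R by rewrite mulr_ge0 ?sqr_ge0// ltW.
have B0 w : setT w -> 0 <= (B (Df t w) (Df t w))%:E by move=> _; rewrite lee_fin B_ge0.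
have M0 w : setT w -> 0 <= (Df t w `^ (2 * alpha))%:E by move=> _; rewrite lee_fin powR_ge0.
rewrite -(ge0_integralZl P measurableT (mB t0 t0) B0) //.
rewrite -(ge0_integralZl P measurableT (mM (2 * alpha) t0) M0) //.
apply: eq_ae_integralT; apply: filterS (Df_ge0 t0) => w.
rewrite le_eqVlt => /predU1P[<-|w0].
  by rewrite /B powR0 ?mul0r ?mule0// mulf_neq0// gt_eqF.
rewrite -!EFinM; congr _%:E.
by rewrite /B divff ?gt_eqF// /dd /beta [(alpha + 1)%R]addrC; ring.
Qed.

(** The domination condition of the time change by [Df]; on the diagonal it amounts to finite
    moments of orders alpha and 2 alpha. *)
Let h_lty t : (0 <= t)%R -> \int[P]_w (h (Df t w) (Df t w))%:E < +oo.
Proof.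
move=> t0; rewrite integral_h// integral_B_diag//.
have a2 : (0 < 2 * alpha)%R by rewrite mulr_gt0.
rewrite -(fineK (M_fin alpha_gt0 t0)) -(fineK (M_fin a2 t0)).
by rewrite -!EFinM -!EFinD ltry.
Qed.

Let Sa_cvg := gfsp_cvg_dyad alpha_gt0 alpha_le1 gfspSa.
Let Sa_moments := gfsp_second_order_moments lambda_ge0 mu_ge0 alpha_gt0 alpha_le1 gfspSa.

Let integral_e t : (0 <= t)%R -> \int[P]_w (e (Df t w))%:E = l1%:E * M alpha t.
Proof.
move=> t0; rewrite -integralZl//.
  by apply: eq_integral => w _; rewrite -EFinM /e /l1; congr _%:E; ring.
apply: (integrable_ge0_fin (c := fine (M alpha t))) => //.
- exact: (measurableT_comp (measurable_powR alpha) (mDf t0)).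
- by move=> w; rewrite powR_ge0.
- by rewrite fineK// M_fin.
Qed.

Lemma tcgfsp_mean t : (0 <= t)%R ->
  'E_P[Z t] = l1%:E * 'E_P[fun w => (Df t w `^ alpha)%R].
Proof.
move=> t0; rewrite (expectation_time_change indep Sa_cvg Df_ge0 Sa_moments h_lty)//.
by rewrite integral_e// unlock.
Qed.

Lemma tcgfsp_covariance s t : (0 <= s)%R -> (s <= t)%R ->
  covariance P (Z s) (Z t) =
    l2%:E * 'E_P[fun w => (Df s w `^ alpha)%R] +
    dd%:E * 'E_P[fun w => (Df s w `^ (2 * alpha))%R] -
    (l1 ^+ 2)%:E * 'E_P[fun w => (Df s w `^ alpha)%R] *
      'E_P[fun w => (Df t w `^ alpha)%R] +
    (l1 ^+ 2 * alpha)%:E *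
      'E_P[fun w => (Df t w `^ (2 * alpha) *
        incomplete_beta alpha (alpha + 1) (Df s w / Df t w))%R].
Proof.
move=> s0 st; have t0 := le_trans s0 st.
rewrite (covariance_time_change indep Sa_cvg Df_ge0 Df_mono Sa_moments h_lty)//.
rewrite integral_h// !integral_e// [in RHS]unlock.
rewrite -[RHS]addeAC; congr (_ - _).
rewrite muleACA -EFinM.
by rewrite -expr2 muleA.
Qed.

Lemma tcgfsp_variance t : (0 <= t)%R ->
  'V_P[Z t] = 'E_P[fun w => (Df t w `^ alpha)%R] *
      (l2%:E - (l1 ^+ 2)%:E * 'E_P[fun w => (Df t w `^ alpha)%R]) +
    (2 * dd)%:E * 'E_P[fun w => (Df t w `^ (2 * alpha))%R].
Proof.
move=> t0; rewrite /variance tcgfsp_covariance// unlock.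
rewrite [X in _ + X](integral_B_diag t0) -/(M alpha t) -/(M (2 * alpha) t).
(* Once both moments are known to be real, the identity is one between real numbers, out of reach in
   the extended reals because of the subtraction. *)
have /fineK <- := M_fin alpha_gt0 t0.
have a2 : (0 < 2 * alpha)%R by rewrite mulr_gt0.
have /fineK <- := M_fin a2 t0.
by rewrite -!(EFinM, EFinN, EFinD); congr _%:E; ring.
Qed.

End time_changed_fractional_skellam.

Theorem mainTheorem16 (R : realType) (d : measure_display)
    (T : measurableType d) (P : probability T R)
    (k : nat) (hk : (0 < k)%N) (lambda mu : 'I_k -> R)
    (hlambda : forall j, 0 < lambda j) (hmu : forall j, 0 < mu j)
    (alpha : R) (halpha0 : 0 < alpha) (halpha1 : alpha <= 1)
    (Sa : R -> T -> R)
    (hSa : generalized_fractional_skellam_process P alpha lambda mu Sa)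
    (f : R -> R) (Df : R -> T -> R) (hDf : levy_subordinator P f Df)
    (hindep : independent_processes P Sa Df)
    (hmoments : forall r t : R, 0 < r -> 0 <= t ->
      ('E_P[fun w => (Df t w `^ r)%R] < +oo)%E) :
  let Z := time_change Sa Df in
  let m1 := \sum_(j < k) j.+1%:R * (lambda j - mu j) in
  let m2 := \sum_(j < k) j.+1%:R ^+ 2 * (lambda j + mu j) in
  let l1 := m1 / Gamma (1 + alpha) in
  let l2 := m2 / Gamma (1 + alpha) in
  let dd := alpha * l1 ^+ 2 * beta alpha (1 + alpha) in
  let EDf (r t : R) := 'E_P[fun w => (Df t w `^ r)%R]%E in
  forall s t : R, 0 < s -> s <= t ->
  [/\ 'E_P[Z t]%E = (l1%:E * EDf alpha t)%E,
      'V_P[Z t] =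
        (EDf alpha t * (l2%:E - (l1 ^+ 2)%:E * EDf alpha t)
         + (2 * dd)%:E * EDf (2 * alpha)%R t)%E
    & covariance P (Z s) (Z t) =
        (l2%:E * EDf alpha s + dd%:E * EDf (2 * alpha)%R s
         - (l1 ^+ 2)%:E * EDf alpha s * EDf alpha t
         + (l1 ^+ 2 * alpha)%:E *
           'E_P[fun w => (Df t w `^ (2 * alpha)
                  * incomplete_beta alpha (alpha + 1) (Df s w / Df t w))%R])%E].
Proof.
move=> Z m1 m2 l1 l2 dd EDf s t /ltW s0 st; have t0 := le_trans s0 st.
have lambda_ge0 j : 0 <= lambda j by exact/ltW/hlambda.
have mu_ge0 j : 0 <= mu j by exact/ltW/hmu.
split.
- exact: (tcgfsp_mean lambda_ge0 mu_ge0 halpha0 halpha1 hSa hDf hindep hmoments t0).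
- exact: (tcgfsp_variance lambda_ge0 mu_ge0 halpha0 halpha1 hSa hDf hindep hmoments t0).
- exact: (tcgfsp_covariance lambda_ge0 mu_ge0 halpha0 halpha1 hSa hDf hindep hmoments s0 st).
Qed.
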